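(* Let $f\colon X\to V$, $L$, $\phi\colon L^{1/p^e}\to R_{A^{1/p^e}}$ and $n_0$ be as in the context. Then there exists a nonempty open subset $U\subseteq V$ such that for all integers $m\ge n\ge n_0$ $$\sigma_m(X/V,\phi)|_{f^{-1}(U)}=\operatorname{Image}\Big(\sigma_n(X/V,\phi)\otimes_{A^{1/p^{ne}}}A^{1/p^{me}}\to R_{A^{1/p^{me}}}\Big)\Big|_{f^{-1}(U)}.$$
   Context: All schemes are Noetherian, all morphisms separated. $f\colon X\to V$ is a flat, equidimensional, geometrically reduced morphism of finite type (i.e. $X\times_V T$ is reduced for all $T\to V$ with $T$ integral) to an excellent integral scheme $V$ of characteristic $p>0$ with a dualizing complex. $V^i$ is $V$ viewed as the source of the iterated Frobenius $F_V^i\colon V^i\to V$, $X_{V^i}=X\times_V V^i$ (same topological space as $X$). Write $R=\mathcal{O}_X$, $A=f^{-1}\mathcal{O}_V$, $A^{1/p^i}=f^{-1}F^i_{V*}\mathcal{O}_V$, $R_{A^{1/p^i}}=R\otimes_AA^{1/p^i}=\mathcal{O}_{X_{V^i}}$, and $M^{1/p^i}=F^i_{X*}M$ for an $R$-module $M$. Fix $e>0$, a line bundle $L$ on $X$ and an $R_{A^{1/p^e}}$-linear map $\phi\colon L^{1/p^e}\to R_{A^{1/p^e}}$. $\phi^1=\phi$, and $\phi^n\colon\big(L^{\frac{p^{ne}-1}{p^e-1}}\big)^{1/p^{ne}}\to R_{A^{1/p^{ne}}}$ is the composition $$\Big(L\otimes_R\big(L^{\frac{p^{(n-1)e}-1}{p^e-1}}\big)^{1/p^{(n-1)e}}\Big)^{1/p^e}\xrightarrow{(\mathrm{id}\otimes\phi^{n-1})^{1/p^e}}\big(L\otimes_RR_{A^{1/p^{(n-1)e}}}\big)^{1/p^e}=L^{1/p^e}\otimes_{A^{1/p^e}}A^{1/p^{ne}}\xrightarrow{\phi\otimes\mathrm{id}}R_{A^{1/p^{ne}}}.$$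 $\sigma_n(X/V,\phi):=\operatorname{Image}(\phi^n)\subseteq R_{A^{1/p^{ne}}}$ (the $n$-th relative non-$F$-pure ideal). The integer $n_0$: let $k(V^\infty)$ be the perfect closure of the function field of $V$ and $R_{k(V^\infty)}=\mathcal{O}_{X\times_V\operatorname{Spec}k(V^\infty)}$. Base changing $\phi$ along $\operatorname{Spec}k(V^\infty)\to V$ and identifying $k(V^\infty)^{1/p^e}=k(V^\infty)$ gives an $R_{k(V^\infty)}$-linear map $\psi_\infty\colon(L_{k(V^\infty)})^{1/p^e}\to R_{k(V^\infty)}$ with iterates $\psi_\infty^n$ (formed as for $\phi^n$). The descending chain of ideals $\psi_\infty^n\big((L_{k(V^\infty)}^{\frac{p^{ne}-1}{p^e-1}})^{1/p^{ne}}\big)$ stabilizes; $n_0$ is an integer such that it is constant for $n\ge n_0$. *)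

(* Defs.v *)
From HB Require Import structures.
From mathcomp Require Import all_boot all_order all_algebra.
From mathcomp Require Import boolp classical_sets functions filter topology.
Set Implicit Arguments.
Unset Strict Implicit.
Unset Printing Implicit Defensive.
Import GRing.Theory.
Local Open Scope classical_set_scope.
Local Open Scope ring_scope.

(** Rings are [comPzRingType]s, because the ring of sections over the empty
    open set is the zero ring.  Localizations, completions and tensor products
    are described by predicates that characterize them up to isomorphism. *)

Section Ideals.
Variable R : comPzRingType.
Implicit Types (I P Q m : set R) (c : nat -> set R).

Definition invertible (x : R) := exists y, x * y = 1.

Definition is_ideal I :=
  [/\ I 0, forall x y, I x -> I y -> I (x + y) & forall a x, I x -> I (a * x)].

Definition prime_ideal P :=
  [/\ is_ideal P, ~ P 1 & forall x y, P (x * y) -> P x \/ P y].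

Definition ideal_span (E : set R) : set R :=
  fun x => forall I, is_ideal I -> E `<=` I -> I x.

Definition ideal_exp I (n : nat) : set R :=
  ideal_span [set x | exists2 g : 'I_n -> R, forall i, I (g i) & x = \prod_i g i].

Definition noetherian_ring :=
  forall I, is_ideal I -> exists n (g : 'I_n -> R), I = ideal_span (range g).

Definition domain_ring :=
  (1 : R) <> 0 /\ forall x y : R, x * y = 0 -> x = 0 \/ y = 0.

Definition reduced_ring := forall (x : R) n, x ^+ n = 0 -> x = 0.

Definition prime_chain n c :=
  (forall i, (i <= n)%N -> prime_ideal (c i)) /\
  (forall i, (i < n)%N -> c i `<` c i.+1).

Definition krull_dim n :=
  (exists c, prime_chain n c) /\ ~ (exists c, prime_chain n.+1 c).

Definition chain_between P Q n c := [/\ prime_chain n c, c 0 = P & c n = Q].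

Definition saturated_between P Q n c :=
  chain_between P Q n c /\
  forall i P', (i < n)%N -> prime_ideal P' -> ~ (c i `<` P' /\ P' `<` c i.+1).

Definition catenary := forall P Q, prime_ideal P -> prime_ideal Q -> P `<=` Q ->
  (exists N, forall n c, chain_between P Q n c -> (n <= N)%N) /\
  (forall n n' c c', saturated_between P Q n c -> saturated_between P Q n' c' ->
     n = n').

Definition local_ring m := is_ideal m /\ forall x, m x <-> ~ invertible x.

Definition regular_local_ring :=
  noetherian_ring /\ exists m d, [/\ local_ring m, krull_dim d &
    exists g : 'I_d -> R, m = ideal_span (range g)].

End Ideals.

Section LocalRings.
Variable R : comPzRingType.
Implicit Types (P m : set R).

Definition is_localization_at P (T : comPzRingType) (h : {rmorphism R -> T}) :=
  [/\ forall s, ~ P s -> invertible (h s),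
      forall t, exists s a, ~ P s /\ h s * t = h a &
      forall a, h a = 0 -> exists s, ~ P s /\ s * a = 0].

Definition regular_at P := forall (T : comPzRingType) (h : {rmorphism R -> T}),
  is_localization_at P h -> regular_local_ring T.

Definition regular_ring :=
  noetherian_ring R /\ forall P, prime_ideal P -> regular_at P.

(** [c : R -> C] exhibits [C] as the inverse limit of the [R / m ^ n]; [J n] is
    the kernel of the projection [C -> R / m ^ n]. *)
Definition is_completion m (C : comPzRingType) (c : {rmorphism R -> C}) :=
  exists J : nat -> set C,
  [/\ forall n, is_ideal (J n) /\ J n.+1 `<=` J n,
      forall n x, J n (c x) <-> ideal_exp m n x,
      forall n y, exists x, J n (y - c x),
      forall y, (forall n, J n y) -> y = 0 &
      forall t : nat -> R, (forall n, ideal_exp m n (t n.+1 - t n)) ->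
        exists y, forall n, J n (y - c (t n))].

End LocalRings.

Section Algebras.
Variables (A B : comPzRingType) (h : {rmorphism A -> B}).

Definition finite_type_algebra := exists n (g : 'I_n -> B), forall S : set B,
  (forall a, S (h a)) -> (forall i, S (g i)) ->
  (forall x y, S x -> S y -> S (x + y)) ->
  (forall x y, S x -> S y -> S (x * y)) -> forall b, S b.

Definition is_pushout (C D : comPzRingType) (k : {rmorphism A -> C})
    (i : {rmorphism B -> D}) (j : {rmorphism C -> D}) :=
  (forall a, i (h a) = j (k a)) /\
  forall (E : comPzRingType) (u : {rmorphism B -> E}) (v : {rmorphism C -> E}),
    (forall a, u (h a) = v (k a)) ->
    (exists w : {rmorphism D -> E},
       (forall b, w (i b) = u b) /\ (forall c, w (j c) = v c)) /\
    (forall w w' : {rmorphism D -> E},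
       (forall b, w (i b) = w' (i b)) -> (forall c, w (j c) = w' (j c)) ->
       w =1 w').

Definition balanced (N : lmodType A) (T : zmodType) (b : B -> N -> T) :=
  [/\ forall x x' n, b (x + x') n = b x n + b x' n,
      forall x n n', b x (n + n') = b x n + b x n' &
      forall a x n, b (h a * x) n = b x (a *: n)].

Definition is_tensor (N : lmodType A) (T : zmodType) (b : B -> N -> T) :=
  balanced b /\
  forall (T' : zmodType) (b' : B -> N -> T'), balanced b' ->
    (exists t : {additive T -> T'}, forall x n, t (b x n) = b' x n) /\
    (forall t t' : {additive T -> T'},
       (forall x n, t (b x n) = t' (b x n)) -> t =1 t').

Definition flat_ring_map := forall (N N' : lmodType A) (u : {linear N -> N'})
    (T T' : zmodType) (b : B -> N -> T) (b' : B -> N' -> T')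
    (t : {additive T -> T'}),
  injective u -> is_tensor b -> is_tensor b' ->
  (forall x n, t (b x n) = b' x (u n)) -> injective t.

(** [B (x)_A K] is Noetherian and regular for every prime [q] of [A] and every
    finite extension [K] of the residue field of [q]; such a [K] is given by a
    map [A -> K] with kernel [q]. *)
Definition geom_regular_fibres :=
  forall (K : fieldType) (chi : {rmorphism A -> K}),
    (exists n (g : 'I_n -> K), forall z, exists s (a : 'I_n -> A),
       chi s <> 0 /\ chi s * z = \sum_i chi (a i) * g i) ->
  forall (D : comPzRingType) (i : {rmorphism B -> D}) (j : {rmorphism K -> D}),
    is_pushout chi i j -> regular_ring D.

Definition regular_ring_map := flat_ring_map /\ geom_regular_fibres.

End Algebras.

Section Excellent.
Variable R : comPzRingType.

Definition universally_catenary :=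
  forall (S : comPzRingType) (h : {rmorphism R -> S}),
    finite_type_algebra h -> catenary S.

Definition G_ring := forall (P : set R) (T C : comPzRingType)
    (h : {rmorphism R -> T}) (m : set T) (c : {rmorphism T -> C}),
  prime_ideal P -> is_localization_at P h -> local_ring m ->
  is_completion m c -> regular_ring_map c.

Definition J2_ring := forall (S : comPzRingType) (h : {rmorphism R -> S}),
  finite_type_algebra h ->
  exists E : set S, forall P, prime_ideal P -> (regular_at P <-> ~ E `<=` P).

Definition excellent_ring :=
  [/\ noetherian_ring R, universally_catenary, G_ring & J2_ring].

End Excellent.

Record opens (X : topologicalType) :=
  Opens { oset : set X; oset_open : open oset }.

Section Opens.
Variable X : topologicalType.

Definition otop : opens X := Opens openT.
Definition osub (W U : opens X) : Prop := oset W `<=` oset U.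
Definition osub_refl U : osub U U := fun x h => h.
Definition osub_trans T W U (h2 : osub T W) (h1 : osub W U) : osub T U :=
  fun x h => h1 x (h2 x h).

(** "Every point of [U] has a neighbourhood [W] in [U] on which [P] holds." *)
Definition locally_on (U : opens X) (P : forall W, osub W U -> Prop) :=
  forall x, oset U x -> exists W (h : osub W U), oset W x /\ P W h.

End Opens.

Definition maps (X Y : topologicalType) (f : X -> Y) (W : opens X) (U : opens Y) :=
  forall x, oset W x -> oset U (f x).

Record ringedSpace := RingedSpace {
  rs_space :> topologicalType;
  sec : opens rs_space -> comPzRingType;
  res : forall U W, osub W U -> {rmorphism sec U -> sec W};
  res_id : forall U (h : osub U U) s, res h s = s;
  res_comp : forall U W T (h1 : osub W U) (h2 : osub T W) (h3 : osub T U) s,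
    res h2 (res h1 s) = res h3 s;
  sec_eq : forall U (s t : sec U),
    locally_on (fun W (h : osub W U) => res h s = res h t) -> s = t;
  sec_glue : forall U (I : Type) (D : I -> opens rs_space)
      (hD : forall i, osub (D i) U) (s : forall i, sec (D i)),
    (forall x, oset U x -> exists i, oset (D i) x) ->
    (forall i j W (hi : osub W (D i)) (hj : osub W (D j)),
       res hi (s i) = res hj (s j)) ->
    exists t, forall i, res (hD i) t = s i }.

Section RingedSpace.
Variable X : ringedSpace.

(** The germ of [s] at [x] is a unit of the stalk. *)
Definition unit_at (U : opens X) (s : sec U) (x : X) :=
  exists W (h : osub W U), oset W x /\ invertible (res h s).

Definition local_stalk (x : X) :=
  (forall U : opens X, oset U x -> (1 : sec U) <> 0) /\
  (forall (U : opens X) (s : sec U), oset U x -> unit_at s x \/ unit_at (1 - s) x).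

Definition is_stalk (x : X) (A : comPzRingType)
    (germ : forall U : opens X, oset U x -> {rmorphism sec U -> A}) :=
  [/\ forall U W (h : osub W U) (hU : oset U x) (hW : oset W x) s,
        germ W hW (res h s) = germ U hU s,
      forall a, exists U (hU : oset U x) s, germ U hU s = a &
      forall U (hU : oset U x) s, germ U hU s = 0 ->
        exists W (h : osub W U), oset W x /\ res h s = 0].

Lemma basic_open_subproof (U : opens X) (s : sec U) :
  open [set x | oset U x /\ unit_at s x].
Proof.
rewrite openE => x /= [Ux [W [h [Wx Ws]]]].
rewrite /interior nbhsE; exists (oset W).
  by split; [exact: oset_open | exact: Wx].
by move=> y Wy; split; [exact: (h y Wy) | exists W, h].
Qed.

Definition basic_open (U : opens X) (s : sec U) : opens X :=
  Opens (basic_open_subproof s).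

Definition basic_open_sub (U : opens X) (s : sec U) : osub (basic_open s) U :=
  fun x h => h.1.
Arguments basic_open_sub [U] s.

(** The canonical map from [U] to the spectrum of [sec U] is an isomorphism:
    it is bijective on points, it is a homeomorphism, and the sections over the
    basic open set of [s] are the localization of [sec U] at [s]. *)
Definition affine (U : opens X) :=
  [/\ forall x y, oset U x -> oset U y ->
        (forall s : sec U, unit_at s x <-> unit_at s y) -> x = y,
      forall P : set (sec U), prime_ideal P ->
        exists2 x, oset U x & P = [set s | ~ unit_at s x],
      forall W x, osub W U -> oset W x ->
        exists s : sec U, oset (basic_open s) x /\ osub (basic_open s) W,
      forall (s : sec U) (t : sec (basic_open s)), exists n a,
        res (basic_open_sub s) s ^+ n * t = res (basic_open_sub s) a &
      forall s a : sec U, res (basic_open_sub s) a = 0 -> exists n, s ^+ n * a = 0].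

End RingedSpace.
Arguments basic_open_sub {X U} s.

Record scheme := Scheme {
  sch_rs :> ringedSpace;
  sch_local : forall x : sch_rs, local_stalk x;
  sch_affine : forall x : sch_rs, exists2 U : opens sch_rs, oset U x & affine U }.

(** The comorphism is given for all pairs [(U, W)] with [W] in the preimage of
    [U], instead of only for [W] equal to the preimage of [U]. *)
Record mor (X Y : scheme) := Mor {
  mfun :> X -> Y;
  mcont : continuous mfun;
  comor : forall U W, maps mfun W U -> {rmorphism sec U -> sec W};
  comor_resl : forall U U' W (h : osub U U') (m : maps mfun W U)
      (m' : maps mfun W U') s, comor m (res h s) = comor m' s;
  comor_resr : forall U W W' (h : osub W' W) (m : maps mfun W U)
      (m' : maps mfun W' U) s, res h (comor m s) = comor m' s;
  mor_local : forall U W (m : maps mfun W U) s x,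
    oset W x -> unit_at (comor m s) x -> unit_at s (mfun x) }.

Section Pre.
Variables (X Y : scheme) (f : mor X Y).

Lemma pre_subproof (U : opens Y) : open [set x | oset U (f x)].
Proof. by apply: (open_comp _ (oset_open U)) => x _; exact: mcont. Qed.

Definition pre (U : opens Y) : opens X := Opens (pre_subproof U).

End Pre.

Definition mor_eq (X Y : scheme) (f g : mor X Y) :=
  (forall x, f x = g x) /\
  (forall U W (m : maps f W U) (m' : maps g W U) s, comor m s = comor m' s).
Notation "f =m g" := (mor_eq f g) (at level 70, no associativity).

Section IdMor.
Variable X : scheme.

Definition id_comor (U W : opens X) (m : maps id W U) : {rmorphism sec U -> sec W} :=
  res (m : osub W U).

Lemma id_cont : continuous (id : X -> X).
Proof. by move=> x A. Qed.

Lemma id_resl (U U' W : opens X) (h : osub U U') (m : maps id W U)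
  (m' : maps id W U') s : id_comor m (res h s) = id_comor m' s.
Proof. exact: res_comp. Qed.

Lemma id_resr (U W W' : opens X) (h : osub W' W) (m : maps id W U)
  (m' : maps id W' U) s : res h (id_comor m s) = id_comor m' s.
Proof. exact: res_comp. Qed.

Lemma id_local (U W : opens X) (m : maps id W U) (s : sec U) x :
  oset W x -> unit_at (id_comor m s) x -> unit_at s x.
Proof.
move=> Wx [T [h [Tx [t Ht]]]]; exists T, (osub_trans h m); split=> //.
by exists t; rewrite -Ht; congr (_ * _); rewrite (res_comp _ _ (osub_trans h m)).
Qed.

Definition idm : mor X X := Mor id_cont id_resl id_resr id_local.

End IdMor.

Section Comp.
Variables (X Y Z : scheme) (g : mor Y Z) (f : mor X Y).

Definition comp_fun (x : X) : Z := g (f x).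

Definition comp_comor U W (m : maps comp_fun W U) : {rmorphism sec U -> sec W} :=
  (comor (m : maps f W (pre g U)) \o comor ((fun y h => h) : maps g (pre g U) U))%FUN.

Lemma comp_cont : continuous comp_fun.
Proof.
move=> x; apply: (@continuous_comp _ _ _ f g); [exact: mcont | exact: mcont].
Qed.

Lemma comp_resl U U' W (h : osub U U') (m : maps comp_fun W U)
  (m' : maps comp_fun W U') s : comp_comor m (res h s) = comp_comor m' s.
Proof.
have hp : osub (pre g U) (pre g U') by move=> y; exact: h.
have k : maps g (pre g U) U' by move=> y; exact: hp.
rewrite /comp_comor /= (comor_resl h _ k).
by rewrite -(comor_resr hp (fun y h => h : oset U' (g y))) comor_resl.
Qed.

Lemma comp_resr U W W' (h : osub W' W) (m : maps comp_fun W U)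
  (m' : maps comp_fun W' U) s : res h (comp_comor m s) = comp_comor m' s.
Proof. exact: comor_resr. Qed.

Lemma comp_local U W (m : maps comp_fun W U) s x :
  oset W x -> unit_at (comp_comor m s) x -> unit_at s (comp_fun x).
Proof.
move=> Wx /(mor_local Wx) H.
exact: (mor_local (x:=f x) (m x Wx : oset (pre g U) (f x)) H).
Qed.

Definition cmor : mor X Z := Mor comp_cont comp_resl comp_resr comp_local.

End Comp.
Notation "g ∘m f" := (cmor g f) (at level 50, left associativity).

Definition has_char (p : nat) (X : scheme) := (p%:R : sec (otop X)) = 0.

Lemma has_char_dom p X V (f : mor X V) : has_char p V -> has_char p X.
Proof.
move=> hV; have m : maps f (otop X) (otop V) by [].
by rewrite /has_char -(rmorph_nat (comor m)) [p%:R](hV) rmorph0.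
Qed.

(** The [i]-th iterate of the absolute Frobenius. *)
Section Frobenius.
Variables (p : nat) (p_pr : prime p) (X : scheme) (hX : has_char p X) (i : nat).

Lemma sec_char (U : opens X) : (p%:R : sec U) = 0.
Proof.
have h : osub U (otop X) by [].
by rewrite -(rmorph_nat (res h)) [p%:R](hX) rmorph0.
Qed.

Section Fun.
Variables (U W : opens X) (m : maps id W U).

Definition frob_fun (s : sec U) : sec W := res (m : osub W U) s ^+ (p ^ i).

Lemma frob_add (R : comPzRingType) (x y : R) : p%:R = 0 :> R ->
  (x + y) ^+ (p ^ i) = x ^+ (p ^ i) + y ^+ (p ^ i).
Proof.
move=> hp; elim: i => [|j IH]; first by rewrite expn0 !expr1.
rewrite !expnSr !exprM IH exprDn.
case: p p_pr hp => [//|q] q_pr hp; rewrite big_ord_recr big_ord_recl /=.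
rewrite bin0 binn subn0 subnn !expr0 mulr1 mul1r !mulr1n big1 ?addr0 // => k _.
have : (q.+1 %| 'C(q.+1, (bump 0 k)))%N.
  by apply: prime_dvd_bin => //; rewrite /bump /= add1n ltnS ltn_ord.
by case/dvdnP => c ->; rewrite mulrnA -mulr_natr hp mulr0.
Qed.

Lemma frob_is_nmod : nmod_morphism frob_fun.
Proof.
split=> [|x y]; rewrite /frob_fun.
  by rewrite rmorph0 expr0n expn_eq0 eqn0Ngt prime_gt0.
by rewrite rmorphD frob_add // sec_char.
Qed.

Lemma frob_is_monoid : monoid_morphism frob_fun.
Proof.
by split=> [|x y]; rewrite /frob_fun ?rmorph1 ?expr1n // rmorphM exprMn.
Qed.

HB.instance Definition _ :=
  GRing.isNmodMorphism.Build (sec U) (sec W) frob_fun frob_is_nmod.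
HB.instance Definition _ :=
  GRing.isMonoidMorphism.Build (sec U) (sec W) frob_fun frob_is_monoid.

Definition frob_comor : {rmorphism sec U -> sec W} := frob_fun.

End Fun.

Lemma frob_resl (U U' W : opens X) (h : osub U U') (m : maps id W U)
  (m' : maps id W U') s : frob_comor m (res h s) = frob_comor m' s.
Proof. by rewrite /= /frob_fun (res_comp _ _ (m' : osub W U')). Qed.

Lemma frob_resr (U W W' : opens X) (h : osub W' W) (m : maps id W U)
  (m' : maps id W' U) s : res h (frob_comor m s) = frob_comor m' s.
Proof. by rewrite /= /frob_fun rmorphXn (res_comp _ _ (m' : osub W' U)). Qed.

Lemma frob_local (U W : opens X) (m : maps id W U) s x :
  oset W x -> unit_at (frob_comor m s) x -> unit_at s x.
Proof.
move=> Wx [T [h [Tx [t Ht]]]].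
apply: (id_local (m:=m) Wx); exists T, h; split=> //.
have ->: id_comor m s = res (m : osub W U) s by [].
move: Ht; rewrite /= /frob_fun rmorphXn.
have: (0 < p ^ i)%N by rewrite expn_gt0 prime_gt0.
case: (p ^ i)%N => // n _; rewrite exprS -mulrA => H.
by exists (res h (res (m : osub W U) s) ^+ n * t).
Qed.

Definition frob : mor X X :=
  Mor (@id_cont X) frob_resl frob_resr frob_local.

End Frobenius.

Lemma frob_comm p (p_pr : prime p) X V (f : mor X V) (hX : has_char p X)
    (hV : has_char p V) i :
  f ∘m frob p_pr hX i =m frob p_pr hV i ∘m f.
Proof.
split=> // U W m m' s; rewrite /= /comp_comor /= /frob_fun.
rewrite rmorphXn; congr (_ ^+ _).
rewrite (comor_resr _ _ (m : maps f W U)).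
by rewrite (comor_resl _ _ (m : maps f W U)).
Qed.

Definition integral_scheme (X : scheme) :=
  (exists x : X, True) /\
  forall U : opens X, (exists x, oset U x) -> domain_ring (sec U).

Definition reduced_scheme (X : scheme) := forall U : opens X, reduced_ring (sec U).

Definition noetherian_scheme (X : scheme) := exists n (W : 'I_n -> opens X),
  (forall i, affine (W i) /\ noetherian_ring (sec (W i))) /\
  (forall x, exists i, oset (W i) x).

Definition excellent_scheme (X : scheme) := forall x : X,
  exists U : opens X, [/\ oset U x, affine U & excellent_ring (sec U)].

Record fiber_product (X Y V : scheme) (f : mor X V) (g : mor Y V) := FiberProduct {
  fp_obj :> scheme;
  fp1 : mor fp_obj X;
  fp2 : mor fp_obj Y;
  fp_comm : f ∘m fp1 =m g ∘m fp2;
  fp_lift : forall (T : scheme) (u : mor T X) (v : mor T Y),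
    f ∘m u =m g ∘m v -> mor T fp_obj;
  fp_lift1 : forall T u v (h : f ∘m u =m g ∘m v), fp1 ∘m @fp_lift T u v h =m u;
  fp_lift2 : forall T u v (h : f ∘m u =m g ∘m v), fp2 ∘m @fp_lift T u v h =m v;
  fp_uniq : forall T (w w' : mor T fp_obj),
    fp1 ∘m w =m fp1 ∘m w' -> fp2 ∘m w =m fp2 ∘m w' -> w =m w' }.
Arguments fp1 {X Y V f g} P : rename.
Arguments fp2 {X Y V f g} P : rename.
Arguments fp_lift {X Y V f g} P {T u v} h : rename.

Lemma mor_eq_refl X Y (f : mor X Y) : f =m f.
Proof.
split=> // U W m m' s; suff -> : m = m' by [].
exact: Prop_irrelevance.
Qed.

Definition closed_immersion (X Y : scheme) (i : mor X Y) :=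
  [/\ injective i,
      forall Z : set X, closed Z -> closed (i @` Z) &
      forall (W : opens X) (s : sec W), locally_on (fun W' (h : osub W' W) =>
        exists U (m : maps i W' U) t, comor m t = res h s)].

Section MorphismProperties.
Variables (X V : scheme) (f : mor X V).

Definition separated_mor := forall P : fiber_product f f,
  closed_immersion (fp_lift P (mor_eq_refl (f ∘m idm X))).

Definition finite_type_mor := forall v : V, exists W : opens V,
  [/\ oset W v, affine W & exists n (U : 'I_n -> opens X),
    (forall x, oset W (f x) <-> exists i, oset (U i) x) /\
    (forall i, affine (U i) /\
       forall m : maps f (U i) W, finite_type_algebra (comor m))].

Definition flat_mor := forall (x : X) (A B : comPzRingType)
    (germA : forall U : opens V, oset U (f x) -> {rmorphism sec U -> A})
    (germB : forall W : opens X, oset W x -> {rmorphism sec W -> B})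
    (h : {rmorphism A -> B}),
  is_stalk germA -> is_stalk germB ->
  (forall U W (hU : oset U (f x)) (hW : oset W x) (m : maps f W U) s,
     h (germA U hU s) = germB W hW (comor m s)) ->
  flat_ring_map h.

End MorphismProperties.

(** Dimensions of fibres depend only on the underlying topological spaces. *)
Section Dimension.
Variable X : topologicalType.
Implicit Types (S C Z : set X) (z : nat -> set X).

Definition irreducible_set S := S !=set0 /\
  forall O1 O2, open O1 -> open O2 -> S `&` O1 !=set0 -> S `&` O2 !=set0 ->
    S `&` (O1 `&` O2) !=set0.

Definition irreducible_component S C :=
  [/\ C `<=` S, irreducible_set C &
      forall C', C' `<=` S -> irreducible_set C' -> C `<=` C' -> C' = C].

Definition closed_chain C n z :=
  (forall i, (i <= n)%N -> irreducible_set (z i) /\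
     exists2 Z, closed Z & z i = C `&` Z) /\
  (forall i, (i < n)%N -> z i `<` z i.+1).

Definition top_dim C n :=
  (exists z, closed_chain C n z) /\ ~ (exists z, closed_chain C n.+1 z).

End Dimension.

Definition equidimensional (X V : scheme) (f : mor X V) := exists d : nat,
  forall v (C : set X), irreducible_component [set x | f x = v] C -> top_dim C d.

Definition geometrically_reduced (X V : scheme) (f : mor X V) :=
  forall (T : scheme) (g : mor T V),
    integral_scheme T -> noetherian_scheme T -> separated_mor g ->
  forall P : fiber_product f g, reduced_scheme P.

Record Omod (X : ringedSpace) := OMod {
  msec :> forall U : opens X, lmodType (sec U);
  mres : forall U W : opens X, osub W U -> msec U -> msec W;
  mres_id : forall U (h : osub U U) s, mres h s = s;
  mres_comp : forall U W T (h1 : osub W U) (h2 : osub T W) (h3 : osub T U) s,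
    mres h2 (mres h1 s) = mres h3 s;
  mresD : forall U W (h : osub W U) s t, mres h (s + t) = mres h s + mres h t;
  mresZ : forall U W (h : osub W U) (a : sec U) s,
    mres h (a *: s) = res h a *: mres h s;
  msec_eq : forall U (s t : msec U),
    locally_on (fun W (h : osub W U) => mres h s = mres h t) -> s = t;
  msec_glue : forall U (I : Type) (D : I -> opens X)
      (hD : forall i, osub (D i) U) (s : forall i, msec (D i)),
    (forall x, oset U x -> exists i, oset (D i) x) ->
    (forall i j W (hi : osub W (D i)) (hj : osub W (D j)),
       mres hi (s i) = mres hj (s j)) ->
    exists t, forall i, mres (hD i) t = s i }.

Definition Oreg (X : ringedSpace) : Omod X :=
  @OMod X (fun U => (sec U)^o) (fun U W h => res h)
    (@res_id X) (@res_comp X)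
    (fun U W h => rmorphD (res h)) (fun U W h => rmorphM (res h))
    (@sec_eq X) (@sec_glue X).

Section Modules.
Variable X : ringedSpace.

Record mhom (M N : Omod X) := MHom {
  mh_fun :> forall U, M U -> N U;
  mhD : forall U (s t : M U), mh_fun (s + t) = mh_fun s + mh_fun t;
  mhZ : forall U (a : sec U) (s : M U), mh_fun (a *: s) = a *: mh_fun s;
  mh_res : forall U W (h : osub W U) (s : M U),
    mh_fun (mres h s) = mres h (mh_fun s) }.

Record bilin (M N P : Omod X) := Bilin {
  bl_fun :> forall U, M U -> N U -> P U;
  blDl : forall U (s s' : M U) (t : N U), bl_fun (s + s') t = bl_fun s t + bl_fun s' t;
  blDr : forall U (s : M U) (t t' : N U), bl_fun s (t + t') = bl_fun s t + bl_fun s t';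
  blZl : forall U (a : sec U) (s : M U) (t : N U), bl_fun (a *: s) t = a *: bl_fun s t;
  blZr : forall U (a : sec U) (s : M U) (t : N U), bl_fun s (a *: t) = a *: bl_fun s t;
  bl_res : forall U W (h : osub W U) (s : M U) (t : N U),
    bl_fun (mres h s) (mres h t) = mres h (bl_fun s t) }.

Definition is_sheaf_tensor (M N P : Omod X) (b : bilin M N P) :=
  forall (Q : Omod X) (b' : bilin M N Q),
    (exists h : mhom P Q, forall U (s : M U) (t : N U), h U (b U s t) = b' U s t) /\
    (forall h h' : mhom P Q,
       (forall U (s : M U) (t : N U), h U (b U s t) = h' U (b U s t)) ->
       forall U (x : P U), h U x = h' U x).

Definition line_bundle (L : Omod X) := forall x : X,
  exists (W : opens X) (l : L W), oset W x /\
    forall U (h : osub U W), bijective (fun a : sec U => a *: mres h l).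

(** The tensor powers of [L], with [tp_pow 0] the structure sheaf and
    [tp_pow k.+1] the tensor product of [L] and [tp_pow k]. *)
Record tensor_powers (L : Omod X) := TensorPowers {
  tp_pow :> nat -> Omod X;
  tp_one : mhom (Oreg X) (tp_pow 0);
  tp_one_bij : forall U, bijective (tp_one U);
  tp_bil : forall k, bilin L (tp_pow k) (tp_pow k.+1);
  tp_univ : forall k, is_sheaf_tensor (tp_bil k) }.

(** [l ^ k * m], the image of [l (x) ... (x) l (x) m]. *)
Fixpoint tp_mul (L : Omod X) (P : tensor_powers L) U (l : L U) k c (m : P c U) :
    P (k + c)%N U :=
  match k with
  | 0 => m
  | k'.+1 => tp_bil P (k' + c) U l (tp_mul l k' m)
  end.

Definition finite_type_module (M : Omod X) := forall x : X,
  exists (W : opens X) n (g : 'I_n -> M W), oset W x /\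
    forall U (h : osub U W) (s : M U), locally_on (fun U' (h' : osub U' U) =>
      exists a : 'I_n -> sec U',
        mres h' s = \sum_i a i *: mres (osub_trans h' h) (g i)).

(** Finite type, and the relations between finitely many sections over an open
    set are of finite type. *)
Definition coherent (M : Omod X) := finite_type_module M /\
  forall (U : opens X) n (g : 'I_n -> M U), locally_on (fun W (h : osub W U) =>
    exists k (r : 'I_k -> 'I_n -> sec W),
      (forall j, \sum_i r j i *: mres h (g i) = 0) /\
      forall W' (h' : osub W' W) (a : 'I_n -> sec W'),
        \sum_i a i *: mres (osub_trans h' h) (g i) = 0 ->
        locally_on (fun T (t : osub T W') => exists b : 'I_k -> sec T,
          forall i, res t (a i) = \sum_j b j * res (osub_trans t h') (r j i))).

Definition injective_module (I : Omod X) :=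
  forall (M N : Omod X) (u : mhom M N) (v : mhom M I),
    (forall U, injective (u U)) ->
    exists w : mhom N I, forall U (x : M U), w U (u U x) = v U x.

(** Degrees are indexed by [int], and maps between degrees are indexed by an
    equation between the degrees. *)

Record omod_complex := OmodComplex {
  cx :> int -> Omod X;
  cxd : forall i j : int, j = i + 1 -> mhom (cx i) (cx j);
  cxdd : forall i j k (h : j = i + 1) (h' : k = j + 1) U (x : cx i U),
    cxd h' U (cxd h U x) = 0 }.

Definition bounded_complex (I : omod_complex) := exists N : nat,
  forall (i : int) U (x : I i U), (N < absz i)%N -> x = 0.

Definition local_boundary (I : omod_complex) (j : int) (U : opens X) (x : I j U) :=
  locally_on (fun W (h : osub W U) => exists i (e : j = i + 1) (y : I i W),
    mres h x = cxd I e W y).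

(** [q] is only relevant on cocycles, where it is the projection onto the
    cohomology sheaf [H]. *)
Definition is_cohomology_sheaf (I : omod_complex) (j : int) (H : Omod X)
    (q : forall U, I j U -> H U) :=
  let Z U (x : I j U) := forall k (e : k = j + 1), cxd I e U x = 0 in
  [/\ forall U (x y : I j U), Z U x -> Z U y -> q U (x + y) = q U x + q U y,
      forall U (a : sec U) (x : I j U), Z U x -> q U (a *: x) = a *: q U x,
      forall U W (h : osub W U) (x : I j U), Z U x -> q W (mres h x) = mres h (q U x),
      forall U (y : H U), locally_on (fun W (h : osub W U) =>
        exists2 x : I j W, Z W x & q W x = mres h y) &
      forall U (x : I j U), Z U x -> (q U x = 0 <-> local_boundary x)].

(** Sections over [U] of the degree [n] term of the complex Hom(I, I): families
    of morphisms from [I i] to [I (i + n)] over [U], for all [i]. *)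
Definition homfam (I : omod_complex) (U : opens X) (n : int) :=
  forall i j : int, j = i + n -> forall W, osub W U -> I i W -> I j W.

Definition is_homfam (I : omod_complex) U n (h : homfam I U n) :=
  forall i j (e : j = i + n),
  [/\ forall W (w : osub W U) x y, h i j e W w (x + y) = h i j e W w x + h i j e W w y,
      forall W (w : osub W U) (a : sec W) x,
        h i j e W w (a *: x) = a *: h i j e W w x &
      forall W W' (w : osub W U) (w' : osub W' W) x,
        h i j e W' (osub_trans w' w) (mres w' x) = mres w' (h i j e W w x)].

Definition homfam_res (I : omod_complex) U W (w : osub W U) n (h : homfam I U n) :
    homfam I W n :=
  fun i j e T t => h i j e T (osub_trans t w).
Arguments homfam_res {I U W} w {n} h i j _ _ _ _.

(** The differential [h |-> d h - (-1) ^ n h d], for [n' = n + 1]. *)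
Definition homfam_diff (I : omod_complex) U n n' (h : homfam I U n) (g : homfam I U n') :=
  forall i j i' k (e : j = i + n) (e' : k = i' + n) (g_e : k = i + n')
      (d : i' = i + 1) (d' : k = j + 1) W (w : osub W U) (x : I i W),
    g i k g_e W w x =
      cxd I d' W (h i j e W w x)
      - (-1) ^+ absz n *: h i' k e' W w (cxd I d W x).

Definition homfam_cocycle (I : omod_complex) U n (h : homfam I U n) :=
  @homfam_diff I U n (n + 1) h (fun i j e W w x => 0).

Definition homfam_scalar (I : omod_complex) U (a : sec U) (h : homfam I U 0) :=
  forall i (e : i = i + 0) W (w : osub W U) (x : I i W),
    h i i e W w x = res w a *: x.

Definition homfam_add (I : omod_complex) U n (h g : homfam I U n) : homfam I U n :=
  fun i j e W w x => h i j e W w x + g i j e W w x.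
Arguments homfam_add {I U n} h g i j _ _ _ _.

(** A complex [I] as below has coherent cohomology and finite injective
    dimension, and Hom(I, I) computes its derived endomorphisms; the last three
    clauses say that the map from the structure sheaf to Hom(I, I) is a
    quasi-isomorphism (injective on H^0, surjective on H^0, zero cohomology in
    the other degrees). *)
Definition dualizing_complex (I : omod_complex) :=
  [/\ bounded_complex I,
      forall i, injective_module (I i),
      forall i, exists H q, @is_cohomology_sheaf I i H q /\ coherent H &
  [/\ forall (U : opens X) (a : sec U) (h : homfam I U 0) (g : homfam I U (-1)),
        is_homfam h -> homfam_scalar a h -> is_homfam g -> homfam_diff g h -> a = 0,
      forall (U : opens X) (h : homfam I U 0), is_homfam h -> homfam_cocycle h ->
        locally_on (fun W (w : osub W U) =>
          exists (a : sec W) (s b : homfam I W 0) (g : homfam I W (-1)),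
          [/\ is_homfam s, is_homfam b, is_homfam g, homfam_scalar a s &
              homfam_diff g b /\
              forall i j e T t x,
                homfam_res w h i j e T t x = homfam_add s b i j e T t x]) &
      forall (n n0 : int) (U : opens X) (h : homfam I U n), n <> 0 -> n = n0 + 1 ->
        is_homfam h -> homfam_cocycle h ->
        locally_on (fun W (w : osub W U) =>
          exists2 g : homfam I W n0, is_homfam g & homfam_diff g (homfam_res w h))]].

End Modules.
Arguments homfam_res {X I U W} w {n} h i j _ _ _ _.
Arguments homfam_add {X I U n} h g i j _ _ _ _.

(** An additive map from [t^-1 M] to [N], for [t : Q -> S]; equivalently, from
    [M] to [t_* N]. *)
Record addhom (Q S : scheme) (t : mor Q S) (M : Omod S) (N : Omod Q) := AddHom {
  ah_fun :> forall U W, maps t W U -> M U -> N W;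
  ahD : forall U W (m : maps t W U) (x y : M U),
    ah_fun m (x + y) = ah_fun m x + ah_fun m y;
  ah_resl : forall U U' W (h : osub U U') (m : maps t W U) (m' : maps t W U') (x : M U'),
    ah_fun m (mres h x) = ah_fun m' x;
  ah_resr : forall U W W' (h : osub W' W) (m : maps t W U) (m' : maps t W' U) (x : M U),
    mres h (ah_fun m x) = ah_fun m' x }.

Definition semilinear (Q S : scheme) (t : mor Q S) (M : Omod S) (N : Omod Q)
    (u : addhom t M N) :=
  forall U W (m : maps t W U) (a : sec U) (x : M U),
    u U W m (a *: x) = comor m a *: u U W m x.

(** [N] is the pullback [t^* M], with [eta] the universal map. *)
Definition is_module_pullback (Q S : scheme) (t : mor Q S) (M : Omod S) (N : Omod Q)
    (eta : addhom t M N) :=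
  semilinear eta /\
  forall (N' : Omod Q) (u : addhom t M N'), semilinear u ->
    (exists h : mhom N N', forall U W (m : maps t W U) (x : M U),
       h W (eta U W m x) = u U W m x) /\
    (forall h h' : mhom N N',
       (forall U W (m : maps t W U) (x : M U),
          h W (eta U W m x) = h' W (eta U W m x)) ->
       forall W (y : N W), h W y = h' W y).

Record module_pullback (Q S : scheme) (t : mor Q S) (M : Omod S) := ModulePullback {
  mp_mod :> Omod Q;
  mp_map : addhom t M mp_mod;
  mp_univ : is_module_pullback mp_map }.

Definition image_sheaf (Q S : scheme) (t : mor Q S) (M : Omod S) (N : Omod Q)
    (u : addhom t M N) (W : opens Q) (s : N W) : Prop :=
  locally_on (fun W' (h : osub W' W) =>
    exists U (m : maps t W' U) (x : M U), u U W' m x = mres h s).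

(** [(p ^ (n * e) - 1) / (p ^ e - 1)], see [tw_exp_div]. *)
Fixpoint tw_exp (p e n : nat) : nat :=
  if n is n'.+1 then (p ^ (n' * e) + tw_exp p e n')%N else 0%N.

Lemma tw_exp_div p e n : prime p -> (0 < e)%N ->
  tw_exp p e n = ((p ^ (n * e)).-1 %/ (p ^ e).-1)%N.
Proof.
move=> p_pr e_gt0; have p1 : (1 < p ^ e)%N.
  by rewrite -(exp1n e) ltn_exp2r // prime_gt1.
have q_gt0 : (0 < (p ^ e).-1)%N by rewrite -subn1 subn_gt0.
suff <- : (tw_exp p e n * (p ^ e).-1)%N = (p ^ (n * e)).-1 by rewrite mulnK.
elim: n => [|n IH] /=; first by rewrite mul0n.
rewrite mulnDl IH mulSn expnD -!subn1 mulnBr muln1 mulnC.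
have a : (0 < p ^ (n * e))%N by rewrite expn_gt0 prime_gt0.
rewrite addnBA // subnK //.
by rewrite leq_pmull // (ltn_trans _ p1).
Qed.

Section Relative.
Variables (p : nat) (p_pr : prime p) (X V : scheme) (f : mor X V).
Variable hV : has_char p V.
Let hX : has_char p X := has_char_dom f hV.

(** [XF i] is the base change of [X] along [V^i -> V].  The projection
    [fp1 (XF i)] is the homeomorphism by which sheaves on [XF i] are seen as
    sheaves on [X]. *)
Definition frob_base_changes := forall i, fiber_product f (frob p_pr hV i).

Variable XF : frob_base_changes.

(** The relative Frobenius [X^e -> X_{V^e}]; through it the [X_{V^e}]-scalars
    act on [M ^ (1 / p ^ e)] for every module [M] on [X]. *)
Definition rel_frob (e : nat) : mor X (XF e) :=
  fp_lift (XF e) (frob_comm p_pr f hX hV e).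

Definition relative_linear (e : nat) (L : Omod X)
    (phi : addhom (fp1 (XF e)) L (Oreg (XF e))) :=
  forall (U : opens X) (l : L U) (T : opens (XF e)) (mT : maps (rel_frob e) U T)
      (s : sec T) (T' : opens (XF e)) (h : osub T' T) (m : maps (fp1 (XF e)) T' U),
    phi U T' m (comor mT s *: l) = res h s * phi U T' m l.

End Relative.

(** Given [phi : L ^ (1 / p ^ e) -> O_{X_{V^e}}] and [g : V' -> V], let [P0] be
    the base change of [X] along [g] and [P1] the one along
    [V'^e -> V' -> V], so that [P1] is the base change of [P0] along [V'^e -> V'].
    The base change of [phi] is the map
    [(L (x)_A A') ^ (1 / p ^ e) = L ^ (1 / p ^ e) (x) A' ^ (1 / p ^ e) -> O_{P1}]
    with [l (x) c |-> phi l (x) c ^ (1 / p ^ e)].  Here [u : P1 -> X_{V^e}] and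
    [j : P1 -> P0] are the projections. *)
Section BaseChange.
Variables (p : nat) (p_pr : prime p) (X V V' : scheme) (f : mor X V) (g : mor V' V).
Variables (hV : has_char p V) (e : nat).
Let hV' : has_char p V' := has_char_dom g hV.
Variables (Xe : fiber_product f (frob p_pr hV e)) (P0 : fiber_product f g).
Variables (g1 : mor V' V) (P1 : fiber_product f g1).
Variables (u : mor P1 Xe) (j : mor P1 P0).

Definition base_change_projections :=
  [/\ g1 =m g ∘m frob p_pr hV' e,
      fp1 Xe ∘m u =m fp1 P1 /\ fp2 Xe ∘m u =m g ∘m fp2 P1 &
      fp1 P0 ∘m j =m fp1 P1 /\ fp2 P0 ∘m j =m frob p_pr hV' e ∘m fp2 P1].

Variables (L : Omod X) (phi : addhom (fp1 Xe) L (Oreg Xe)).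
Variable L' : module_pullback (fp1 P0) L.

Definition is_base_change (phi' : addhom j L' (Oreg P1)) :=
  forall (U : opens X) (l : L U) (C : opens V') (c : sec C)
      (T : opens P0) (mT : maps (fp1 P0) T U) (mC : maps (fp2 P0) T C)
      (S : opens Xe) (mS : maps (fp1 Xe) S U)
      (W : opens P1) (mj : maps j W T) (mu : maps u W S) (mW : maps (fp2 P1) W C),
    phi' T W mj (comor mC c *: mp_map L' U T mT l) =
    comor mu (phi U S mS l : sec S) * comor mW c.

End BaseChange.

Section Iterates.
Variables (p : nat) (p_pr : prime p) (X V : scheme) (f : mor X V).
Variables (hV : has_char p V) (e : nat) (XF : frob_base_changes p_pr f hV).
Variables (L : Omod X) (Lp : tensor_powers L).

(** [tr i k] is, for [i <= k], the projection [X_{V^k} -> X_{V^i}] over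
    [F ^ (k - i) : V^k -> V^i]; it is unconstrained for [k < i]. *)
Definition frob_transitions (tr : forall i k, mor (XF k) (XF i)) :=
  forall i j k, k = (i + j)%N ->
    fp1 (XF i) ∘m tr i k =m fp1 (XF k) /\
    fp2 (XF i) ∘m tr i k =m frob p_pr hV j ∘m fp2 (XF k).

Variable tr : forall i k, mor (XF k) (XF i).
Variable LF : forall i, module_pullback (fp1 (XF i)) L.
Variable phi : addhom (fp1 (XF e)) L (Oreg (XF e)).

(** [phib j] is [phi (x) id : L ^ (1 / p ^ e) (x) A ^ (1 / p ^ (e + j)) ->
    R_{A ^ (1 / p ^ (e + j))}], the base change of [phi] along [V^j -> V]. *)
Definition frob_twists
    (phib : forall j, addhom (tr j (e + j)%N) (LF j) (Oreg (XF (e + j)%N))) :=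
  forall j, is_base_change (tr e (e + j)%N) phi (phib j).

Variable phib : forall j, addhom (tr j (e + j)%N) (LF j) (Oreg (XF (e + j)%N)).

(** [phin n] is defined on the [tw_exp p e n]-th power of [L].  The clause for
    [n.+1] is the composition of [id (x) phi^n] and [phi (x) id], where the
    projection formula identifies [L (x) (L ^ c) ^ (1 / p ^ N)] with
    [(L ^ (p ^ N + c)) ^ (1 / p ^ N)] by [l (x) m |-> l ^ (p ^ N) m].  There is
    no clause for [n = 0]. *)
Definition relative_iterates
    (phin : forall n, addhom (fp1 (XF (n * e)%N)) (Lp (tw_exp p e n)) (Oreg (XF (n * e)%N))) :=
  (forall (U : opens X) (l : L U) (W : opens (XF (1 * e)%N)) (m : maps (fp1 (XF (1 * e)%N)) W U)
      (W' : opens (XF e)) (m' : maps (fp1 (XF e)) W' U)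
      (t : maps (tr e (1 * e)%N) W W'),
     phin 1%N U W m (tp_bil Lp 0 U l (tp_one Lp U 1)) =
     comor t (phi U W' m' l : sec W')) /\
  (forall n, (0 < n)%N ->
     forall (U : opens X) (l : L U) (x : Lp (tw_exp p e n) U)
       (T : opens (XF (n * e)%N)) (mT : maps (fp1 (XF (n * e)%N)) T U)
       (W : opens (XF (n.+1 * e)%N)) (mW : maps (fp1 (XF (n.+1 * e)%N)) W U)
       (t : maps (tr (n * e)%N (n.+1 * e)%N) W T),
     phin n.+1 U W mW (tp_mul l (p ^ (n * e)) x) =
     phib (n * e)%N T W t ((phin n U T mT x : sec T) *: mp_map (LF (n * e)%N) U T mT l)).

Variable phin :
  forall n, addhom (fp1 (XF (n * e)%N)) (Lp (tw_exp p e n)) (Oreg (XF (n * e)%N)).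

(** The [n]-th relative non-F-pure ideal, as an ideal sheaf on [X_{V^(n e)}]. *)
Definition sigma (n : nat) (W : opens (XF (n * e)%N)) (s : sec W) : Prop :=
  image_sheaf (phin n) (s : Oreg _ W).

(** The image of [sigma n (x)_{A ^ (1 / p ^ (n e))} A ^ (1 / p ^ (m e))] in the
    structure sheaf of [X_{V^(m e)}]. *)
Definition sigma_base_change (n m : nat) (W : opens (XF (m * e)%N)) (s : sec W) : Prop :=
  locally_on (fun W' (h : osub W' W) =>
    exists (T : opens (XF (n * e)%N)) (C : opens V)
      (t : maps (tr (n * e)%N (m * e)%N) W' T) (b : maps (fp2 (XF (m * e)%N)) W' C)
      (k : nat) (y : 'I_k -> sec T) (c : 'I_k -> sec C),
      (forall i, sigma (y i)) /\
      res h s = \sum_i comor t (y i) * comor b (c i)).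

End Iterates.

Definition generic_point (V : scheme) (x : V) :=
  forall U : opens V, (exists y, oset U y) -> oset U x.

Definition is_perfect_closure (p : nat) (k K : fieldType) (i : {rmorphism k -> K}) :=
  (forall x : K, exists y, y ^+ p = x) /\
  (forall x : K, exists n y, x ^+ (p ^ n) = i y).

Record perfect_generic_point (p : nat) (V : scheme) := PerfectGenericPoint {
  pg_eta : V;
  pg_generic : generic_point pg_eta;
  pg_k : fieldType;
  pg_germ : forall U : opens V, oset U pg_eta -> {rmorphism sec U -> pg_k};
  pg_stalk : is_stalk pg_germ;
  pg_K : fieldType;
  pg_incl : {rmorphism pg_k -> pg_K};
  pg_perfect : is_perfect_closure p pg_incl;
  (* Y = Spec K *)
  pg_Y : scheme;
  pg_affine : affine (otop pg_Y);
  pg_theta : {rmorphism pg_K -> sec (otop pg_Y)};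
  pg_theta_bij : bijective pg_theta;
  (* the canonical morphism Spec K -> V *)
  pg_mor : mor pg_Y V;
  pg_mor_eta : forall y, pg_mor y = pg_eta;
  pg_comor : forall (U : opens V) (hU : oset U pg_eta) (m : maps pg_mor (otop pg_Y) U) s,
    comor m s = pg_theta (pg_incl (pg_germ hU s)) }.

(** For [V' = Spec K] with [K] perfect, the Frobenius of [V'] is an isomorphism,
    and so is its base change [j : P1 -> P0]: [psi] is the base change [phi'] of
    [phi], viewed by means of [j] as taking values in the structure sheaf of
    [P0]. *)
Definition untwist (P0 P1 : scheme) (j : mor P1 P0) (L : Omod P0)
    (phi' : addhom j L (Oreg P1)) (psi : addhom (idm P0) L (Oreg P0)) :=
  forall (U T : opens P0) (m : maps (idm P0) T U) (W : opens P1) (mj : maps j W T)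
    (m' : maps j W U) (l : L U),
  comor mj (psi U T m l : sec T) = phi' U W m' l.

Definition absolute_iterates (p e : nat) (Y : scheme) (L : Omod Y)
    (Lp : tensor_powers L) (psi : addhom (idm Y) L (Oreg Y))
    (psin : forall n, addhom (idm Y) (Lp (tw_exp p e n)) (Oreg Y)) :=
  (forall (U W : opens Y) (m : maps (idm Y) W U) (l : L U),
     psin 1%N U W m (tp_bil Lp 0 U l (tp_one Lp U 1)) = psi U W m l) /\
  (forall n, (0 < n)%N ->
     forall (U W : opens Y) (m : maps (idm Y) U U) (m' : maps (idm Y) W U)
       (l : L U) (x : Lp (tw_exp p e n) U),
     psin n.+1 U W m' (tp_mul l (p ^ (n * e)) x) =
     psi U W m' ((psin n U U m x : sec U) *: l)).

(* Main.v *)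
Require Import Defs.
From HB Require Import structures.
From mathcomp Require Import all_boot all_order all_algebra ring.
From mathcomp Require mpoly.
From mathcomp Require Import boolp classical_sets functions filter topology.
Set Implicit Arguments.
Unset Strict Implicit.
Unset Printing Implicit Defensive.
Import GRing.Theory.
Local Open Scope classical_set_scope.
Local Open Scope ring_scope.

(** Write [X_N] for [X x_V V^N] and [G_n] for the stalk of [phi^n] at the point of
    [X_(ne)] above a point [x] of [X], where [L] is trivialized. Since [G_(n+1)] is
    obtained from [G_n] by applying [phi (x) id], the images of the iterates decrease
    after base change, and if the image of [G_n0] in the stalk of [X_((n0+1)e)] is
    contained in the image of [G_(n0+1)], then this remains true for all [n >= n0],
    and the two sides of the theorem have the same stalks. It thus suffices to
    spread out this one inclusion from the generic fibre.

    Over an affine open subset of [X] of finite type over [V], the image of [G_n] is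
    generated by the images of finitely many sections, because the ring is a finite
    module over the subring of [p^(ne)]-th powers and constants. The pullback of
    [phi^n] to [X x_V Spec k(V^oo)] is [psi_oo^n], up to the identification of
    [k(V^oo)] with its [p^(ne)]-th roots; so the stability of the images of
    [psi_oo^n] shows that each of the finitely many generators lies in the image of
    [G_(n0+1)] after tensoring with [k(V^oo)], hence after multiplication with a
    nonzero function on an open subset of [V]. Inverting these finitely many
    functions gives [U]. *)

(** * Quotients and subrings *)

(** Fibre products, pullbacks and tensor powers are given by universal properties alone, so that
    nothing is known in advance about the sections of [X_N] or of the generic fibre. Explicit tensor
    products are replaced by a generation statement: each element of a stalk is a sum of products of
    elements from the two factors. In a general fibre product this holds only up to denominators;
    here they disappear because [V^N] is radicial over [V] and [k(V^oo)] over [k(V)], so that some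
    power [p ^ r] of a denominator comes from [X].

    The same obstacle shapes the spreading out. That a section vanishes after tensoring with
    [k(V^oo)] has to be produced by a test ring: an algebra over [k(V^oo)] is built by generators
    and relations, its spectrum is mapped to the generic fibre, and linear algebra brings the
    relation found there back to functions on [V]. The denominator must serve all points of an open
    subset of [X] simultaneously, which is why the argument runs in a product of stalks and not in
    one stalk. *)

Record setoid_ring := SetoidRing {
  sr_car :> Type;
  sr_eqv : sr_car -> sr_car -> Prop;
  sr_zero : sr_car; sr_one : sr_car; sr_opp : sr_car -> sr_car;
  sr_add : sr_car -> sr_car -> sr_car; sr_mul : sr_car -> sr_car -> sr_car;
  sr_refl : forall a, sr_eqv a a;
  sr_sym : forall a b, sr_eqv a b -> sr_eqv b a;
  sr_trans : forall a b c, sr_eqv a b -> sr_eqv b c -> sr_eqv a c;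
  sr_oppE : forall a b, sr_eqv a b -> sr_eqv (sr_opp a) (sr_opp b);
  sr_addE : forall a b c, sr_eqv a b -> sr_eqv (sr_add a c) (sr_add b c);
  sr_mulE : forall a b c, sr_eqv a b -> sr_eqv (sr_mul a c) (sr_mul b c);
  sr_addA : forall a b c, sr_eqv (sr_add a (sr_add b c)) (sr_add (sr_add a b) c);
  sr_addC : forall a b, sr_eqv (sr_add a b) (sr_add b a);
  sr_add0 : forall a, sr_eqv (sr_add sr_zero a) a;
  sr_addN : forall a, sr_eqv (sr_add (sr_opp a) a) sr_zero;
  sr_mulA : forall a b c, sr_eqv (sr_mul a (sr_mul b c)) (sr_mul (sr_mul a b) c);
  sr_mulC : forall a b, sr_eqv (sr_mul a b) (sr_mul b a);
  sr_mul1 : forall a, sr_eqv (sr_mul sr_one a) a;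
  sr_mulD : forall a b c, sr_eqv (sr_mul (sr_add a b) c)
                                 (sr_add (sr_mul a c) (sr_mul b c)) }.

Section QuotientRing.
Variable S : setoid_ring.

(** Elements are equivalence classes as sets, so that equality in the ring is [sr_eqv] itself
    ([qpi_eq]). Localizations, stalks and residue rings all arise this way; congruence in the second
    argument of the operations follows from commutativity. *)
Definition qring := {c : set S | exists a, c = sr_eqv a}.

Definition qpi (a : S) : qring := exist _ (sr_eqv a) (ex_intro _ a erefl).

Lemma qpi_eq (a b : S) : qpi a = qpi b <-> sr_eqv a b.
Proof.
split=> [/(congr1 sval)/= H|H].
  by have := sr_refl b; rewrite -[sr_eqv b b]/((sr_eqv b : set S) b) -H.
apply: eq_exist; apply/seteqP; split=> x Hx.
  exact: (sr_trans (sr_sym H) Hx).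
exact: (sr_trans H Hx).
Qed.

Lemma qpi_surj (x : qring) : {a | x = qpi a}.
Proof. by apply: cid; case: x => c [a E]; exists a; apply: eq_exist. Qed.

Definition qrepr (x : qring) : S := sval (qpi_surj x).
Lemma qreprK x : qpi (qrepr x) = x.
Proof. exact: esym (svalP (qpi_surj x)). Qed.
Lemma qreprE a : sr_eqv (qrepr (qpi a)) a.
Proof. by apply/qpi_eq; rewrite qreprK. Qed.

Definition qadd x y := qpi (sr_add (qrepr x) (qrepr y)).
Definition qmul x y := qpi (sr_mul (qrepr x) (qrepr y)).
Definition qopp x := qpi (sr_opp (qrepr x)).

Lemma qaddE a b : qadd (qpi a) (qpi b) = qpi (sr_add a b).
Proof.
apply/qpi_eq; apply: sr_trans (sr_addE _ (qreprE a)) _.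
apply: sr_trans (sr_addC _ _) _; apply: sr_trans (sr_addE _ (qreprE b)) _.
exact: sr_addC.
Qed.

Lemma qmulE a b : qmul (qpi a) (qpi b) = qpi (sr_mul a b).
Proof.
apply/qpi_eq; apply: sr_trans (sr_mulE _ (qreprE a)) _.
apply: sr_trans (sr_mulC _ _) _; apply: sr_trans (sr_mulE _ (qreprE b)) _.
exact: sr_mulC.
Qed.

Lemma qoppE a : qopp (qpi a) = qpi (sr_opp a).
Proof. by apply/qpi_eq; apply: sr_oppE; exact: qreprE. Qed.

Lemma qind (P : qring -> Prop) : (forall a, P (qpi a)) -> forall x, P x.
Proof. by move=> H x; rewrite -(qreprK x). Qed.

HB.instance Definition _ := gen_eqMixin qring.
HB.instance Definition _ := gen_choiceMixin qring.

Lemma qaddA : associative qadd.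
Proof.
by elim/qind=> a; elim/qind=> b; elim/qind=> c; rewrite !qaddE; apply/qpi_eq/sr_addA.
Qed.
Lemma qaddC : commutative qadd.
Proof. by elim/qind=> a; elim/qind=> b; rewrite !qaddE; apply/qpi_eq/sr_addC. Qed.
Lemma qadd0 : left_id (qpi (sr_zero S)) qadd.
Proof. by elim/qind=> a; rewrite !qaddE; apply/qpi_eq/sr_add0. Qed.
Lemma qaddN : left_inverse (qpi (sr_zero S)) qopp qadd.
Proof. by elim/qind=> a; rewrite qoppE !qaddE; apply/qpi_eq/sr_addN. Qed.
Lemma qmulA : associative qmul.
Proof.
by elim/qind=> a; elim/qind=> b; elim/qind=> c; rewrite !qmulE; apply/qpi_eq/sr_mulA.
Qed.
Lemma qmulC : commutative qmul.
Proof. by elim/qind=> a; elim/qind=> b; rewrite !qmulE; apply/qpi_eq/sr_mulC. Qed.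
Lemma qmul1 : left_id (qpi (sr_one S)) qmul.
Proof. by elim/qind=> a; rewrite !qmulE; apply/qpi_eq/sr_mul1. Qed.
Lemma qmulD : left_distributive qmul qadd.
Proof.
elim/qind=> a; elim/qind=> b; elim/qind=> c.
by rewrite qaddE !qmulE qaddE; apply/qpi_eq/sr_mulD.
Qed.

HB.instance Definition _ := GRing.isZmodule.Build qring qaddA qaddC qadd0 qaddN.
HB.instance Definition _ :=
  GRing.Zmodule_isComPzRing.Build qring qmulA qmulC qmul1 qmulD.

Lemma qpiD a b : qpi (sr_add a b) = qpi a + qpi b. Proof. by rewrite -qaddE. Qed.
Lemma qpiM a b : qpi (sr_mul a b) = qpi a * qpi b. Proof. by rewrite -qmulE. Qed.
Lemma qpiN a : qpi (sr_opp a) = - qpi a. Proof. by rewrite -qoppE. Qed.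
Lemma qpi0 : qpi (sr_zero S) = 0. Proof. by []. Qed.
Lemma qpi1 : qpi (sr_one S) = 1. Proof. by []. Qed.

End QuotientRing.

Section Subring.
Variables (R : comPzRingType) (P : set R).

Record subring_spec : Prop := SubringSpec {
  sub1 : P 1; subN : forall x, P x -> P (- x);
  subD : forall x y, P x -> P y -> P (x + y);
  subM : forall x y, P x -> P y -> P (x * y) }.

Variable H : subring_spec.

Definition subring_of (_ : subring_spec) := {x : R | P x}.
Local Notation Q := (subring_of H).

Lemma sub0 : P 0.
Proof. by rewrite -(subrr 1); apply: (subD H); [|apply: (subN H)]; exact: (sub1 H). Qed.

Lemma sub_inj (x y : Q) : sval x = sval y -> x = y.
Proof. by case: x y => x Hx [y Hy] /= E; apply: eq_exist. Qed.

Definition sub_add (x y : Q) : Q := exist _ _ (subD H (svalP x) (svalP y)).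
Definition sub_mul (x y : Q) : Q := exist _ _ (subM H (svalP x) (svalP y)).
Definition sub_opp (x : Q) : Q := exist _ _ (subN H (svalP x)).
Definition sub_zero : Q := exist _ _ sub0.
Definition sub_one : Q := exist _ _ (sub1 H).

HB.instance Definition _ := gen_eqMixin Q.
HB.instance Definition _ := gen_choiceMixin Q.

Lemma sub_addA : associative sub_add. Proof. by move=> x y z; apply/sub_inj/addrA. Qed.
Lemma sub_addC : commutative sub_add. Proof. by move=> x y; apply/sub_inj/addrC. Qed.
Lemma sub_add0 : left_id sub_zero sub_add. Proof. by move=> x; apply/sub_inj/add0r. Qed.
Lemma sub_addN : left_inverse sub_zero sub_opp sub_add.
Proof. by move=> x; apply/sub_inj/addNr. Qed.
Lemma sub_mulA : associative sub_mul. Proof. by move=> x y z; apply/sub_inj/mulrA. Qed.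
Lemma sub_mulC : commutative sub_mul. Proof. by move=> x y; apply/sub_inj/mulrC. Qed.
Lemma sub_mul1 : left_id sub_one sub_mul. Proof. by move=> x; apply/sub_inj/mul1r. Qed.
Lemma sub_mulD : left_distributive sub_mul sub_add.
Proof. by move=> x y z; apply/sub_inj/mulrDl. Qed.

HB.instance Definition _ := GRing.isZmodule.Build Q sub_addA sub_addC sub_add0 sub_addN.
HB.instance Definition _ :=
  GRing.Zmodule_isComPzRing.Build Q sub_mulA sub_mulC sub_mul1 sub_mulD.

Definition sub_val (x : Q) : R := sval x.
Lemma sub_val_nmod : nmod_morphism sub_val. Proof. by []. Qed.
Lemma sub_val_monoid : monoid_morphism sub_val. Proof. by []. Qed.
HB.instance Definition _ := GRing.isNmodMorphism.Build Q R sub_val sub_val_nmod.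
HB.instance Definition _ := GRing.isMonoidMorphism.Build Q R sub_val sub_val_monoid.

End Subring.

(** * Prime ideals avoiding a multiplicative set *)

Section Primes.
Variable R : comPzRingType.
Implicit Types (I J P S : set R).

Lemma ideal0 I : is_ideal I -> I 0. Proof. by case. Qed.
Lemma idealD I x y : is_ideal I -> I x -> I y -> I (x + y).
Proof. by case=> _ H _; exact: H. Qed.
Lemma idealM I a x : is_ideal I -> I x -> I (a * x).
Proof. by case=> _ _; exact. Qed.
Lemma idealN I x : is_ideal I -> I x -> I (- x).
Proof. by move=> hI hx; rewrite -mulN1r; exact: idealM. Qed.

(** An ideal maximal among those that contain [I] and miss [S] is prime: if [x] and [y] lie outside
    it, the ideals generated by it with [x] and with [y] both meet [S], and the product of the two
    elements would lie in it if [x * y] did. *)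
Lemma exists_prime I S : is_ideal I -> S 1 -> (forall x y, S x -> S y -> S (x * y)) ->
  (forall x, I x -> ~ S x) ->
  exists P, [/\ prime_ideal P, I `<=` P & forall x, P x -> ~ S x].
Proof.
move=> hI S1 SM IS.
pose good := [set A : set R | A = set0 \/
  [/\ is_ideal A, I `<=` A & forall x, A x -> ~ S x]].
have [F FP Ftot|A [gA maxA]] := @Zorn_bigcup R good.
  case: (pselect (exists2 B, F B & B <> set0)) => [[B FB B0]|H]; last first.
    left; apply/seteqP; split=> // x [B FB Bx]; apply: H; exists B => // E.
    by move: Bx; rewrite E.
  have gF C x : F C -> C x -> [/\ is_ideal C, I `<=` C & forall x, C x -> ~ S x].
    by move=> /FP [->|//].
  have [hB IB SB] : [/\ is_ideal B, I `<=` B & forall x, B x -> ~ S x].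
    by case: (FP _ FB).
  right; split.
  - split.
    + by exists B => //; exact: ideal0.
    + move=> x y [C FC Cx] [D FD Dy].
      case: (Ftot _ _ FC FD) => CD.
        exists D => //; have [hD _ _] := gF _ _ FD Dy.
        by apply: idealD => //; exact: CD.
      exists C => //; have [hC _ _] := gF _ _ FC Cx.
      by apply: idealD => //; exact: CD.
    + move=> a x [C FC Cx]; exists C => //; have [hC _ _] := gF _ _ FC Cx.
      exact: idealM.
  - by move=> x Ix; exists B => //; exact: IB.
  - by move=> x [C FC Cx]; have [_ _ ] := gF _ _ FC Cx; apply.
(* The maximal set is not empty, since [I] is a larger candidate than the empty set. *)
have {}gA : [/\ is_ideal A, I `<=` A & forall x, A x -> ~ S x].
  case: gA => // A0; exfalso; apply: (maxA I); last first.
    by right; split=> //; exact: subset_refl.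
  rewrite A0; split=> //; move=> /(_ 0 (ideal0 hI)); exact.
case: gA => hA IA SA; exists A; split=> //.
pose Ax x : set R := [set y | exists a b, A a /\ y = a + b * x].
have hAx x : is_ideal (Ax x).
  split.
  - by exists 0, 0; split; [exact: (ideal0 hA)|ring].
  - move=> _ _ [a [b [Aa ->]]] [a' [b' [Aa' ->]]]; exists (a + a'), (b + b').
    by split; [exact: (idealD hA)|ring].
  - move=> c _ [a [b [Aa ->]]]; exists (c * a), (c * b).
    by split; [exact: (idealM _ hA)|ring].
have meets x : ~ A x -> exists2 y, Ax x y & S y.
  move=> Ax'; apply: contrapT => H; apply: (maxA (Ax x)).
    split; first by move=> a Aa; exists a, 0; split=> //; ring.
    move=> /(_ x) H'; apply: Ax'; apply: H'.
    by exists 0, 1; split; [exact: (ideal0 hA)|ring].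
  right; split=> //.
    by move=> y /IA Ay; exists y, 0; split=> //; ring.
  by move=> y Hy Sy; apply: H; exists y.
split=> //.
  by move=> /SA; apply.
move=> x y Axy; apply: contrapT => /not_orP [nx ny].
have [_ [a [b [Aa ->]]] S1'] := meets _ nx.
have [_ [a' [b' [Aa' ->]]] S2] := meets _ ny.
apply: (SA _ _ (SM _ _ S1' S2)).
have -> : (a + b * x) * (a' + b' * y) =
  (a' + b' * y) * a + ((b * x) * a' + (b * b') * (x * y)) by ring.
by apply: idealD => //; [exact: idealM|apply: idealD => //; exact: idealM].
Qed.

End Primes.

Lemma rmorphism_of (R S : comPzRingType) (k : R -> S) :
  nmod_morphism k -> monoid_morphism k -> exists h : {rmorphism R -> S}, forall a, h a = k a.
Proof.
move=> k_nmod k_monoid; pose k1 := GRing.isNmodMorphism.Build _ _ k k_nmod.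
pose k2 := GRing.isMonoidMorphism.Build _ _ k k_monoid.
pose kk : {rmorphism R -> S} := HB.pack k k1 k2.
by exists kk.
Qed.

(** * Spectra of rings *)

Section Localization.
Variables (R : comPzRingType) (S : set R) (S1 : S 1).
Variable (SM : forall x y, S x -> S y -> S (x * y)).

Let car := (R * {x | S x})%type.
Let eqv (a b : car) := exists2 u, S u & u * (a.1 * sval b.2) = u * (b.1 * sval a.2).
Let den (b c : {x | S x}) : {x | S x} := exist _ _ (SM (svalP b) (svalP c)).

Definition loc_setoid : setoid_ring.
Proof.
refine (@SetoidRing car eqv (0, exist _ 1 S1) (1, exist _ 1 S1)
  (fun a => (- a.1, a.2))
  (fun a b => (a.1 * sval b.2 + b.1 * sval a.2, den a.2 b.2))
  (fun a b => (a.1 * b.1, den a.2 b.2)) _ _ _ _ _ _ _ _ _ _ _ _ _ _).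
- by move=> a; exists 1.
- by move=> a b [u Su E]; exists u.
- move=> [a [s Ss]] [b [t St]] [c [r Sr]] [u Su /= E] [v Sv /= F].
  exists (u * v * t); first by do !apply: SM.
  have -> : u * v * t * (a * r) = v * r * (u * (a * t)) by ring.
  rewrite E; have -> : v * r * (u * (b * s)) = u * s * (v * (b * r)) by ring.
  by rewrite F /=; ring.
- move=> [a [s Ss]] [b [t St]] [u Su /= E]; exists u => //=.
  by rewrite !mulNr !mulrN E.
- move=> [a [s Ss]] [b [t St]] [c [r Sr]] [u Su /= E]; exists u => //=.
  have -> : u * ((a * r + c * s) * (t * r)) =
    r * r * (u * (a * t)) + u * (c * s * t * r) by ring.
  by rewrite E; ring.
- move=> [a [s Ss]] [b [t St]] [c [r Sr]] [u Su /= E]; exists u => //=.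
  have -> : u * (a * c * (t * r)) = c * r * (u * (a * t)) by ring.
  by rewrite E; ring.
- by move=> [a [s Ss]] [b [t St]] [c [r Sr]]; exists 1 => //=; ring.
- by move=> [a [s Ss]] [b [t St]]; exists 1 => //=; ring.
- by move=> [a [s Ss]]; exists 1 => //=; ring.
- by move=> [a [s Ss]]; exists 1 => //=; ring.
- by move=> [a [s Ss]] [b [t St]] [c [r Sr]]; exists 1 => //=; ring.
- by move=> [a [s Ss]] [b [t St]]; exists 1 => //=; ring.
- by move=> [a [s Ss]]; exists 1 => //=; ring.
- by move=> [a [s Ss]] [b [t St]] [c [r Sr]]; exists 1 => //=; ring.
Defined.

Definition loc : comPzRingType := qring loc_setoid.
Definition frac (a b : R) (hb : S b) : loc := @qpi loc_setoid (a, exist _ b hb).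

Lemma frac_eq a b c d (hb : S b) (hd : S d) :
  frac a hb = frac c hd <-> exists2 u, S u & u * (a * d) = u * (c * b).
Proof. exact: qpi_eq. Qed.

Lemma frac_surj (x : loc) : exists a b (hb : S b), x = frac a hb.
Proof. by elim/qind: x => -[a [b hb]]; exists a, b, hb. Qed.

Lemma fracE a b c d (hb : S b) (hd : S d) : a * d = c * b -> frac a hb = frac c hd.
Proof. by move=> E; apply/frac_eq; exists 1; rewrite ?E. Qed.

Lemma fracD a b c d (hb : S b) (hd : S d) :
  frac a hb + frac c hd = frac (a * d + c * b) (SM hb hd).
Proof. by rewrite -qpiD; apply: fracE. Qed.
Lemma fracM a b c d (hb : S b) (hd : S d) :
  frac a hb * frac c hd = frac (a * c) (SM hb hd).
Proof. by rewrite -qpiM; apply: fracE. Qed.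
Lemma fracN a b (hb : S b) : - frac a hb = frac (- a) hb.
Proof. by rewrite -qpiN; apply: fracE. Qed.

Definition loc_in (a : R) : loc := frac a S1.
Lemma loc_in_nmod : nmod_morphism loc_in.
Proof.
split=> [|x y]; rewrite /loc_in ?fracD; last by apply: fracE; ring.
by rewrite -qpi0; apply: fracE; ring.
Qed.
Lemma loc_in_monoid : monoid_morphism loc_in.
Proof.
split=> [|x y]; rewrite /loc_in ?fracM; last by apply: fracE; ring.
by rewrite -qpi1; apply: fracE; ring.
Qed.
HB.instance Definition _ := GRing.isNmodMorphism.Build R loc loc_in loc_in_nmod.
HB.instance Definition _ := GRing.isMonoidMorphism.Build R loc loc_in loc_in_monoid.

Lemma loc_in_eq0 a : loc_in a = 0 <-> exists2 u, S u & u * a = 0.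
Proof.
rewrite -(rmorph0 loc_in) frac_eq; split=> -[u Su E]; exists u => //.
  by move: E; rewrite mulr1 mul0r mulr0.
by rewrite mulr1 E mul0r mulr0.
Qed.

End Localization.

Lemma unit_cancel (R : comPzRingType) (u x y : R) :
  invertible u -> u * x = u * y -> x = y.
Proof.
move=> [v uv] E; rewrite -(mul1r x) -(mul1r y) -uv.
by rewrite [u * v]mulrC -!mulrA E.
Qed.

Lemma invertibleM (R : comPzRingType) (u v : R) :
  invertible u -> invertible v -> invertible (u * v).
Proof. by move=> [x ux] [y vy]; exists (x * y); rewrite mulrACA ux vy mulr1. Qed.

Lemma invertibleMl (R : comPzRingType) (u v : R) : invertible (u * v) -> invertible u.
Proof. by move=> [y E]; exists (v * y); rewrite mulrA. Qed.

Lemma invertibleX (R : comPzRingType) (u : R) n : invertible u -> invertible (u ^+ n).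
Proof.
by move=> [y E]; exists (y ^+ n); rewrite -exprMn E expr1n.
Qed.

Lemma invertible_morph (R S : comPzRingType) (h : {rmorphism R -> S}) u :
  invertible u -> invertible (h u).
Proof. by move=> [y E]; exists (h y); rewrite -rmorphM E rmorph1. Qed.

Section ProductRing.
Variables (I : Type) (F : I -> comPzRingType).
Definition pring := forall i, F i.
HB.instance Definition _ := gen_eqMixin pring.
HB.instance Definition _ := gen_choiceMixin pring.
Definition pr_add (x y : pring) : pring := fun i => x i + y i.
Definition pr_mul (x y : pring) : pring := fun i => x i * y i.
Definition pr_opp (x : pring) : pring := fun i => - x i.
Definition pr_zero : pring := fun i => 0.
Definition pr_one : pring := fun i => 1.
Lemma pr_addA : associative pr_add.
Proof. by move=> x y z; apply: functional_extensionality_dep => i; exact: addrA. Qed.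
Lemma pr_addC : commutative pr_add.
Proof. by move=> x y; apply: functional_extensionality_dep => i; exact: addrC. Qed.
Lemma pr_add0 : left_id pr_zero pr_add.
Proof. by move=> x; apply: functional_extensionality_dep => i; exact: add0r. Qed.
Lemma pr_addN : left_inverse pr_zero pr_opp pr_add.
Proof. by move=> x; apply: functional_extensionality_dep => i; exact: addNr. Qed.
Lemma pr_mulA : associative pr_mul.
Proof. by move=> x y z; apply: functional_extensionality_dep => i; exact: mulrA. Qed.
Lemma pr_mulC : commutative pr_mul.
Proof. by move=> x y; apply: functional_extensionality_dep => i; exact: mulrC. Qed.
Lemma pr_mul1 : left_id pr_one pr_mul.
Proof. by move=> x; apply: functional_extensionality_dep => i; exact: mul1r. Qed.
Lemma pr_mulD : left_distributive pr_mul pr_add.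
Proof. by move=> x y z; apply: functional_extensionality_dep => i; exact: mulrDl. Qed.
HB.instance Definition _ := GRing.isZmodule.Build pring pr_addA pr_addC pr_add0 pr_addN.
HB.instance Definition _ :=
  GRing.Zmodule_isComPzRing.Build pring pr_mulA pr_mulC pr_mul1 pr_mulD.
End ProductRing.

Section OpensI.
Variable X : topologicalType.
Implicit Types U W : opens X.
Definition oI U W : opens X := Opens (openI (oset_open U) (oset_open W)).
Lemma oIl U W : osub (oI U W) U. Proof. by move=> x []. Qed.
Lemma oIr U W : osub (oI U W) W. Proof. by move=> x []. Qed.
End OpensI.
Arguments oIl {X U W}.
Arguments oIr {X U W}.

(** * The structure sheaf of a spectrum *)

Definition spec (R : comPzRingType) := {P : set R | prime_ideal P}.

Section SpecTopology.
Variable R : comPzRingType.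
Local Notation spec := (spec R).
HB.instance Definition _ := gen_eqMixin spec.
HB.instance Definition _ := gen_choiceMixin spec.

Definition spec_D (a : R) : set spec := [set P | ~ sval P a].
Definition spec_op (U : set spec) := forall P, U P -> exists2 a, spec_D a P & spec_D a `<=` U.

Lemma spec_P1 (P : spec) : ~ sval P 1. Proof. by case: (svalP P). Qed.
Lemma spec_PM (P : spec) x y : ~ sval P x -> ~ sval P y -> ~ sval P (x * y).
Proof. by case: (svalP P) => _ _ H hx hy /H []. Qed.
Lemma spec_DM a b (P : spec) : spec_D (a * b) P <-> spec_D a P /\ spec_D b P.
Proof.
split=> [H|[]]; last exact: spec_PM.
case: (svalP P) => hP _ _; split=> h; apply: H; last exact: (idealM a hP).
by rewrite mulrC; exact: (idealM b hP).
Qed.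
Lemma spec_DX a n (P : spec) : spec_D a P -> spec_D (a ^+ n) P.
Proof.
move=> Ha; elim: n => [|n IH]; first by rewrite expr0; exact: spec_P1.
by rewrite exprS; apply/spec_DM.
Qed.

Lemma spec_opT : spec_op setT.
Proof. by move=> P _; exists 1 => //; exact: spec_P1. Qed.
Lemma spec_opI : forall A B, spec_op A -> spec_op B -> spec_op (A `&` B).
Proof.
move=> A B hA hB P [/hA [a Pa aA] /hB [b Pb bB]]; exists (a * b).
  exact/spec_DM.
by move=> Q /spec_DM [/aA ? /bB ?].
Qed.
Lemma spec_op_bigU (I : Type) (f : I -> set spec) :
  (forall i, spec_op (f i)) -> spec_op (\bigcup_i f i).
Proof.
move=> H P [i _ /H [a Pa af]]; exists a => // Q /af ?.
by exists i.
Qed.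
HB.instance Definition _ :=
  isOpenTopological.Build spec spec_opT spec_opI spec_op_bigU.

Lemma spec_openE (U : set spec) : open U = spec_op U. Proof. by []. Qed.
Lemma spec_D_op a : open (spec_D a). Proof. by move=> P Pa; exists a. Qed.
Definition spec_Do a : opens spec := Opens (@spec_D_op a).

Definition locP (P : spec) : comPzRingType := loc (@spec_P1 P) (@spec_PM P).
Definition fracP (P : spec) a b (hb : spec_D b P) : locP P :=
  @frac R (fun x => ~ sval P x) (@spec_P1 P) (@spec_PM P) a b hb.

End SpecTopology.

Section SpecSheaf.
Variable R : comPzRingType.
Local Notation spec := (spec R).
Implicit Types (U W : opens spec) (P Q : spec).

Definition spec_fun U := pring (fun P : {P | oset U P} => locP (sval P)).
(** Locally a single fraction. The equation is demanded at every point of [U] where [b] does not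
    vanish, so that no second neighbourhood has to be carried along. *)
Definition spec_loc U (s : spec_fun U) := forall P, oset U P ->
  exists a b, spec_D b P /\ forall Q (hQ : oset U Q) (hb : spec_D b Q),
    s (exist _ Q hQ) = fracP a hb.

Lemma spec_loc_sub U : subring_spec (@spec_loc U).
Proof.
split.
- move=> P _; exists 1, 1; split; first exact: spec_P1.
  by move=> Q hQ hb; rewrite -[LHS]qpi1; apply: fracE.
- move=> s Hs P /Hs [a [b [hb E]]]; exists (- a), b; split=> // Q hQ hc.
  by rewrite -[LHS]/(- s _) E; exact: fracN.
- move=> s t Hs Ht P hP; have [a [b [hb E]]] := Hs P hP.
  have [c [d [hd F]]] := Ht P hP; exists (a * d + c * b), (b * d).
  split=> [|Q hQ hbd]; first exact/spec_DM.
  have [hb' hd'] := (spec_DM _ _ _).1 hbd.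
  by rewrite -[LHS]/(s _ + t _) (E _ _ hb') (F _ _ hd') fracD; apply: fracE.
- move=> s t Hs Ht P hP; have [a [b [hb E]]] := Hs P hP.
  have [c [d [hd F]]] := Ht P hP; exists (a * c), (b * d).
  split=> [|Q hQ hbd]; first exact/spec_DM.
  have [hb' hd'] := (spec_DM _ _ _).1 hbd.
  by rewrite -[LHS]/(s _ * t _) (E _ _ hb') (F _ _ hd') fracM; apply: fracE.
Qed.

Definition spec_sec U : comPzRingType := subring_of (spec_loc_sub U).
Definition spec_val U (s : spec_sec U) P (h : oset U P) : locP P := sval s (exist _ P h).

Lemma spec_sec_ext U (s t : spec_sec U) :
  (forall P (h : oset U P), spec_val s h = spec_val t h) -> s = t.
Proof.
move=> H; apply: sub_inj; apply: functional_extensionality_dep => -[P hP].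
exact: H.
Qed.

Definition spec_res_fun U W (h : osub W U) (s : spec_sec U) : spec_sec W.
Proof.
exists (fun P : {P | oset W P} => spec_val s (h _ (svalP P))).
move=> P hP; have [a [b [hb E]]] := svalP s P (h _ hP).
by exists a, b; split=> // Q hQ hc; exact: E.
Defined.

Lemma spec_valE U (s : spec_sec U) P (h h' : oset U P) : spec_val s h = spec_val s h'.
Proof. by congr (spec_val s _); exact: Prop_irrelevance. Qed.

Lemma spec_res_nmod U W (h : osub W U) : nmod_morphism (spec_res_fun h).
Proof. by split=> [|x y]; apply: spec_sec_ext. Qed.
Lemma spec_res_monoid U W (h : osub W U) : monoid_morphism (spec_res_fun h).
Proof. by split=> [|x y]; apply: spec_sec_ext. Qed.
HB.instance Definition _ U W (h : osub W U) :=
  GRing.isNmodMorphism.Build _ _ (spec_res_fun h) (spec_res_nmod h).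
HB.instance Definition _ U W (h : osub W U) :=
  GRing.isMonoidMorphism.Build _ _ (spec_res_fun h) (spec_res_monoid h).
Definition spec_res U W (h : osub W U) : {rmorphism spec_sec U -> spec_sec W} :=
  spec_res_fun h.

Lemma spec_val_res U W (h : osub W U) (s : spec_sec U) P (hP : oset W P) :
  spec_val (spec_res h s) hP = spec_val s (h P hP).
Proof.
exact: (@spec_valE U s P (h P (svalP (exist (fun P => oset W P) P hP))) (h P hP)).
Qed.

Lemma spec_res_id U (h : osub U U) s : spec_res h s = s.
Proof. by apply: spec_sec_ext => P hP; rewrite !spec_val_res; exact: spec_valE. Qed.
Lemma spec_res_comp U W T (h1 : osub W U) (h2 : osub T W) (h3 : osub T U) s :
  spec_res h2 (spec_res h1 s) = spec_res h3 s.
Proof. by apply: spec_sec_ext => P hP; rewrite !spec_val_res; exact: spec_valE. Qed.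
Lemma spec_sec_eq U (s t : spec_sec U) :
  locally_on (fun W (h : osub W U) => spec_res h s = spec_res h t) -> s = t.
Proof.
move=> H; apply: spec_sec_ext => P hP; have [W [h [WP E]]] := H P hP.
have := congr1 (fun s => spec_val s WP) E.
by rewrite !spec_val_res !(spec_valE _ (h P WP) hP).
Qed.
Lemma spec_glue U (I : Type) (D : I -> opens spec)
      (hD : forall i, osub (D i) U) (s : forall i, spec_sec (D i)) :
    (forall x, oset U x -> exists i, oset (D i) x) ->
    (forall i j W (hi : osub W (D i)) (hj : osub W (D j)),
       spec_res hi (s i) = spec_res hj (s j)) ->
    exists t, forall i, spec_res (hD i) t = s i.
Proof.
move=> cov comp.
have comp' P i j (hi : oset (D i) P) (hj : oset (D j) P) :
    spec_val (s i) hi = spec_val (s j) hj.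
  have hij : oset (oI (D i) (D j)) P by [].
  have := congr1 (fun s => spec_val s hij) (comp _ _ _ (@oIl _ (D i) (D j)) oIr).
  by rewrite !spec_val_res (spec_valE _ hi (oIl _ hij)) (spec_valE _ hj (oIr _ hij)).
pose v (P : {P | oset U P}) : locP (sval P) :=
  spec_val (s (sval (cid (cov _ (svalP P))))) (svalP (cid (cov _ (svalP P)))).

have vE i P (hP : oset U P) (hi : oset (D i) P) : v (exist _ P hP) = spec_val (s i) hi.
  exact: comp'.
have Hv : spec_loc v.
  move=> P hP; have [i hi] := cov P hP.
  have [a [b [hb E]]] := svalP (s i) P hi.
  have := oset_open (D i); rewrite spec_openE => /(_ P hi) [c hc cD].
  (* Expanding the fraction by [c] confines it to [D i], where [v] agrees with [s i]. *)
  exists (a * c), (b * c); split; first exact/spec_DM.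
  move=> Q hQ hbc; have [hb' hc'] := (spec_DM _ _ _).1 hbc.
  rewrite (vE i _ _ (cD _ hc')) /spec_val (E _ _ hb'); apply: fracE; ring.
exists (exist _ v Hv) => i; apply: spec_sec_ext => P hP.
exact: vE.
Qed.

Definition spec_rs : ringedSpace :=
  RingedSpace spec_res_id spec_res_comp spec_sec_eq spec_glue.

Definition spec_in_fun (a : R) : spec_sec (otop spec).
Proof.
exists (fun P : {P : spec | oset (otop spec) P} => @loc_in R _ (@spec_P1 _ (sval P)) (@spec_PM _ (sval P)) a).
by move=> P _; exists a, 1; split=> [|Q hQ hb]; [exact: spec_P1|apply: fracE].
Defined.
Lemma spec_in_nmod : nmod_morphism spec_in_fun.
Proof.
by split=> [|x y]; apply: spec_sec_ext => P hP; rewrite /spec_val /= ?raddf0 ?raddfD.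
Qed.
Lemma spec_in_monoid : monoid_morphism spec_in_fun.
Proof.
by split=> [|x y]; apply: spec_sec_ext => P hP; rewrite /spec_val /= ?rmorph1 ?rmorphM.
Qed.
HB.instance Definition _ :=
  GRing.isNmodMorphism.Build _ _ spec_in_fun spec_in_nmod.
HB.instance Definition _ :=
  GRing.isMonoidMorphism.Build _ _ spec_in_fun spec_in_monoid.
Definition spec_in : {rmorphism R -> sec (otop spec_rs)} := spec_in_fun.

End SpecSheaf.

Lemma uniform_nat (T : eqType) (l : seq T) (P : T -> nat -> Prop) :
  (forall i m m', (m <= m')%N -> P i m -> P i m') ->
  (forall i, i \in l -> exists m, P i m) -> exists m, forall i, i \in l -> P i m.
Proof.
move=> mono; elim: l => [|i l IH] H; first by exists 0%N.
have [|m Hm] := IH; first by move=> k kl; apply: H; rewrite inE kl orbT.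
have [|m' Hm'] := H i; first by rewrite inE eqxx.
exists (maxn m m') => k; rewrite inE => /orP [/eqP ->|kl].
  exact: mono (leq_maxr _ _) Hm'.
exact: mono (leq_maxl _ _) (Hm _ kl).
Qed.

Lemma prime_exp (R : comPzRingType) (P : set R) x n : prime_ideal P -> P (x ^+ n) -> P x.
Proof.
case=> _ P1 PM; elim: n => [|n IH]; first by rewrite expr0 => /P1.
by rewrite exprS => /PM [|/IH].
Qed.

Lemma ideal_sum (R : comPzRingType) (I : set R) (T : eqType) (l : seq T) (F : T -> R) :
  is_ideal I -> (forall i, i \in l -> I (F i)) -> I (\sum_(i <- l) F i).
Proof.
move=> hI H; rewrite big_seq; apply: (big_ind I); first exact: ideal0.
  by move=> x y; exact: idealD.
by move=> i /H.
Qed.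

Lemma exists_prime_notin (R : comPzRingType) (I : set R) (a : R) : is_ideal I ->
  (forall n, ~ I (a ^+ n)) -> exists P, [/\ prime_ideal P, I `<=` P & ~ P a].
Proof.
move=> hI H.
have [||x Ix [n E]|P [hP IP SP]] := @exists_prime R I [set x | exists n, x = a ^+ n] hI.
- by exists 0%N.
- by move=> _ _ [m ->] [n ->]; exists (m + n)%N; rewrite exprD.
- by apply: (H n); rewrite -E.
exists P; split=> // Pa; apply: (SP a Pa); by exists 1%N.
Qed.

Section LinearSpan.
Variables (R : comPzRingType) (T : eqType) (F : T -> R) (G : T -> Prop).

(** The ideal generated by the [F i] with [G i]. The indices are kept in the combination because
    they will carry a numerator besides the denominator that generates. *)
Definition lspan : set R := [set x | exists l : seq (R * T),
  (forall i, i \in l -> G i.2) /\ x = \sum_(i <- l) i.1 * F i.2].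

Lemma lspan_ideal : is_ideal lspan.
Proof.
split.
- by exists [::]; rewrite big_nil.
- move=> _ _ [l [gl ->]] [l' [gl' ->]]; exists (l ++ l'); rewrite big_cat.
  by split=> // i; rewrite mem_cat => /orP [/gl|/gl'].
- move=> c _ [l [gl ->]]; exists [seq (c * i.1, i.2) | i <- l].
  split; first by move=> _ /mapP [i /gl il ->].
  by rewrite big_map big_distrr /=; apply: eq_bigr => i _; rewrite mulrA.
Qed.

Lemma lspan_in i : G i -> lspan (F i).
Proof.
move=> Gi; exists [:: (1, i)]; rewrite big_seq1 mul1r; split=> // j.
by rewrite inE => /eqP ->.
Qed.

End LinearSpan.

Section SpecSections.
Variable R : comPzRingType.
Local Notation spec := (spec R).
Local Notation Spec := (spec_rs R).
Implicit Types (U W : opens Spec) (P Q : spec).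

Lemma spec_val_in (r : R) P (h : oset (otop Spec) P) :
  spec_val (spec_in R r) h = fracP r (@spec_P1 R P).
Proof. by []. Qed.

Lemma spec_valM U (s t : sec U) P (h : oset U P) :
  spec_val (s * t) h = spec_val s h * spec_val t h.
Proof. by []. Qed.

Definition frac_sec U (a b : R) (h : forall P, oset U P -> spec_D b P) : sec U.
Proof.
exists (fun P : {P | oset U P} => fracP a (h _ (svalP P))).
move=> P hP; exists a, b; split; first exact: h.
by move=> Q hQ hb; apply: fracE.
Defined.
Lemma frac_secE U a b (h : forall P, oset U P -> spec_D b P) P (hP : oset U P)
  (hb : spec_D b P) : spec_val (frac_sec a h) hP = fracP a hb.
Proof. by apply: fracE. Qed.

Lemma spec_unit U (s : sec U) P a b : oset U P -> spec_D a P -> spec_D b P ->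
  (forall Q (hQ : oset U Q) (hb : spec_D b Q), spec_val s hQ = fracP a hb) ->
  unit_at s P.
Proof.
move=> UP Pa Pb E; pose W := oI U (spec_Do (a * b)).
have h : osub W U := oIl.
have ha Q : oset W Q -> spec_D a Q by move=> [_ /spec_DM []].
have hb Q : oset W Q -> spec_D b Q by move=> [_ /spec_DM []].
exists W, h; split; first by split=> //; exact/spec_DM.
exists (frac_sec b ha); apply: spec_sec_ext => Q hQ.
rewrite spec_valM spec_val_res (E _ _ (hb _ hQ)) (frac_secE _ _ _ (ha _ hQ)).
by rewrite fracM -[RHS]qpi1; apply: fracE; ring.
Qed.

Lemma spec_local P : local_stalk (P : Spec).
Proof.
have P0 : sval P 0 by case: (svalP P) => /ideal0.
have Pid : is_ideal (sval P) by case: (svalP P).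
split=> [U UP E|U s UP].
  have := congr1 (fun s => spec_val (U:=U) s UP) E.
  rewrite -[spec_val 1 UP]/(1 : locP P) -[spec_val 0 UP]/(0 : locP P).
  rewrite -(rmorph1 (@loc_in R _ (@spec_P1 R P) (@spec_PM R P))) => /loc_in_eq0.
  by move=> [u uP]; rewrite mulr1 => u0; apply: uP; rewrite u0.
have [a [b [hb E]]] := svalP s P UP.
case: (pselect (sval P a)) => Pa; last by left; exact: (spec_unit UP Pa hb).
right; have Pba : spec_D (b - a) P.
  by move=> H; apply: hb; rewrite -(subrK a b); exact: idealD.
apply: (spec_unit UP Pba hb) => Q hQ hb'.
rewrite -[LHS]/(1 - spec_val s hQ) [spec_val s hQ](E _ _ hb') fracN.
by rewrite -[X in X + _]qpi1 fracD; apply: fracE; ring.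
Qed.

Lemma spec_in_unit r P : unit_at (spec_in R r) P <-> spec_D r P.
Proof.
split=> [[W [h [WP [v E]]]] Pr|Pr]; last first.
  apply: (spec_unit (a:=r) (b:=1)) => //; first exact: spec_P1.
  by move=> Q hQ h1; rewrite spec_val_in; apply: fracE.
have := congr1 (fun s => spec_val (U:=W) s WP) E; rewrite spec_valM.
have [a [b [hb ->]]] := frac_surj (spec_val v WP).
rewrite spec_val_res spec_val_in fracM -[RHS]qpi1 => /frac_eq [u uP].
move=> E'; apply: (spec_PM uP hb); move: E'; rewrite !mulr1 !mul1r => <-.
have [Pid _ _] := svalP P.
by rewrite mulrCA mulrC; apply: idealM.
Qed.

(** If no power of [a] killed [r], some prime would contain the annihilator of [r] and avoid [a],
    and [r] would be nonzero in the localization at this prime. *)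
Lemma spec_in_res_eq0 U a r (hU : osub U (otop Spec)) :
  (forall P, spec_D a P -> oset U P) -> res hU (spec_in R r) = 0 ->
  exists n, a ^+ n * r = 0.
Proof.
move=> UD E; apply: contrapT => H.
pose Ann : set R := [set x | x * r = 0].
have hAnn : is_ideal Ann.
  split; first exact: mul0r.
    by move=> x y /= hx hy; rewrite /Ann /= mulrDl hx hy addr0.
  by move=> c x /= hx; rewrite /Ann /= -mulrA hx mulr0.
have [|P [hP AP Pa]] := @exists_prime_notin R Ann a hAnn.
  by move=> n Hn; apply: H; exists n.
pose P' : spec := exist _ P hP.
have hP' : oset U P' by apply: UD.
have := congr1 (fun s => spec_val (U:=U) s hP') E.
rewrite spec_val_res -[RHS]/(0 : locP P') => /loc_in_eq0 [u uP] ur.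
by apply: uP; apply: AP.
Qed.

(** The denominators of the local expressions generate an ideal containing a power of [a], so
    finitely many of them suffice; the numerators, made compatible by a common power, are then
    combined as in a partition of unity. *)
Lemma spec_sec_frac U a (t : sec U) (hU : osub U (otop Spec)) :
  (forall P, oset U P <-> spec_D a P) ->
  exists n r, res hU (spec_in R a) ^+ n * t = res hU (spec_in R r).
Proof.
move=> UD.
pose good (i : R * R) := forall Q (hQ : oset U Q) (hh : spec_D i.1 Q),
  spec_val t hQ = fracP i.2 hh.
have [n [l [gl an]]] : exists n, lspan fst good (a ^+ n).
  apply: contrapT => H.
  have [|P [hP HP Pa]] := @exists_prime_notin R _ a (lspan_ideal fst good).
    by move=> n Hn; apply: H; exists n.
  pose P' : spec := exist _ P hP.
  have [b [c [hc E]]] := svalP t P' ((UD P').2 Pa).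
  by apply: hc; apply: HP; apply: (@lspan_in _ _ fst good (c, b)) => Q hQ hh; exact: E.
(* On the intersection of two basic open sets the two fractions agree, so that a power kills the
   difference of the cross products; one [m] serves all pairs. *)
have [m Hm] : exists m, forall ij, ij \in allpairs pair l l ->
   (a * ij.1.2.1 * ij.2.2.1) ^+ m * (ij.1.2.2 * ij.2.2.1 - ij.2.2.2 * ij.1.2.1) = 0.
  apply: uniform_nat.
    by move=> i m m' /subnK <- E; rewrite exprD -mulrA E mulr0.
  move=> _ /allpairsP [[i j] [/= il jl ->]] /=.
  pose W := oI U (spec_Do (a * i.2.1 * j.2.1)).
  apply: (@spec_in_res_eq0 W _ _ (osub_trans oIl hU)).
    by move=> P HP; split=> //; apply/UD; move/spec_DM: HP => [/spec_DM []].
  apply: spec_sec_ext => Q hQ; rewrite spec_val_res.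
  have hQU := oIl _ hQ; have [_ /spec_DM [/spec_DM [_ hi] hj]] := hQ.
  have := gl _ il _ hQU hi; rewrite (gl _ jl _ hQU hj) => /frac_eq [u uP E].
  rewrite -[RHS]/(0 : locP Q); apply/loc_in_eq0; exists u => //.
  by rewrite mulrBr E subrr.
pose G (k : R * R) := exists2 i : R * (R * R), i \in l & k = i.2.
(* Thus [i.1 ^+ m * i.2] over [i.1 ^+ m.+1] represents the same fraction, and for these
   representations cross multiplication holds up to [a ^+ m] alone. *)
have {}Hm i j : G i -> G j -> a ^+ m * (i.1 ^+ m * i.2 * j.1 ^+ m.+1) =
    a ^+ m * (j.1 ^+ m * j.2 * i.1 ^+ m.+1).
  move=> [k kl ->] [k' kl' ->]; apply/eqP; rewrite -subr_eq0; apply/eqP.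
  have H : (k, k') \in allpairs pair l l by apply/allpairsP; exists (k, k').
  by rewrite -[RHS](Hm _ H) ?exprMn ?exprS /=; ring.
pose F (k : R * R) := k.1 ^+ m.+1.
have [n' [l' [gl' an']]] : exists n', lspan F G (a ^+ n').
  apply: contrapT => H.
  have [|P [hP JP Pa]] := @exists_prime_notin R _ a (lspan_ideal F G).
    by move=> k Hk; apply: H; exists k.
  apply: Pa; apply: (@prime_exp _ _ _ n hP); rewrite an.
  have [hid _ _] := hP; apply: ideal_sum => // i il; apply: idealM => //.
  by apply: (@prime_exp _ _ _ m.+1 hP); apply: JP; apply: (lspan_in F); exists i.
(* The coefficients that write [a ^+ n'] in terms of the new denominators [F i] are applied to the
   new numerators; [a ^+ m] pays for compatibility. *)
pose r := a ^+ m * \sum_(i <- l') i.1 * (i.2.1 ^+ m * i.2.2).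
exists (n' + m)%N, r; apply: spec_sec_ext => Q hQ.
have Qa : spec_D a Q by apply/UD.
have [j Gj hj] : exists2 j, G j & spec_D j.1 Q.
  apply: contrapT => H; case: (@spec_DX _ a n' Q Qa); rewrite an'.
  have [hid _ _] := svalP Q; apply: ideal_sum => // i il; apply: idealM => //.
  rewrite /F exprS mulrC; apply: idealM => //; apply: contrapT => Hi.
  by apply: H; exists i.2 => //; exact: gl'.
have [k kl jk] := Gj.
have hk : spec_D k.2.1 Q by rewrite -jk.
rewrite -rmorphXn -rmorphXn spec_valM !spec_val_res !spec_val_in (gl _ kl _ hQ hk).
rewrite [X in X = _]fracM; apply/frac_eq; exists (j.1 ^+ m); first exact: spec_DX.
rewrite -jk !mulr1 !mul1r.
suff E : j.1 ^+ m.+1 * r = a ^+ m * j.1 ^+ m * j.2 * a ^+ n'.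
  transitivity (j.1 ^+ m.+1 * r); first by rewrite E exprD; ring.
  by rewrite exprS; ring.
rewrite /r an' mulrCA !big_distrr /=; apply: eq_big_seq => i il.
transitivity (i.1 * (a ^+ m * (i.2.1 ^+ m * i.2.2 * j.1 ^+ m.+1))); first by ring.
by rewrite (Hm _ _ (gl' _ il) Gj) /F; ring.
Qed.

Lemma spec_in_inj : injective (spec_in R).
Proof.
apply: raddf_inj => r E.
have [||n] := @spec_in_res_eq0 (otop Spec) 1 r (@osub_refl _ _).
- by move=> P.
- by rewrite res_id.
by rewrite expr1n mul1r.
Qed.

Lemma spec_in_surj (s : sec (otop Spec)) : exists r, s = spec_in R r.
Proof.
have [|n [r]] := @spec_sec_frac (otop Spec) 1 s (@osub_refl _ _).
  by move=> P; split=> // _; exact: spec_P1.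
by rewrite !res_id rmorph1 expr1n mul1r => ->; exists r.
Qed.

Lemma spec_ext P Q : sval P = sval Q -> P = Q.
Proof. by case: P Q => P hP [Q hQ] /= E; apply: eq_exist. Qed.

Lemma spec_affine : affine (otop Spec).
Proof.
split.
- move=> P Q _ _ H; apply: spec_ext; apply/seteqP.
  have K r : ~ sval P r <-> ~ sval Q r.
    by rewrite -[~ sval P r]/(spec_D r P) -spec_in_unit H spec_in_unit.
  by split=> r hr; apply: contrapT => /K; exact.
- move=> P hP; have hQ : prime_ideal [set r | P (spec_in R r)].
    case: hP => hid P1 PM; split.
    + split=> [|x y|c x] /=; first by rewrite rmorph0; exact: ideal0.
        by rewrite rmorphD; exact: idealD.
      by rewrite rmorphM; exact: idealM.
    + by rewrite /= rmorph1.
    + by move=> x y /=; rewrite rmorphM; exact: PM.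
  exists (exist _ _ hQ) => //; apply/seteqP; split=> s.
    by have [r ->] := spec_in_surj s => Pr /spec_in_unit; apply.
  have [r ->] := spec_in_surj s => /= H; apply: contrapT => Pr.
  by apply: H; apply/spec_in_unit.
- move=> W P _ WP; have := oset_open W; rewrite spec_openE => /(_ P WP) [a Pa aW].
  exists (spec_in R a); split; first by split=> //; apply/spec_in_unit.
  by move=> Q [_ /spec_in_unit /aW].
- move=> s; have [a ->] := spec_in_surj s => t.
  have [|n [r E]] := @spec_sec_frac _ a t (@basic_open_sub _ _ (spec_in R a)).
    by move=> P; rewrite -spec_in_unit; split=> [[]|].
  by exists n, (spec_in R r).
- move=> s; have [a ->] := spec_in_surj s => t; have [r ->] := spec_in_surj t => E.
  have [|n H] := @spec_in_res_eq0 _ a r _ _ E.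
    by move=> P Pa; split=> //; apply/spec_in_unit.
  by exists n; rewrite -rmorphXn -rmorphM H rmorph0.
Qed.

Definition spec_scheme : scheme :=
  @Scheme Spec spec_local (fun x => ex_intro2 _ _ (otop Spec) I spec_affine).

End SpecSections.

Section Spec.
Variable R : comPzRingType.

(** Choosing [Spec] from an existence statement keeps the sheaf of fractions from
    being unfolded; the same is done for [stalk] and [stalk_map]. *)
Lemma Spec_exists : exists S : {T : scheme & {rmorphism R -> sec (otop T)}},
  [/\ affine (otop (projT1 S)), injective (projT2 S) &
      forall s, exists r, s = projT2 S r].
Proof.
exists (existT (fun T : scheme => {rmorphism R -> sec (otop T)}) (spec_scheme R) (spec_in R)).
split; [exact: spec_affine|exact: spec_in_inj|exact: spec_in_surj].
Qed.

Definition Spec : scheme := projT1 (sval (cid Spec_exists)).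
Definition Spec_in : {rmorphism R -> sec (otop Spec)} := projT2 (sval (cid Spec_exists)).
Lemma Spec_affine : affine (otop Spec).
Proof. by case: (svalP (cid Spec_exists)). Qed.
Lemma Spec_inj : injective Spec_in.
Proof. by case: (svalP (cid Spec_exists)). Qed.
Lemma Spec_surj s : exists r, s = Spec_in r.
Proof. by case: (svalP (cid Spec_exists)) => _ _; apply. Qed.

End Spec.

(** * Stalks *)

Section Res.
Variable X : ringedSpace.
Lemma resE (U W T : opens X) (h1 : osub W U) (h2 : osub T W) (s : sec U) :
  res h2 (res h1 s) = res (osub_trans h2 h1) s.
Proof. exact: res_comp. Qed.
Lemma res_irr (U W : opens X) (h h' : osub W U) (s : sec U) : res h s = res h' s.
Proof. by congr (res _ s); exact: Prop_irrelevance. Qed.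
Lemma osub_top (U : opens X) : osub U (otop X). Proof. by []. Qed.
End Res.
Arguments osub_top {X} U.

Section Stalk.
Variables (X : ringedSpace) (x : X).

Record germ_rep := GermRep { gr_open : opens X; gr_in : oset gr_open x; gr_sec : sec gr_open }.

Let eqv (a b : germ_rep) := exists W (h : osub W (gr_open a)) (h' : osub W (gr_open b)),
  oset W x /\ res h (gr_sec a) = res h' (gr_sec b).
Let op2 (f : forall U, sec U -> sec U -> sec U) (a b : germ_rep) : germ_rep :=
  @GermRep (oI (gr_open a) (gr_open b)) (conj (gr_in a) (gr_in b))
    (f _ (res oIl (gr_sec a)) (res oIr (gr_sec b))).

Definition stalk_setoid : setoid_ring.
Proof.
refine (@SetoidRing germ_rep eqv
  (@GermRep (otop X) I 0) (@GermRep (otop X) I 1)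
  (fun a => @GermRep (gr_open a) (gr_in a) (- gr_sec a))
  (op2 (fun U => +%R)) (op2 (fun U => *%R)) _ _ _ _ _ _ _ _ _ _ _ _ _ _).
- by move=> a; exists (gr_open a), (@osub_refl _ _), (@osub_refl _ _); split; case: a.
- by move=> a b [W [h [h' [Wx E]]]]; exists W, h', h.
- move=> a b c [W [h [h' [Wx E]]]] [T [k [k' [Tx F]]]].
  exists (oI W T), (osub_trans oIl h), (osub_trans oIr k'); split=> //.
  move: (congr1 (res (@oIl _ W T)) E) (congr1 (res (@oIr _ W T)) F).
  by rewrite !resE => -> <-; exact: res_irr.
- by move=> a b [W [h [h' [Wx E]]]]; exists W, h, h'; split=> //=; rewrite !rmorphN E.
- move=> [U Ux s] [U' Ux' s'] [T Tx t] [W [h [h' [/= Wx E]]]].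
  have k : osub (oI W T) (oI U T) by move=> y [/h ? ?].
  have k' : osub (oI W T) (oI U' T) by move=> y [/h' ? ?].
  exists (oI W T), k, k'; split=> //=; rewrite !rmorphD /= !resE.
  move: (congr1 (res (@oIl _ W T)) E); rewrite !resE => {}E.
  congr (_ + _); last exact: res_irr.
  by rewrite (res_irr _ (osub_trans oIl h)) E; exact: res_irr.
- move=> [U Ux s] [U' Ux' s'] [T Tx t] [W [h [h' [/= Wx E]]]].
  have k : osub (oI W T) (oI U T) by move=> y [/h ? ?].
  have k' : osub (oI W T) (oI U' T) by move=> y [/h' ? ?].
  exists (oI W T), k, k'; split=> //=; rewrite !rmorphM /= !resE.
  move: (congr1 (res (@oIl _ W T)) E); rewrite !resE => {}E.
  congr (_ * _); last exact: res_irr.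
  by rewrite (res_irr _ (osub_trans oIl h)) E; exact: res_irr.
- move=> [U Ux s] [W Wx t] [T Tx r].
  have k : osub (oI U (oI W T)) (oI (oI U W) T) by move=> y [? [? ?]].
  exists _, (@osub_refl _ _), k; split=> //=; rewrite res_id.
  by rewrite !rmorphD /= !resE addrA; congr (_ + _ + _); exact: res_irr.
- move=> [U Ux s] [W Wx t].
  have k : osub (oI U W) (oI W U) by move=> y [].
  exists _, (@osub_refl _ _), k; split=> //=; rewrite res_id.
  by rewrite !rmorphD /= !resE addrC; congr (_ + _); exact: res_irr.
- move=> [U Ux s].
  exists _, (@osub_refl _ _), oIr; split=> //=.
  by rewrite res_id !rmorph0 add0r.
- move=> [U Ux s].
  exists _, (@osub_refl _ _), (osub_top _); split=> //=.
  rewrite res_id !rmorph0 rmorphN /= (res_irr oIl oIr); exact: addNr.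
- move=> [U Ux s] [W Wx t] [T Tx r].
  have k : osub (oI U (oI W T)) (oI (oI U W) T) by move=> y [? [? ?]].
  exists _, (@osub_refl _ _), k; split=> //=; rewrite res_id.
  by rewrite !rmorphM /= !resE mulrA; congr (_ * _ * _); exact: res_irr.
- move=> [U Ux s] [W Wx t].
  have k : osub (oI U W) (oI W U) by move=> y [].
  exists _, (@osub_refl _ _), k; split=> //=; rewrite res_id.
  by rewrite !rmorphM /= !resE mulrC; congr (_ * _); exact: res_irr.
- move=> [U Ux s].
  exists _, (@osub_refl _ _), oIr; split=> //=.
  by rewrite res_id !rmorph1 mul1r.
- move=> [U Ux s] [W Wx t] [T Tx r].
  have k : osub (oI (oI U W) T) (oI (oI U T) (oI W T)) by move=> y [[]].
  exists _, (@osub_refl _ _), k; split=> //=; rewrite res_id.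
  rewrite !rmorphD !rmorphM /= !resE mulrDl.
  by congr (_ * _ + _ * _); exact: res_irr.
Defined.

Definition pstalk : comPzRingType := qring stalk_setoid.

Definition pgerm (U : opens X) (hU : oset U x) (s : sec U) : pstalk :=
  @qpi stalk_setoid (GermRep hU s).

Lemma pgerm_eq U W (hU : oset U x) (hW : oset W x) s t : pgerm hU s = pgerm hW t <->
  exists T (h : osub T U) (h' : osub T W), oset T x /\ res h s = res h' t.
Proof. exact: qpi_eq. Qed.

Lemma pgerm_surj (a : pstalk) : exists U (hU : oset U x) s, a = pgerm hU s.
Proof. by elim/qind: a => -[U hU s]; exists U, hU, s. Qed.

Section GermMorphism.
Variables (U : opens X) (hU : oset U x).
Lemma pgerm_nmod : nmod_morphism (pgerm hU).
Proof.
split=> [|s t]; first by rewrite -qpi0; apply/pgerm_eq; exists U, (@osub_refl _ _), (fun=> fun=> I);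
  split=> //; rewrite !rmorph0.
rewrite -qpiD; apply/pgerm_eq; have k : osub U (oI U U) by [].
by exists U, (@osub_refl _ _), k; split=> //=; rewrite !rmorphD /= !resE;
  congr (_ + _); exact: res_irr.
Qed.
Lemma pgerm_monoid : monoid_morphism (pgerm hU).
Proof.
split=> [|s t]; first by rewrite -qpi1; apply/pgerm_eq; exists U, (@osub_refl _ _), (fun=> fun=> I);
  split=> //; rewrite !rmorph1.
rewrite -qpiM; apply/pgerm_eq; have k : osub U (oI U U) by [].
by exists U, (@osub_refl _ _), k; split=> //=; rewrite !rmorphM /= !resE;
  congr (_ * _); exact: res_irr.
Qed.
HB.instance Definition _ := GRing.isNmodMorphism.Build _ _ (pgerm hU) pgerm_nmod.
HB.instance Definition _ := GRing.isMonoidMorphism.Build _ _ (pgerm hU) pgerm_monoid.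
End GermMorphism.

Lemma stalk_exists : exists S : {A : comPzRingType &
  forall U : opens X, oset U x -> {rmorphism sec U -> A}}, is_stalk (projT2 S).
Proof.
exists (existT (fun A : comPzRingType => forall U : opens X, oset U x -> {rmorphism sec U -> A})
  pstalk (fun U hU => pgerm hU : {rmorphism _ -> _})); split=> /=.
- move=> U W h hU hW s; apply/pgerm_eq.
  by exists W, (@osub_refl _ _), h; split=> //; rewrite res_id.
- by move=> a; have [U [hU [s ->]]] := pgerm_surj a; exists U, hU, s.
- move=> U hU s E; have [|T [h [h' [Tx F]]]] := (pgerm_eq hU hU s 0).1.
    by rewrite E; exact/esym/(rmorph0 (pgerm hU)).
  by exists T, h; rewrite F rmorph0.
Qed.

Definition stalk : comPzRingType := projT1 (sval (cid stalk_exists)).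
Definition germ (U : opens X) (hU : oset U x) : {rmorphism sec U -> stalk} :=
  projT2 (sval (cid stalk_exists)) U hU.

Lemma germ_surj (a : stalk) : exists U (hU : oset U x) s, a = germ hU s.
Proof.
have [_ H _] := svalP (cid stalk_exists); have [U [hU [s E]]] := H a.
by exists U, hU, s.
Qed.

Lemma germ_res U W (h : osub W U) (hU : oset U x) (hW : oset W x) s :
  germ hW (res h s) = germ hU s.
Proof. by have [H _ _] := svalP (cid stalk_exists); exact: H. Qed.

Lemma germ_eq U W (hU : oset U x) (hW : oset W x) s t : germ hU s = germ hW t <->
  exists T (h : osub T U) (h' : osub T W), oset T x /\ res h s = res h' t.
Proof.
split=> [E|[T [h [h' [Tx E]]]]]; last first.
  by rewrite -(germ_res h hU Tx) E germ_res.
have [_ _ H] := svalP (cid stalk_exists).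
pose hI : oset (oI U W) x := conj hU hW.
have [|T [h [Tx F]]] := H _ hI (res oIl s - res oIr t).
  rewrite -[LHS]/(germ hI _) rmorphB.
  by rewrite (germ_res (@oIl _ U W) hU hI) (germ_res (@oIr _ U W) hW hI) E subrr.
exists T, (osub_trans h oIl), (osub_trans h oIr); split=> //.
by move: F; rewrite rmorphB !resE => /eqP; rewrite subr_eq0 => /eqP.
Qed.

Lemma germ_in W (hW : oset W x) (a : stalk) :
  exists U (h : osub U W) (hU : oset U x) s, a = germ hU s.
Proof.
have [U [hU [s ->]]] := germ_surj a.
exists (oI U W), oIr, (conj hU hW), (res oIl s); by rewrite (germ_res _ hU).
Qed.

Lemma germ_eq0 U (hU : oset U x) s : germ hU s = 0 <->
  exists T (h : osub T U), oset T x /\ res h s = 0.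
Proof.
rewrite -(rmorph0 (germ hU)) germ_eq; split=> [[T [h [h' [Tx]]]]|[T [h [Tx E]]]].
  by rewrite rmorph0 => E; exists T, h.
by exists T, h, h; rewrite rmorph0.
Qed.

Lemma germ_unit U (hU : oset U x) s : invertible (germ hU s) <-> unit_at s x.
Proof.
split=> [[a]|[W [h [Wx [t E]]]]]; last first.
  by exists (germ Wx t); rewrite -(germ_res h hU Wx) -rmorphM E rmorph1.
have [W [h [hW [t ->]]]] := germ_in hU a.
rewrite -(germ_res h hU hW) -rmorphM -(rmorph1 (germ hW)) => /germ_eq.
move=> [T [k [k' [Tx]]]]; rewrite rmorphM rmorph1 resE => E.
by exists T, (osub_trans k h); split=> //; exists (res k t).
Qed.

Lemma unit_at1 U (hU : oset U x) : unit_at (1 : sec U) x.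
Proof. by apply/(germ_unit hU); exists 1; rewrite rmorph1 mulr1. Qed.

Lemma unit_at_mul U (s t : sec U) : oset U x ->
  unit_at (s * t) x <-> unit_at s x /\ unit_at t x.
Proof.
move=> Ux; rewrite -!(germ_unit Ux) rmorphM.
split=> [H|[]]; last exact: invertibleM.
by split; [apply: invertibleMl H | apply: (@invertibleMl _ _ (germ Ux s)); rewrite mulrC].
Qed.

Lemma unit_at_germ U (hU : oset U x) s : unit_at s x -> invertible (germ hU s).
Proof. by move/germ_unit; apply. Qed.

End Stalk.

Lemma germ_ext (X : ringedSpace) (U : opens X) (s t : sec U) :
  (forall x (hx : oset U x), germ hx s = germ hx t) -> s = t.
Proof.
move=> H; apply: sec_eq => x hx; have [T [h [h' [Tx E]]]] := (germ_eq _ _ _ _).1 (H x hx).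
by exists T, h; split=> //; rewrite E; exact: res_irr.
Qed.

Lemma sec_of_germs (X : ringedSpace) (U : opens X) (g : forall x, oset U x -> stalk x) :
  (forall x, oset U x -> exists W (h : osub W U) (s : sec W), oset W x /\
     forall y (hy : oset W y), g y (h y hy) = germ hy s) ->
  exists s : sec U, forall x (hx : oset U x), germ hx s = g x hx.
Proof.
move=> H; pose I := {x | oset U x}.
have ch (i : I) := cid (H _ (svalP i)).
have ch2 (i : I) := cid (svalP (ch i)).
have ch3 (i : I) := cid (svalP (ch2 i)).
pose D i := sval (ch i); pose hD i : osub (D i) U := sval (ch2 i).
pose s i : sec (D i) := sval (ch3 i).
have sx i : oset (D i) (sval i) := (svalP (ch3 i)).1.
have sE i y (hy : oset (D i) y) : g y (hD i y hy) = germ hy (s i) := (svalP (ch3 i)).2 y hy.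
have [|i j W hi hj|t Ht] := @sec_glue X U I D hD s.
- by move=> x hx; exists (exist _ x hx); exact: sx.
- apply: germ_ext => y Wy.
  rewrite (germ_res hi (hi y Wy)) (germ_res hj (hj y Wy)) -!sE.
  by congr (g y _); exact: Prop_irrelevance.
exists t => x hx; pose i : I := exist _ x hx.
rewrite -(germ_res (hD i) hx (sx i)) Ht -sE.
by congr (g x _); exact: Prop_irrelevance.
Qed.

Lemma unit_glue (X : ringedSpace) (U : opens X) (s : sec U) :
  (forall x, oset U x -> unit_at s x) -> invertible s.
Proof.
move=> H.
have inv x (hx : oset U x) : {a | germ hx s * a = 1} by apply/cid/germ_unit/H.
have [x hx|t Ht] := @sec_of_germs X U (fun x hx => sval (inv x hx)); last first.
  by exists t; apply: germ_ext => x hx; rewrite rmorphM rmorph1 /= Ht (svalP (inv x hx)).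
have [W [h [Wx [t E]]]] := H x hx; exists W, h, t; split=> // y hy.
apply: (@unit_cancel _ (germ (h y hy) s)); first by apply/germ_unit/H/h.
by rewrite (svalP (inv y (h y hy))) -(germ_res h (h y hy) hy) -rmorphM E rmorph1.
Qed.

Definition pre_maps (X Y : scheme) (f : mor X Y) (U : opens Y) : maps f (pre f U) U :=
  fun x h => h.
Arguments pre_maps {X Y} f U.

Lemma germ_pair (Z : ringedSpace) (z : Z) (a b : stalk z) :
  exists U (hU : oset U z) s t, a = germ hU s /\ b = germ hU t.
Proof.
have [U [hU [s ->]]] := germ_surj a; have [W [h [hW [t ->]]]] := germ_in hU b.
by exists W, hW, (res h s), t; rewrite (germ_res h hU).
Qed.

Section StalkMap.
Variables (X Y : scheme) (f : mor X Y) (x : X) (y : Y) (e : f x = y).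

Lemma maps_at (U : opens Y) : oset U y -> oset (pre f U) x.
Proof. by rewrite -e. Qed.

Lemma stalk_map_rep (a : stalk y) : exists b : stalk x,
  forall U (hU : oset U y) s W (hW : oset W x) (m : maps f W U), a = germ hU s ->
    b = germ hW (comor m s).
Proof.
have [U [hU [s E]]] := germ_surj a.
exists (germ (maps_at hU) (comor (pre_maps f U) s)) => U' hU' s' W hW m.
rewrite {}E => /germ_eq [T [h [h' [Ty E]]]]; apply/germ_eq.
have k1 : maps f (oI W (pre f T)) T by move=> z [].
have k2 : osub (oI W (pre f T)) (pre f U) by move=> z [_ /h].
exists (oI W (pre f T)), k2, oIl; split.
  by split=> //; exact: maps_at.
have := congr1 (comor k1) E; rewrite (comor_resl _ _ (fun z (hz : oset (oI W (pre f T)) z) => h _ (k1 z hz))).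
rewrite (comor_resl _ _ (fun z (hz : oset (oI W (pre f T)) z) => h' _ (k1 z hz))).
move=> E'; rewrite !(comor_resr _ _ (fun z (hz : oset (oI W (pre f T)) z) => h _ (k1 z hz))).
by rewrite E' (comor_resr _ _ (fun z (hz : oset (oI W (pre f T)) z) => h' _ (k1 z hz))).
Qed.

Let stalk_map0 (a : stalk y) : stalk x := sval (cid (stalk_map_rep a)).

Let stalk_map0E U (hU : oset U y) s W (hW : oset W x) (m : maps f W U) :
  stalk_map0 (germ hU s) = germ hW (comor m s).
Proof. exact: (svalP (cid (stalk_map_rep (germ hU s)))). Qed.

Let stalk_map0_nmod : nmod_morphism stalk_map0.
Proof.
split=> [|a b].
  by rewrite -(rmorph0 (@germ Y y (otop Y) I)) (@stalk_map0E (otop Y) I 0 (otop X) I (fun _ _ => I)) !rmorph0.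
have [U [hU [s [t [-> ->]]]]] := germ_pair a b.
by rewrite -rmorphD !(stalk_map0E hU _ (maps_at hU) (pre_maps _ _)) !rmorphD.
Qed.
Let stalk_map0_monoid : monoid_morphism stalk_map0.
Proof.
split=> [|a b].
  by rewrite -(rmorph1 (@germ Y y (otop Y) I)) (@stalk_map0E (otop Y) I 1 (otop X) I (fun _ _ => I)) !rmorph1.
have [U [hU [s [t [-> ->]]]]] := germ_pair a b.
by rewrite -rmorphM !(stalk_map0E hU _ (maps_at hU) (pre_maps _ _)) !rmorphM.
Qed.
HB.instance Definition _ := GRing.isNmodMorphism.Build _ _ stalk_map0 stalk_map0_nmod.
HB.instance Definition _ := GRing.isMonoidMorphism.Build _ _ stalk_map0 stalk_map0_monoid.

Lemma stalk_map_exists : exists h : {rmorphism stalk y -> stalk x},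
  forall U (hU : oset U y) s W (hW : oset W x) (m : maps f W U),
    h (germ hU s) = germ hW (comor m s).
Proof. by exists (stalk_map0 : {rmorphism _ -> _}) => U hU s W hW m; exact: stalk_map0E. Qed.

(** The image point is a variable [y] with an equation, so that morphisms that agree only
    propositionally at a point, such as two composites, induce maps between the same stalks. *)
Definition stalk_map : {rmorphism stalk y -> stalk x} := sval (cid stalk_map_exists).
Lemma stalk_mapE U (hU : oset U y) s W (hW : oset W x) (m : maps f W U) :
  stalk_map (germ hU s) = germ hW (comor m s).
Proof. exact: (svalP (cid stalk_map_exists)). Qed.

Lemma stalk_map_local a : invertible (stalk_map a) -> invertible a.
Proof.
have [U [hU [s ->]]] := germ_surj a.
rewrite (stalk_mapE hU s (maps_at hU) (pre_maps _ _)) => /germ_unit.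
by move/(mor_local (maps_at hU)); rewrite e => /unit_at_germ.
Qed.

End StalkMap.

Lemma stalk_map_comp (X Y Z : scheme) (g : mor Y Z) (f : mor X Y) x y z
  (e : f x = y) (e' : g y = z) (e'' : (g ∘m f) x = z) a :
  stalk_map e'' a = stalk_map e (stalk_map e' a).
Proof.
have [U [hU [s ->]]] := germ_surj a.
rewrite (stalk_mapE e' hU s (maps_at e' hU) (pre_maps _ _)).
rewrite (stalk_mapE e _ _ (maps_at e (maps_at e' hU)) (pre_maps _ _)).
have hx : oset (pre f (pre g U)) x by exact: (maps_at e (maps_at e' hU)).
rewrite (stalk_mapE e'' hU s hx (pre_maps _ _)) /= /comp_comor /=.
by congr (germ _ _).
Qed.

Lemma stalk_map_eq (X Y : scheme) (f g : mor X Y) x y (e : f x = y) (e' : g x = y) a :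
  f =m g -> stalk_map e a = stalk_map e' a.
Proof.
move=> [E1 E2]; have [U [hU [s ->]]] := germ_surj a.
have m : maps g (pre f U) U by move=> t; rewrite /= -E1.
rewrite (stalk_mapE e hU s (maps_at e hU) (pre_maps _ _)).
by rewrite (stalk_mapE e' hU s (maps_at e hU) m); congr (germ _ _); exact: E2.
Qed.

Lemma stalk_map_id (X : scheme) (f : mor X X) (x : X) (e : f x = x) (a : stalk x) :
  f =m idm X -> stalk_map e a = a.
Proof.
move=> E; rewrite (stalk_map_eq e (erefl : idm X x = x) _ E).
have [U [hU [s ->]]] := germ_surj a.
have m : maps (idm X) U U by [].
by rewrite (stalk_mapE _ hU s hU m) /= /id_comor (germ_res _ hU).
Qed.

Lemma stalk_neq0 (X : scheme) (x : X) : (1 : stalk x) <> 0.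
Proof.
have [H _] := sch_local x; rewrite -(rmorph1 (@germ X x (otop X) I)) => /germ_eq0.
by move=> [T [h [Tx]]]; rewrite rmorph1 => /H; apply.
Qed.

Lemma stalk_local (X : scheme) (x : X) (a : stalk x) : invertible a \/ invertible (1 - a).
Proof.
have [_ H] := sch_local x; have [U [hU [s ->]]] := germ_surj a.
rewrite -(rmorph1 (germ hU)) -rmorphB.
by case: (H U s hU) => /(unit_at_germ hU); [left|right].
Qed.

Lemma stalk_localD (X : scheme) (x : X) (a b : stalk x) :
  invertible (a + b) -> invertible a \/ invertible b.
Proof.
move=> [c E]; case: (stalk_local (a * c)) => [/invertibleMl|]; first by left.
have -> : 1 - a * c = b * c by rewrite -E; ring.
by move/invertibleMl; right.
Qed.

(** * Affine open sets *)

Lemma unit_at_morph (X Y : scheme) (f : mor X Y) U W (m : maps f W U) (s : sec U) x :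
  oset W x -> unit_at s (f x) -> unit_at (comor m s) x.
Proof.
move=> Wx [T [h [Tx [t E]]]].
have k : osub (oI W (pre f T)) W := oIl.
have mT : maps f (oI W (pre f T)) T by move=> y [].
exists (oI W (pre f T)), k; split=> //; exists (comor mT t).
have mU : maps f (oI W (pre f T)) U by move=> y [Wy _]; exact: m.
by rewrite (comor_resr _ _ mU) -(comor_resl h mT) -rmorphM E rmorph1.
Qed.

Lemma unit_at_res (X : ringedSpace) (U W : opens X) (h : osub W U) (s : sec U) x :
  oset W x -> unit_at (res h s) x <-> unit_at s x.
Proof.
move=> Wx; have Ux := h x Wx.
by rewrite -(germ_unit Wx) -(germ_unit Ux) (germ_res h Ux).
Qed.

Section Affine.
Variables (X : scheme) (U : opens X) (aU : affine U).

Lemma affine_basis (W : opens X) x : oset U x -> oset W x ->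
  exists s : sec U, oset (basic_open s) x /\ osub (basic_open s) W.
Proof.
move=> Ux Wx; have [_ _ H _ _] := aU.
have [//|s [sx sW]] := H (oI U W) x oIl.
by exists s; split=> // y /sW [].
Qed.

Lemma affine_stalk x (hx : oset U x) (a : stalk x) :
  exists s t : sec U, unit_at s x /\ germ hx s * a = germ hx t.
Proof.
have [W [h [Wx [a0 ->]]]] := germ_in hx a.
have [s [sx sW]] := affine_basis hx Wx; have [_ _ _ H _] := aU.
have [n [b E]] := H s (res sW a0).
exists (s ^+ n), b; have su : unit_at s x by case: sx.
split; first by apply/(germ_unit hx); rewrite rmorphXn; apply/invertibleX/(germ_unit hx).
rewrite -(germ_res (@basic_open_sub X U s) hx sx b) -E rmorphM /= (germ_res sW Wx sx).
by rewrite !rmorphXn /= (germ_res _ hx).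
Qed.

Lemma affine_germ0 x (hx : oset U x) (a : sec U) :
  germ hx a = 0 -> exists2 s : sec U, unit_at s x & s * a = 0.
Proof.
move/germ_eq0 => [T [h [Tx E]]].
have [s [sx sT]] := affine_basis hx Tx; have [_ _ _ _ H] := aU.
have [|n En] := H s a.
  by rewrite (res_irr _ (osub_trans sT h)) -resE E rmorph0.
exists (s ^+ n) => //; apply/(germ_unit hx); rewrite rmorphXn.
by apply/invertibleX/(germ_unit hx); case: sx.
Qed.

Lemma affine_prime x : oset U x -> prime_ideal [set s : sec U | ~ unit_at s x].
Proof.
move=> hx; have H (s : sec U) : ([set s | ~ unit_at s x] : set (sec U)) s <-> ~ invertible (germ hx s).
  by rewrite /= germ_unit.
split.
- split=> [|s t|c s]; rewrite !H.
  + by rewrite rmorph0 => -[a]; rewrite mul0r => /esym/stalk_neq0.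
  + by move=> hs ht; rewrite rmorphD => /stalk_localD [].
  + by move=> hs; rewrite rmorphM mulrC => /invertibleMl.
- by rewrite H rmorph1; apply; exists 1; rewrite mulr1.
- move=> s t; rewrite !H rmorphM => Hst; apply: contrapT => /not_orP [/contrapT hs /contrapT ht].
  by apply: Hst; exact: invertibleM.
Qed.

(** If the members of [G] generated a proper ideal, a prime above it would be a point of [U] at
    which none of them is a unit. The terms in an expression of 1 form the finite list. *)
Lemma affine_qc (G : set (sec U)) :
  (forall x, oset U x -> exists2 s : sec U, unit_at s x & G s) ->
  exists l : seq (sec U), (forall s, s \in l -> G s) /\
    forall x, oset U x -> exists2 s, s \in l & unit_at s x.
Proof.
move=> H; have [l [gl E]] : lspan id G 1.
  apply: contrapT => N.
  have [|P [hP JP _]] := @exists_prime_notin _ _ 1 (lspan_ideal id G).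
    by move=> n; rewrite expr1n.
  have [_ K _ _ _] := aU; have [x hx PE] := K P hP.
  have [s su Gs] := H x hx.
  by have := JP s (lspan_in id Gs); rewrite PE; apply.
exists [seq i.2 | i <- l]; split; first by move=> _ /mapP [i /gl Gi ->].
move=> x hx; apply: contrapT => N; have [hid P1 _] := affine_prime hx.
apply: P1; rewrite E; apply: (ideal_sum hid) => i il; apply: (idealM _ hid) => u.
by apply: N; exists i.2 => //; exact: map_f.
Qed.

Section Basic.
Variable s : sec U.
Let D := basic_open s.
Let hD : osub D U := @basic_open_sub X U s.

Lemma basic_inv : invertible (res hD s).
Proof. by apply: unit_glue => x Dx; apply/unit_at_res => //; case: Dx. Qed.

(** A section over [D] becomes the restriction of one over [U] after multiplication with a power of
    [s], which is invertible on [D]; this carries the clauses on primes and on fractions from [U] to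
    [D]. *)
Lemma affine_basic : affine D.
Proof.
have [A1 A2 A3 A4 A5] := aU; split.
- move=> x y Dx Dy H; apply: A1 => [||t]; [exact: hD|exact: hD|].
  by rewrite -(unit_at_res hD _ Dx) -(unit_at_res hD _ Dy).
- move=> P hP; have hP0 : prime_ideal [set t : sec U | P (res hD t)].
    case: hP => hid P1 PM; split.
    + split=> [|x y|c x] /=; first by rewrite rmorph0; exact: ideal0.
        by rewrite rmorphD; exact: idealD.
      by rewrite rmorphM; exact: idealM.
    + by rewrite /= rmorph1.
    + by move=> x y /=; rewrite rmorphM; exact: PM.
  have [x Ux E] := A2 _ hP0.
  have Pu t : invertible t -> ~ P t.
    by move=> [v tv] Pt; case: hP => hid; rewrite -tv mulrC => P1 _; apply: P1; exact: idealM.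
  have su : unit_at s x.
    apply: contrapT => N; have : [set s | ~ unit_at s x] s by [].
    by rewrite -E; apply: Pu; exact: basic_inv.
  exists x => //; apply/seteqP.
  have K t : P t <-> ~ unit_at t x.
    have [n [a Ea]] := A4 s t.
    have Dx : oset D x by [].
    have -> : P t <-> P (res hD a).
      rewrite -Ea; case: (hP) => hid _ PM; split=> [Pt|/PM [/(@prime_exp _ _ _ _ hP)|//]].
        exact: idealM.
      by move/(Pu _ basic_inv).
    rewrite -[P (res hD a)]/([set t : sec U | P (res hD t)] a) E /=.
    rewrite -(unit_at_res hD _ Dx) -Ea -!(germ_unit Dx) rmorphM.
    have un : invertible (germ Dx (res hD s ^+ n)).
      exact: invertible_morph (invertibleX _ basic_inv).
    split=> H H'; apply: H; first exact: invertibleM.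
    by move: H'; rewrite mulrC => /invertibleMl.
  by split=> t /K.
- move=> W x WD Wx; have [t [tx tW]] := A3 W x (osub_trans WD hD) Wx.
  exists (res hD t); split; first by split; [exact: WD|apply/unit_at_res; [exact: WD|case: tx]].
  move=> y [Dy]; rewrite unit_at_res // => ty; apply: tW; split=> //; exact: hD.
- move=> s1 t; have [n [a Ea]] := A4 s s1.
  have DxE x : oset D x -> unit_at s1 x <-> unit_at (s * a) x.
    move=> Dx; have Ux := hD Dx; rewrite -(germ_unit Dx) -(germ_unit Ux) rmorphM /=.
    rewrite -(germ_res hD Ux Dx a) -Ea rmorphM rmorphXn /= (germ_res hD Ux Dx).
    have un : invertible (germ Ux s) by apply/germ_unit; case: Dx.
    split=> [H|]; first by do ?apply: invertibleM => //; exact: invertibleX.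
    by rewrite mulrA mulrC => /invertibleMl.
  (* The basic open set of [s1] in [D] is the basic open set of [s * a] in [U]. *)
  have k1 : osub (basic_open (s * a)) D.
    move=> x [Ux H]; split=> //; move: H; rewrite -!(germ_unit Ux) rmorphM.
    exact: invertibleMl.
  have k2 : osub (basic_open (s * a)) (basic_open s1).
    by move=> x H; split; [exact: k1|apply/DxE; [exact: k1|case: H]].
  have k3 : osub (basic_open s1) (basic_open (s * a)).
    by move=> x [Dx H]; split; [exact: hD|apply/DxE].
  have [m [b Eb]] := A4 (s * a) (res k2 t).
  have [v sv] := basic_inv.
  exists m, (v ^+ (n.+1 * m) * res hD b).
  have := congr1 (res k3) Eb; rewrite rmorphM rmorphXn !resE.
  set k4 := osub_trans _ _; rewrite (res_irr _ (@osub_refl _ _) t) res_id => E.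
  set hs1 := @basic_open_sub X D s1.
  rewrite rmorphM resE (res_irr _ k4 b) -E (res_irr _ (osub_trans hs1 hD)).
  rewrite -(resE hD hs1) rmorphM -Ea mulrA -!rmorphXn -!rmorphM.
  congr (res _ _ * t).
  rewrite exprM -exprMn; congr (_ ^+ m).
  transitivity ((res hD s * v) ^+ n.+1 * s1); first by rewrite sv expr1n mul1r.
  rewrite exprMn mulrAC mulrC; congr (_ * _).
  by rewrite [_ ^+ n.+1]exprS -mulrA rmorphXn.
- move=> s1 a1 E; have [n [a Ea]] := A4 s s1; have [k [b Eb]] := A4 s a1.
  have k2 : osub (basic_open (s * a)) (basic_open s1).
    move=> x [Ux /(germ_unit Ux)]; rewrite rmorphM => H; have Hs := invertibleMl H.
    have Dx : oset D x by split=> //; apply/germ_unit.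
    split=> //; apply/(germ_unit Dx).
    move: H; rewrite -(germ_res hD Ux Dx a) -Ea rmorphM mulrC => /invertibleMl.
    by rewrite mulrC => /invertibleMl.
  have [|m Em] := A5 (s * a) b.
    have := congr1 (res k2) E; rewrite rmorph0 resE => E'.
    have k1 := osub_trans k2 (@basic_open_sub X D s1).
    rewrite (res_irr _ (osub_trans k1 hD)) -resE -Eb rmorphM.
    by rewrite (res_irr _ (osub_trans k2 (@basic_open_sub X D s1)) a1) E' mulr0.
  exists m; apply: (@unit_cancel _ (res hD s ^+ (n.+1 * m + k))).
    exact: invertibleX basic_inv.
  rewrite mulr0 -[RHS](rmorph0 (res hD)) -Em rmorphM -Eb rmorphXn rmorphM -Ea.
  by rewrite mulrA [_ * (_ ^+ n * s1)]mulrA -exprS exprMn -exprM exprD; ring.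
Qed.

End Basic.
End Affine.

Lemma affine_nbhd (X : scheme) (W : opens X) x : oset W x ->
  exists U : opens X, [/\ affine U, oset U x & osub U W].
Proof.
move=> Wx; have [U Ux aU] := sch_affine x.
have [s [sx sW]] := affine_basis aU Ux Wx.
by exists (basic_open s); split=> //; exact: affine_basic.
Qed.

(** * Morphisms into an affine open set *)

Section AffineMor.
Variables (X T : scheme) (U : opens X) (aU : affine U).
Variable h : {rmorphism sec U -> sec (otop T)}.

Let top (t : T) : oset (otop T) t := I.

(** Points of [U] are the primes of [sec U]; the one wanted is the preimage under [h] of the
    sections that are not units at [t]. *)
Lemma aff_pt_spec (t : T) : exists x, oset U x /\
  forall s : sec U, unit_at s x <-> unit_at (h s) t.
Proof.
have hP : prime_ideal [set s : sec U | ~ unit_at (h s) t].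
  have H (s : sec U) : ([set s | ~ unit_at (h s) t] : set (sec U)) s <->
      ~ invertible (germ (top t) (h s)) by rewrite /= germ_unit.
  split.
  - split=> [|s s'|c s]; rewrite !H.
    + by rewrite !rmorph0 => -[a]; rewrite mul0r => /esym/stalk_neq0.
    + by move=> hs ht; rewrite !rmorphD => /stalk_localD [].
    + by move=> hs; rewrite !rmorphM mulrC => /invertibleMl.
  - by rewrite H !rmorph1; apply; exists 1; rewrite mulr1.
  - move=> s s'; rewrite !H !rmorphM => Hst; apply: contrapT => /not_orP [/contrapT hs /contrapT ht].
    by apply: Hst; exact: invertibleM.
have [_ H _ _ _] := aU; have [x Ux E] := H _ hP.
exists x; split=> // s.
have : ([set s : sec U | ~ unit_at (h s) t] : set _) s <-> ~ unit_at s x by rewrite E.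
by move=> /= K; split=> N; apply: contrapT => /K; apply.
Qed.

Definition aff_fun (t : T) : X := sval (cid (aff_pt_spec t)).
Lemma aff_in t : oset U (aff_fun t). Proof. exact: (svalP (cid (aff_pt_spec t))).1. Qed.
Lemma aff_unit t (s : sec U) : unit_at s (aff_fun t) <-> unit_at (h s) t.
Proof. exact: (svalP (cid (aff_pt_spec t))).2. Qed.

Lemma aff_cont : continuous aff_fun.
Proof.
apply/continuousP => A oA; rewrite openE => t At.
have [s [[_ sx] sA]] := affine_basis aU (W:=Opens oA) (aff_in t) At.
rewrite /interior nbhsE; exists [set y | oset (otop T) y /\ unit_at (h s) y].
  by split; [exact: basic_open_subproof|split=> //; apply/aff_unit].
by move=> y [_ /aff_unit sy]; apply: sA; split=> //; exact: aff_in.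
Qed.

Lemma aff_stalk_rep t (a : stalk (aff_fun t)) : exists y : stalk t,
  forall s b : sec U, unit_at s (aff_fun t) -> germ (aff_in t) s * a = germ (aff_in t) b ->
    germ (top t) (h s) * y = germ (top t) (h b).
Proof.
have [s [b [su E]]] := affine_stalk aU (aff_in t) a.
have /aff_unit/(germ_unit (top t)) [v sv] := su.
exists (v * germ (top t) (h b)) => s' b' su' E'.
have [|u uu Eu] := affine_germ0 aU (hx:=aff_in t) (a:=s * b' - s' * b).
  by rewrite rmorphB !rmorphM -E -E' /=; ring.
apply: (@unit_cancel _ (germ (top t) (h u) * germ (top t) (h s))).
  by apply: invertibleM; apply/germ_unit/aff_unit.
transitivity ((germ (top t) (h s) * v) * (germ (top t) (h (u * (s' * b))))).
  by rewrite !rmorphM; ring.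
have -> : u * (s' * b) = u * (s * b').
  by apply/esym/eqP; rewrite -subr_eq0 -mulrBr Eu.
by rewrite sv !rmorphM /=; ring.
Qed.

Definition aff_stalk t (a : stalk (aff_fun t)) : stalk t := sval (cid (aff_stalk_rep a)).

Lemma aff_stalkP t (a : stalk (aff_fun t)) (s b : sec U) : unit_at s (aff_fun t) ->
  germ (aff_in t) s * a = germ (aff_in t) b ->
  germ (top t) (h s) * aff_stalk a = germ (top t) (h b).
Proof. exact: (svalP (cid (aff_stalk_rep a))). Qed.

Lemma aff_stalk_germ t (s : sec U) : aff_stalk (germ (aff_in t) s) = germ (top t) (h s).
Proof.
have := @aff_stalkP t (germ (aff_in t) s) 1 s.
rewrite !rmorph1 !mul1r; apply=> //.
exact: unit_at1 (aff_in t).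
Qed.

Let aff_cancel t (s : sec U) (x y : stalk t) : unit_at s (aff_fun t) ->
  germ (top t) (h s) * x = germ (top t) (h s) * y -> x = y.
Proof. by move=> /aff_unit/(germ_unit (top t)); exact: unit_cancel. Qed.

Lemma aff_stalk_nmod t : nmod_morphism (@aff_stalk t).
Proof.
split=> [|a b].
  by have := aff_stalk_germ t 0; rewrite !rmorph0.
have [s [a' [su E]]] := affine_stalk aU (aff_in t) a.
have [r [b' [ru F]]] := affine_stalk aU (aff_in t) b.
have sru : unit_at (s * r) (aff_fun t) by apply/unit_at_mul; first exact: aff_in.
apply: (aff_cancel sru); rewrite (aff_stalkP (b:=r * a' + s * b') sru); last first.
  by rewrite rmorphD !rmorphM -E -F /=; ring.
have := aff_stalkP su E; have := aff_stalkP ru F.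
by rewrite !rmorphD !rmorphM /= => <- <-; ring.
Qed.
Lemma aff_stalk_monoid t : monoid_morphism (@aff_stalk t).
Proof.
split=> [|a b].
  by have := aff_stalk_germ t 1; rewrite !rmorph1.
have [s [a' [su E]]] := affine_stalk aU (aff_in t) a.
have [r [b' [ru F]]] := affine_stalk aU (aff_in t) b.
have sru : unit_at (s * r) (aff_fun t) by apply/unit_at_mul; first exact: aff_in.
apply: (aff_cancel sru); rewrite (aff_stalkP (b:=a' * b') sru); last first.
  by rewrite !rmorphM -E -F /=; ring.
have := aff_stalkP su E; have := aff_stalkP ru F.
by rewrite !rmorphM /= => <- <-; ring.
Qed.
HB.instance Definition _ t :=
  GRing.isNmodMorphism.Build _ _ (@aff_stalk t) (@aff_stalk_nmod t).
HB.instance Definition _ t :=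
  GRing.isMonoidMorphism.Build _ _ (@aff_stalk t) (@aff_stalk_monoid t).

Section Comorphism.
Variables (W : opens X) (O : opens T) (m : maps aff_fun O W).

Lemma aff_comor_ex (s : sec W) : exists r : sec O, forall t (ht : oset O t),
  germ ht r = aff_stalk (germ (m ht) s).
Proof.
apply: sec_of_germs => t ht.
have [a [ax aW]] := affine_basis aU (aff_in t) (m ht).
have [_ _ _ H _] := aU; have [n [b Eb]] := H a (res aW s).
have hu : unit_at (h a) t by apply/aff_unit; case: ax.
pose O' := oI O (basic_open (h a)).
have hO' : osub O' O := oIl.
have inv : invertible (res (osub_top O') (h a)).
  by apply: unit_glue => y [Oy [_ hy]]; apply/unit_at_res.
have [v av] := inv.
exists O', hO', (v ^+ n * res (osub_top O') (h b)); split; first by split.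
move=> y hy; have [Oy [_ hay]] := hy; have ay : unit_at a (aff_fun y) by apply/aff_unit.
have aDy : oset (basic_open a) (aff_fun y) by split=> //; exact: aff_in.
apply: (@unit_cancel _ (germ (top y) (h a) ^+ n)).
  by apply: invertibleX; apply/germ_unit.
rewrite rmorphM rmorphXn (germ_res _ (top y)) mulrA -exprMn.
rewrite -[X in (X * _) ^+ n](germ_res (osub_top O') (top y) hy) -rmorphM av rmorph1 expr1n mul1r.
have -> : germ (top y) (h a) ^+ n = germ (top y) (h (a ^+ n)) by rewrite !rmorphXn.
apply: aff_stalkP; first by apply/(germ_unit (aff_in y)); rewrite rmorphXn; apply/invertibleX/germ_unit.
rewrite -(germ_res (@basic_open_sub X U a) (aff_in y) aDy b) -Eb rmorphM /=.
by rewrite (germ_res aW (m (hO' y hy))) !rmorphXn /= (germ_res _ (aff_in y)).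
Qed.

Definition aff_comor_fun (s : sec W) : sec O := sval (cid (aff_comor_ex s)).
Lemma aff_comor_germ s t (ht : oset O t) (hm : oset W (aff_fun t)) :
  germ ht (aff_comor_fun s) = aff_stalk (germ hm s).
Proof.
rewrite (svalP (cid (aff_comor_ex s)) t ht); congr (aff_stalk (germ _ s)).
exact: Prop_irrelevance.
Qed.
Lemma aff_comor_nmod : nmod_morphism aff_comor_fun.
Proof.
split=> [|a b]; apply: germ_ext => t ht; rewrite ?rmorphD /= !(aff_comor_germ _ _ (m ht)).
  by rewrite !rmorph0.
by rewrite !rmorphD.
Qed.
Lemma aff_comor_monoid : monoid_morphism aff_comor_fun.
Proof.
split=> [|a b]; apply: germ_ext => t ht; rewrite ?rmorphM /= !(aff_comor_germ _ _ (m ht)).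
  by rewrite !rmorph1.
by rewrite !rmorphM.
Qed.
HB.instance Definition _ := GRing.isNmodMorphism.Build _ _ aff_comor_fun aff_comor_nmod.
HB.instance Definition _ :=
  GRing.isMonoidMorphism.Build _ _ aff_comor_fun aff_comor_monoid.
Definition aff_comor : {rmorphism sec W -> sec O} := aff_comor_fun.
End Comorphism.

Lemma aff_resl (W W' : opens X) (O : opens T) (k : osub W W') (m : maps aff_fun O W)
  (m' : maps aff_fun O W') s : aff_comor m (res k s) = aff_comor m' s.
Proof.
apply: germ_ext => t ht.
by rewrite !(aff_comor_germ _ _ _ (m _ ht)) !(aff_comor_germ _ _ _ (m' _ ht)) (germ_res _ (m' _ ht)).
Qed.
Lemma aff_resr (W : opens X) (O O' : opens T) (k : osub O' O) (m : maps aff_fun O W)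
  (m' : maps aff_fun O' W) s : res k (aff_comor m s) = aff_comor m' s.
Proof.
apply: germ_ext => t ht; rewrite (germ_res _ (k _ ht)).
by rewrite !(aff_comor_germ _ _ _ (m' _ ht)).
Qed.
Lemma aff_local W O (m : maps aff_fun O W) s t :
  oset O t -> unit_at (aff_comor m s) t -> unit_at s (aff_fun t).
Proof.
move=> ht /(germ_unit ht); rewrite (aff_comor_germ _ _ _ (m _ ht)).
have [a [b [au E]]] := affine_stalk aU (aff_in t) (germ (m t ht) s).
have := aff_stalkP au E => E' su; apply/(germ_unit (m _ ht)).
have /(germ_unit (aff_in t)) : unit_at b (aff_fun t).
  apply/aff_unit/(germ_unit (top t)); rewrite -E'; apply: invertibleM => //.
  by apply/germ_unit/aff_unit.
by rewrite -E mulrC => /invertibleMl.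
Qed.

Definition aff_mor : mor T X := Mor aff_cont aff_resl aff_resr aff_local.

Lemma aff_maps (O : opens T) : maps aff_mor O U.
Proof. by move=> t _; exact: aff_in. Qed.

Lemma aff_morE (m : maps aff_mor (otop T) U) s : comor m s = h s.
Proof.
apply: germ_ext => t ht.
rewrite (aff_comor_germ _ _ _ (aff_in t)) aff_stalk_germ.
by congr (germ _ _); exact: Prop_irrelevance.
Qed.

End AffineMor.

(** A point of [U] is determined by the sections that are units at it, and a germ there is a
    fraction of sections over [U]; both are fixed by the comorphism on [sec U]. *)
Lemma aff_uniq (X T : scheme) (U : opens X) (F G : mor T X) (mF : maps F (otop T) U)
    (mG : maps G (otop T) U) : affine U -> (forall s, comor mF s = comor mG s) -> F =m G.
Proof.
move=> aU E; have top (t : T) : oset (otop T) t := I.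
have FG t : F t = G t.
  have [A1 _ _ _ _] := aU; apply: A1 => [||s]; [exact: (mF _ (top t))|exact: (mG _ (top t))|].
  split=> [/(unit_at_morph mF (top t))|/(unit_at_morph mG (top t))].
    by rewrite E => /(mor_local (top t)).
  by rewrite -E => /(mor_local (top t)).
split=> // W O m m' s; apply: germ_ext => t ht.
have hU : oset U (F t) by exact: (mF _ (top t)).
have [a [b [au Eb]]] := affine_stalk aU hU (germ (m t ht) s).
have EF := congr1 (stalk_map (erefl (F t))) Eb.
have EG := congr1 (stalk_map (esym (FG t))) Eb.
move: EF EG; rewrite !rmorphM /= !(stalk_mapE _ hU _ (top t) mF) !(stalk_mapE _ hU _ (top t) mG).
rewrite (stalk_mapE _ _ _ ht m) (stalk_mapE _ _ _ ht m') -!E => <-.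
move=> H; apply/esym; apply: unit_cancel H; apply/germ_unit.
exact: unit_at_morph.
Qed.

(** * Stalks of fibre products *)

Section MorEq.
Lemma mor_sym X Y (f g : mor X Y) : f =m g -> g =m f.
Proof. by move=> [E1 E2]; split=> // U W m m' s; rewrite (E2 _ _ m' m). Qed.
Lemma mor_trans X Y (f g h : mor X Y) : f =m g -> g =m h -> f =m h.
Proof.
move=> [E1 E2] [F1 F2]; split=> [x|U W m m' s]; first by rewrite E1.
have mg : maps g W U by move=> x /m; rewrite E1.
by rewrite (E2 _ _ m mg) (F2 _ _ mg m').
Qed.

Lemma comor_irr X Y (f : mor X Y) U W (m m' : maps f W U) s : comor m s = comor m' s.
Proof. by congr (comor _ s); exact: Prop_irrelevance. Qed.

Lemma comor_comp X Y Z (g : mor Y Z) (f : mor X Y) U U' W (m : maps (g ∘m f) W U)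
  (m1 : maps f W U') (m2 : maps g U' U) s : comor m s = comor m1 (comor m2 s).
Proof.
have h : osub U' (pre g U) by move=> y /m2.
by rewrite -(comor_resr h (pre_maps g U) m2) (comor_resl h m1 (m : maps f W (pre g U))).
Qed.

Lemma cmor_congl X Y Z (g g' : mor Y Z) (f : mor X Y) : g =m g' -> g ∘m f =m g' ∘m f.
Proof.
move=> [E1 E2]; split=> [x|U W m m' s]; first exact: E1.
have k : maps f W (pre g U) by [].
have m2 : maps g' (pre g U) U by move=> y; rewrite /= E1.
by rewrite (comor_comp m k (pre_maps g U)) (comor_comp m' k m2) (E2 _ _ _ m2).
Qed.
Lemma cmor_congr X Y Z (g : mor Y Z) (f f' : mor X Y) : f =m f' -> g ∘m f =m g ∘m f'.
Proof.
move=> [E1 E2]; split=> [x|U W m m' s]; first by rewrite /= /comp_fun E1.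
rewrite (comor_comp m (m : maps f W (pre g U)) (pre_maps g U)).
rewrite (comor_comp m' (m' : maps f' W (pre g U)) (pre_maps g U)).
exact: (E2 (pre g U) W m m').
Qed.
Lemma cmorA X Y Z T (h : mor Z T) (g : mor Y Z) (f : mor X Y) :
  h ∘m (g ∘m f) =m (h ∘m g) ∘m f.
Proof.
split=> // U W m m' s.
rewrite (comor_comp m (m : maps (g ∘m f) W (pre h U)) (pre_maps h U)).
rewrite (comor_comp _ (m : maps f W (pre g (pre h U))) (pre_maps g (pre h U))).
rewrite (comor_comp m' (m : maps f W (pre g (pre h U))) (pre_maps g (pre h U) : maps (h ∘m g) _ U)).
by rewrite (comor_comp _ (pre_maps g (pre h U)) (pre_maps h U)).
Qed.
Lemma cmor_idl X Y (f : mor X Y) : idm Y ∘m f =m f.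
Proof.
split=> // U W m m' s.
have k : maps (idm Y) U U by [].
by rewrite (comor_comp m m' k) /= /id_comor res_id.
Qed.
Lemma cmor_idr X Y (f : mor X Y) : f ∘m idm X =m f.
Proof.
split=> // U W m m' s.
have k : maps (idm X) W W by [].
by rewrite (comor_comp m k m') /= /id_comor res_id.
Qed.
End MorEq.

Section Tens.
Variables (A B R : comPzRingType) (P : {rmorphism A -> R}) (Q : {rmorphism B -> R}).
(** The image in [R] of the tensor product of [A] and [B] over the integers. *)
Definition tens : set R := [set x | exists l : seq (A * B), x = \sum_(i <- l) P i.1 * Q i.2].

Lemma tens1 a b : tens (P a * Q b).
Proof. by exists [:: (a, b)]; rewrite big_seq1. Qed.
Lemma tens0 : tens 0. Proof. by exists [::]; rewrite big_nil. Qed.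
Lemma tensD x y : tens x -> tens y -> tens (x + y).
Proof. by move=> [l ->] [l' ->]; exists (l ++ l'); rewrite big_cat. Qed.
Lemma tens_ind (K : R -> Prop) : K 0 -> (forall x y, K x -> K y -> K (x + y)) ->
  (forall a b, K (P a * Q b)) -> forall x, tens x -> K x.
Proof.
move=> K0 KD K1 _ [l ->]; apply: (big_ind K) => // i _; exact: K1.
Qed.
Lemma tensM x y : tens x -> tens y -> tens (x * y).
Proof.
move=> tx ty; elim/tens_ind: tx => [|x1 x2 H1 H2|a b].
- by rewrite mul0r; exact: tens0.
- by rewrite mulrDl; exact: tensD.
elim/tens_ind: ty => [|y1 y2 H1 H2|c d].
- by rewrite mulr0; exact: tens0.
- by rewrite mulrDr; exact: tensD.
by rewrite mulrACA -!rmorphM; exact: tens1.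
Qed.
Lemma tens_sub : subring_spec tens.
Proof.
split; [|move=> x|exact: tensD|exact: tensM].
  by rewrite -(mulr1 1) -{1}(rmorph1 P) -(rmorph1 Q); exact: tens1.
move=> tx; rewrite -mulN1r; apply: tensM => //.
by rewrite -(mulr1 (-1)) -(rmorphN1 P) -(rmorph1 Q); exact: tens1.
Qed.
Lemma tens_l a : tens (P a). Proof. by rewrite -(mulr1 (P a)) -(rmorph1 Q); exact: tens1. Qed.
Lemma tens_r b : tens (Q b). Proof. by rewrite -(mul1r (Q b)) -(rmorph1 P); exact: tens1. Qed.
Lemma tensX x n : tens x -> tens (x ^+ n).
Proof.
move=> tx; elim: n => [|n IH]; last by rewrite exprS; exact: tensM.
by rewrite expr0; exact: (sub1 tens_sub).
Qed.
End Tens.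

Lemma tens_morph (A B A' B' R S : comPzRingType) (P : {rmorphism A -> R})
    (Q : {rmorphism B -> R}) (P' : {rmorphism A' -> S}) (Q' : {rmorphism B' -> S})
    (h : {rmorphism R -> S}) x :
  (forall a, exists a', h (P a) = P' a') -> (forall b, exists b', h (Q b) = Q' b') ->
  tens P Q x -> tens P' Q' (h x).
Proof.
move=> HP HQ; elim/tens_ind => [|y y' H H'|a b].
- by rewrite rmorph0; exact: tens0.
- by rewrite rmorphD; exact: tensD.
by rewrite rmorphM; have [a' ->] := HP a; have [b' ->] := HQ b; exact: tens1.
Qed.

Section SubLift.
Variables (A R : comPzRingType) (P : set R) (H : subring_spec P) (h : {rmorphism A -> R}).
Lemma sub_lift : (forall a, P (h a)) -> exists k : {rmorphism A -> subring_of H},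
  forall a, sub_val (k a) = h a.
Proof.
move=> hP; pose k a : subring_of H := exist _ _ (hP a).
have k_nmod : nmod_morphism k.
  by split=> [|x y]; apply: sub_inj; rewrite /= ?rmorph0 ?rmorphD.
have k_monoid : monoid_morphism k.
  by split=> [|x y]; apply: sub_inj; rewrite /= ?rmorph1 ?rmorphM.
have [kk kkE] := rmorphism_of k_nmod k_monoid; exists kk => a.
by rewrite kkE.
Qed.
End SubLift.

Lemma rmorph_inv (R S : comPzRingType) (h : {rmorphism R -> S}) :
  injective h -> (forall s, exists r, s = h r) ->
  exists k : {rmorphism S -> R}, cancel k h /\ cancel h k.
Proof.
move=> inj surj; pose k s := sval (cid (surj s)).
have kK s : h (k s) = s by rewrite -(svalP (cid (surj s))).
have k_nmod : nmod_morphism k.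
  by split=> [|x y]; apply: inj; rewrite ?rmorphD ?kK ?rmorph0.
have k_monoid : monoid_morphism k.
  by split=> [|x y]; apply: inj; rewrite ?rmorphM ?kK ?rmorph1.
have [kk kkE] := rmorphism_of k_nmod k_monoid.
by exists kk; split=> x; [rewrite kkE | apply: inj; rewrite kkE kK].
Qed.

Lemma rmorph_comp_ex (A B C : comPzRingType) (g : {rmorphism B -> C}) (f : {rmorphism A -> B}) :
  exists h : {rmorphism A -> C}, forall a, h a = g (f a).
Proof. by exists (g \o f)%FUN. Qed.

Lemma Spec_point (R : comPzRingType) (P : set R) : prime_ideal P ->
  exists t : Spec R, forall r, unit_at (Spec_in R r) t <-> ~ P r.
Proof.
move=> hP; have [k [kK Kk]] := rmorph_inv (@Spec_inj R) (@Spec_surj R).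
have hQ : prime_ideal [set s | P (k s)].
  case: hP => hid P1 PM; split.
  + split=> [|x y|c x] /=; first by rewrite rmorph0; exact: ideal0.
      by rewrite rmorphD; exact: idealD.
    by rewrite rmorphM; exact: idealM.
  + by rewrite /= rmorph1.
  + by move=> x y /=; rewrite rmorphM; exact: PM.
have [_ H _ _ _] := Spec_affine R; have [t _ E] := H _ hQ.
exists t => r; have : [set s | P (k s)] (Spec_in R r) <-> ~ unit_at (Spec_in R r) t by rewrite E.
by rewrite /= Kk => K; split=> [u /K|nP]; [apply|apply: contrapT => /K].
Qed.

Section Fiber.
Variables (X Y V : scheme) (f : mor X V) (g : mor Y V) (Z : fiber_product f g).
Variables (U : opens X) (C : opens Y) (V0 : opens V).
Hypotheses (aU : affine U) (aC : affine C) (aV : affine V0).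
Variables (mU : maps f U V0) (mC : maps g C V0).
Variables (z : Z) (x : X) (y : Y) (ex : fp1 Z z = x) (ey : fp2 Z z = y).
Variables (hx : oset U x) (hy : oset C y).

(** The subring of [sec Z0] generated by the two factors has a spectrum that maps
    to the fibre product [Z]; by uniqueness of maps to [Z], an element of the stalk
    is a quotient of elements of this subring. *)
Lemma fib_frac (P : {rmorphism sec U -> stalk z}) (Q : {rmorphism sec C -> stalk z})
    (PE : forall a, P a = stalk_map ex (germ hx a))
    (QE : forall b, Q b = stalk_map ey (germ hy b)) (s : stalk z) :
  exists b a, [/\ invertible b, tens P Q b, tens P Q a & b * s = a].
Proof.
have hz : oset (oI (pre (fp1 Z) U) (pre (fp2 Z) C)) z by split=> /=; rewrite ?ex ?ey.
have [Z0 [aZ z0 ZZ]] := affine_nbhd hz.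
have m1 : maps (fp1 Z) Z0 U by move=> w /ZZ [].
have m2 : maps (fp2 Z) Z0 C by move=> w /ZZ [].
set R0 := sec Z0; pose p0 : {rmorphism sec U -> R0} := comor m1.
pose q0 : {rmorphism sec C -> R0} := comor m2.
pose H := tens_sub p0 q0; pose R' : comPzRingType := subring_of H.
pose inc : {rmorphism R' -> R0} := (@sub_val _ _ H).
have [p' p'E] := sub_lift H (tens_l p0 q0).
have [q' q'E] := sub_lift H (tens_r p0 q0).
have [hX hXE] := rmorph_comp_ex (Spec_in R') p'.
have [hY hYE] := rmorph_comp_ex (Spec_in R') q'.
pose tX := aff_mor aU hX; pose tY := aff_mor aC hY.
have comm : f ∘m tX =m g ∘m tY.
  have kX : maps tX (otop (Spec R')) U by exact: aff_maps.
  have kY : maps tY (otop (Spec R')) C by exact: aff_maps.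
  have k1 : maps (f ∘m tX) (otop (Spec R')) V0 by move=> w _; exact: mU (kX w I).
  have k2 : maps (g ∘m tY) (otop (Spec R')) V0 by move=> w _; exact: mC (kY w I).
  apply: (aff_uniq (mF:=k1) (mG:=k2) aV) => r.
  rewrite (comor_comp k1 kX mU) (comor_comp k2 kY mC) !aff_morE hXE hYE.
  congr (Spec_in R' _); apply: sub_inj.
  rewrite -[LHS]/(sub_val (p' _)) -[RHS]/(sub_val (q' _)) p'E q'E /p0 /q0.
  have k3 : maps (f ∘m fp1 Z) Z0 V0 by move=> w /m1/mU.
  have k4 : maps (g ∘m fp2 Z) Z0 V0 by move=> w /m2/mC.
  by rewrite -(comor_comp k3 m1 mU) -(comor_comp k4 m2 mC) (fp_comm Z).2.
pose tau := fp_lift Z comm.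
pose io := aff_mor aZ (Spec_in R0).
have [k [kK Kk]] := rmorph_inv (@Spec_inj R') (@Spec_surj R').
have [hr' hr'E] := rmorph_comp_ex inc k.
have [hr hrE] := rmorph_comp_ex (Spec_in R0) hr'.
pose rho := aff_mor (Spec_affine R') hr.
have mio : maps io (otop (Spec R0)) Z0 by exact: aff_maps.
have mrho : maps rho (otop (Spec R0)) (otop (Spec R')) by [].
have rhoE r : comor mrho (Spec_in R' r) = Spec_in R0 (inc r).
  by rewrite aff_morE hrE hr'E Kk.
(* Here [rho] comes from the inclusion of [R'] in [R0], and [io] plays the role of the inclusion of
   [Z0] in [Z]. The two morphisms have the same projections to [X] and to [Y]. *)
have E : tau ∘m rho =m io.
  apply: (@fp_uniq _ _ _ _ _ Z).
    apply: mor_trans (cmorA _ _ _) _.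
    apply: mor_trans (cmor_congl rho (fp_lift1 Z comm)) _.
    have kX : maps tX (otop (Spec R')) U by exact: aff_maps.
    have k1 : maps (tX ∘m rho) (otop (Spec R0)) U by move=> w _; exact: kX.
    have k2 : maps (fp1 Z ∘m io) (otop (Spec R0)) U by move=> w _; exact: m1 (mio w I).
    apply: (aff_uniq (mF:=k1) (mG:=k2) aU) => r.
    have tE r' : comor kX r' = Spec_in R' (p' r') by rewrite aff_morE hXE.
    have iE r' : comor mio r' = Spec_in R0 r' by rewrite aff_morE.
    by rewrite (comor_comp k1 mrho kX) (comor_comp k2 mio m1) tE rhoE iE -p'E.
  apply: mor_trans (cmorA _ _ _) _.
  apply: mor_trans (cmor_congl rho (fp_lift2 Z comm)) _.
  have kY : maps tY (otop (Spec R')) C by exact: aff_maps.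
  have k1 : maps (tY ∘m rho) (otop (Spec R0)) C by move=> w _; exact: kY.
  have k2 : maps (fp2 Z ∘m io) (otop (Spec R0)) C by move=> w _; exact: m2 (mio w I).
  apply: (aff_uniq (mF:=k1) (mG:=k2) aC) => r.
  have tE r' : comor kY r' = Spec_in R' (q' r') by rewrite aff_morE hYE.
  have iE r' : comor mio r' = Spec_in R0 r' by rewrite aff_morE.
  by rewrite (comor_comp k1 mrho kY) (comor_comp k2 mio m2) tE rhoE iE -q'E.
have [t0 Ht0] := Spec_point (affine_prime z0).
have {}Ht0 r : unit_at (Spec_in R0 r) t0 <-> unit_at r z.
  rewrite Ht0 /=; split=> [H0|u N]; last exact: N.
  by apply: contrapT.
have iz : io t0 = z.
  have [A1 _ _ _ _] := aZ; apply: A1 => // [|r]; first exact: mio.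
  by rewrite aff_unit Ht0.
have tz : tau (rho t0) = z by rewrite -iz -E.1.
have itop : oset (otop (Spec R0)) t0 by [].
have ioE r : stalk_map iz (germ z0 r) = germ itop (Spec_in R0 r).
  by rewrite (stalk_mapE iz z0 r itop mio) aff_morE.
have topr : oset (otop (Spec R')) (rho t0) by [].
(* On [Spec R'] the pullback of [s] is a fraction of elements of [R'], that is, of the subring
   generated by the two factors. *)
have [b [a [bu Eba]]] := affine_stalk (Spec_affine R') topr (stalk_map tz s).
have [b' Eb] := Spec_surj b; have [a' Ea] := Spec_surj a; subst a b.
have rho_germ r : stalk_map (erefl (rho t0)) (germ topr (Spec_in R' r)) = germ itop (Spec_in R0 (inc r)).
  by rewrite (stalk_mapE _ topr _ itop mrho) rhoE.
have bu' : unit_at (inc b') z.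
  by apply/Ht0; rewrite -rhoE; exact: unit_at_morph.
have germ_tens r : tens p0 q0 r -> tens P Q (germ z0 r).
  apply: tens_morph => c; exists c; rewrite ?PE ?QE.
    by rewrite (stalk_mapE ex _ _ z0 m1).
  by rewrite (stalk_mapE ey _ _ z0 m2).
exists (germ z0 (inc b')), (germ z0 (inc a')); split.
- exact/germ_unit.
- exact/germ_tens/(svalP b').
- exact/germ_tens/(svalP a').
(* The relation is known in the stalk of [Spec R0] at [t0]. Clearing denominators turns it into a
   relation in [R0], where [Spec_in] is injective. *)
apply/eqP; rewrite -subr_eq0; apply/eqP; set w := (X in X = 0).
have iw : stalk_map iz w = 0.
  rewrite /w rmorphB rmorphM !ioE -!rho_germ.
  have eq : (tau ∘m rho) t0 = z by [].
  rewrite -(stalk_map_eq eq iz _ E) (stalk_map_comp (erefl (rho t0)) tz eq).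
  by rewrite -rmorphM Eba subrr.
have [c [d [cu Ecd]]] := affine_stalk aZ z0 w.
have : germ itop (Spec_in R0 d) = 0 by rewrite -ioE -Ecd rmorphM iw mulr0.
move=> /(affine_germ0 (Spec_affine R0)) [e' eu]; have [e Ee] := Spec_surj e'.
move: eu; rewrite {}Ee => eu /eqP; rewrite -rmorphM -(rmorph0 (Spec_in R0)) => /eqP/Spec_inj Eed.
apply: (@unit_cancel _ (germ z0 e * germ z0 c)).
  by apply: invertibleM; apply/germ_unit => //; apply/Ht0.
by rewrite mulr0 -mulrA Ecd -rmorphM Eed rmorph0.
Qed.

Variables (p : nat) (p_pr : prime p).

(** No denominators are needed if one factor is radicial over the other: a
    denominator [b] can be replaced by [b ^ (p ^ r)], which comes from [x]. *)
Lemma fib_gen (Q : {rmorphism sec C -> stalk z}) :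
  (forall b, Q b = stalk_map ey (germ hy b)) -> (p%:R : stalk z) = 0 ->
  (forall c, exists r b, Q c ^+ (p ^ r) = stalk_map ex b) ->
  forall s, tens (stalk_map ex) Q s.
Proof.
move=> QE charp rad s.
have [P PE] := rmorph_comp_ex (stalk_map ex) (germ hx).
have [b [a [bu tb ta Ebs]]] := fib_frac PE QE s.
have tPQ w : tens P Q w -> tens (stalk_map ex) Q w.
  elim/tens_ind => [|w1 w2|a' c]; [exact: tens0|exact: tensD|].
  by rewrite PE; exact: tens1.
have [r [c Ec]] : exists r c, b ^+ (p ^ r) = stalk_map ex c.
  elim/tens_ind: tb {bu} => [|w1 w2 [r1 [c1 E1]] [r2 [c2 E2]]|a' c].
  - by exists 0%N, 0; rewrite rmorph0 expn0 expr1.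
  - exists (r1 + r2)%N, (c1 ^+ (p ^ r2) + c2 ^+ (p ^ r1)).
    rewrite (frob_add p_pr) // rmorphD !rmorphXn -E1 -E2 -!exprM -!expnD.
    by rewrite [(r2 + r1)%N]addnC.
  - have [r [d Ed]] := rad c; exists r, (germ hx a' ^+ (p ^ r) * d).
    by rewrite exprMn Ed rmorphM rmorphXn PE.
have q_gt0 : (0 < p ^ r)%N by rewrite expn_gt0 prime_gt0.
have [d cd] : invertible c.
  by apply: (@stalk_map_local _ _ _ _ _ ex); rewrite -Ec; exact: invertibleX.
have -> : s = stalk_map ex d * (b ^+ (p ^ r).-1 * a).
  apply: (@unit_cancel _ (b ^+ (p ^ r))); first exact: invertibleX.
  rewrite mulrA {2}Ec -rmorphM cd rmorph1 mul1r -Ebs mulrA -exprSr.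
  by rewrite prednK.
by apply: tensM; [exact: tens_l|apply: tPQ; apply: tensM => //; exact: tensX].
Qed.

End Fiber.

(** * Generators of modules *)

Section SubOmod.
Variables (X : ringedSpace) (M : Omod X) (K : forall U : opens X, set (M U)).

Record submodule_spec : Prop := SubmoduleSpec {
  sm0 : forall U, K (0 : M U);
  smD : forall U (s t : M U), K s -> K t -> K (s + t);
  smZ : forall U (a : sec U) (s : M U), K s -> K (a *: s);
  sm_res : forall U W (h : osub W U) (s : M U), K s -> K (mres h s);
  sm_local : forall U (s : M U), locally_on (fun W (h : osub W U) => K (mres h s)) -> K s }.

Variable H : submodule_spec.

Definition submod_sec (_ : submodule_spec) (U : opens X) := {s : M U | K s}.

Section At.
Variable U : opens X.
Local Notation T := (submod_sec H U).
Lemma submod_inj (x y : T) : sval x = sval y -> x = y.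
Proof. by case: x y => x Hx [y Hy] /= E; apply: eq_exist. Qed.
HB.instance Definition _ := gen_eqMixin T.
HB.instance Definition _ := gen_choiceMixin T.
Definition submod_add (x y : T) : T := exist _ _ (smD H (svalP x) (svalP y)).
Definition submod_scale (a : sec U) (x : T) : T := exist _ _ (smZ H a (svalP x)).
Definition submod_opp (x : T) : T := submod_scale (-1) x.
Definition submod_zero : T := exist _ _ (sm0 H U).
Lemma submod_addA : associative submod_add.
Proof. by move=> x y z; apply/submod_inj/addrA. Qed.
Lemma submod_addC : commutative submod_add.
Proof. by move=> x y; apply/submod_inj/addrC. Qed.
Lemma submod_add0 : left_id submod_zero submod_add.
Proof. by move=> x; apply/submod_inj/add0r. Qed.
Lemma submod_addN : left_inverse submod_zero submod_opp submod_add.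
Proof. by move=> x; apply/submod_inj; rewrite /= scaleN1r addNr. Qed.
HB.instance Definition _ :=
  GRing.isZmodule.Build T submod_addA submod_addC submod_add0 submod_addN.
Lemma submod_scaleA a b v : submod_scale a (submod_scale b v) = submod_scale (a * b) v.
Proof. by apply/submod_inj/scalerA. Qed.
Lemma submod_scale1 : left_id 1 submod_scale.
Proof. by move=> v; apply/submod_inj/scale1r. Qed.
Lemma submod_scaleDr : right_distributive submod_scale +%R.
Proof. by move=> a x y; apply/submod_inj/scalerDr. Qed.
Lemma submod_scaleDl v : {morph submod_scale^~ v : a b / a + b}.
Proof. by move=> a b; apply/submod_inj/scalerDl. Qed.
HB.instance Definition _ := GRing.Zmodule_isLmodule.Build (sec U) T
  submod_scaleA submod_scale1 submod_scaleDr submod_scaleDl.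
End At.

Definition submod_res U W (h : osub W U) (x : submod_sec H U) : submod_sec H W :=
  exist _ _ (sm_res H h (svalP x)).

Lemma submod_glue U (I : Type) (D : I -> opens X)
      (hD : forall i, osub (D i) U) (s : forall i, submod_sec H (D i)) :
    (forall x, oset U x -> exists i, oset (D i) x) ->
    (forall i j W (hi : osub W (D i)) (hj : osub W (D j)),
       submod_res hi (s i) = submod_res hj (s j)) ->
    exists t, forall i, submod_res (hD i) t = s i.
Proof.
move=> cov comp.
have [|i j W hi hj|t Ht] := @msec_glue _ M U I D hD (fun i => sval (s i)) => //.
  exact: (congr1 sval (comp i j W hi hj)).
have Kt : K t.
  apply: (sm_local H) => x /cov [i Dx]; exists (D i), (hD i); split=> //.
  by rewrite Ht; exact: (svalP (s i)).
by exists (exist _ t Kt) => i; apply: submod_inj; exact: Ht.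
Qed.

Definition sub_omod : Omod X.
Proof.
refine (@OMod X (fun U => submod_sec H U : lmodType (sec U)) submod_res _ _ _ _ _ _).
- by move=> U h s; apply/submod_inj/mres_id.
- by move=> U W T h1 h2 h3 s; apply/submod_inj/mres_comp.
- by move=> U W h s t; apply/submod_inj/mresD.
- by move=> U W h a s; apply/submod_inj/mresZ.
- move=> U s t E; apply/submod_inj; apply: msec_eq => x Ux.
  have [W [h [Wx F]]] := E x Ux; exists W, h; split=> //.
  exact: (congr1 sval F).
- exact: submod_glue.
Defined.

Definition sub_omod_in : mhom sub_omod M.
Proof.
by refine (@MHom X sub_omod M (fun U (s : submod_sec H U) => sval s) _ _ _).
Defined.

End SubOmod.

Section MRes.
Variables (X : ringedSpace) (M : Omod X).
Lemma mresE (U W T : opens X) (h1 : osub W U) (h2 : osub T W) (s : M U) :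
  mres h2 (mres h1 s) = mres (osub_trans h2 h1) s.
Proof. exact: mres_comp. Qed.
Lemma mres_irr (U W : opens X) (h h' : osub W U) (s : M U) : mres h s = mres h' s.
Proof. by congr (mres _ s); exact: Prop_irrelevance. Qed.
Lemma mres0 (U W : opens X) (h : osub W U) : mres h (0 : M U) = 0.
Proof. by rewrite -(scale0r 0) mresZ rmorph0 scale0r. Qed.
End MRes.

Section Generated.
Variables (X : ringedSpace) (M : Omod X) (G : forall U : opens X, set (M U)).
Hypothesis G_res : forall U W (h : osub W U) (s : M U), G s -> G (mres h s).

Inductive gspan (U : opens X) : M U -> Prop :=
| gspan0 : gspan (0 : M U)
| gspanD s t : gspan s -> gspan t -> gspan (s + t)
| gspanG a s : G s -> gspan (a *: s).

Lemma gspanZ U (a : sec U) s : gspan s -> gspan (a *: s).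
Proof.
elim=> [|x y _ Hx _ Hy|b x Gx]; first by rewrite scaler0; exact: gspan0.
  by rewrite scalerDr; exact: gspanD.
by rewrite scalerA; exact: gspanG.
Qed.
Lemma gspan_res U W (h : osub W U) s : gspan s -> gspan (mres h s).
Proof.
elim=> [|x y _ Hx _ Hy|b x Gx]; first by rewrite mres0; exact: gspan0.
  by rewrite mresD; exact: gspanD.
by rewrite mresZ; apply: gspanG; exact: G_res.
Qed.

(** Membership is asked for locally because the spans themselves form only a presheaf. *)
Definition lspan_sec (U : opens X) : set (M U) :=
  [set s | locally_on (fun W (h : osub W U) => gspan (mres h s))].

Lemma lspan_spec : submodule_spec lspan_sec.
Proof.
split.
- move=> U x Ux; exists U, (@osub_refl _ _); split=> //; rewrite mres0; exact: gspan0.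
- move=> U s t Hs Ht x Ux; have [W [h [Wx Gs]]] := Hs x Ux.
  have [T [k [Tx Gt]]] := Ht x Ux; exists (oI W T), (osub_trans oIl h); split=> //.
  rewrite mresD; apply: gspanD; first by rewrite -mresE; exact: gspan_res.
  by rewrite (mres_irr _ (osub_trans oIr k)) -mresE; exact: gspan_res.
- move=> U a s Hs x Ux; have [W [h [Wx Gs]]] := Hs x Ux.
  by exists W, h; split=> //; rewrite mresZ; exact: gspanZ.
- move=> U W h s Hs x Wx; have [T [k [Tx Gs]]] := Hs x (h x Wx).
  exists (oI W T), oIl; split=> //.
  by rewrite mresE (mres_irr _ (osub_trans oIr k)) -mresE; exact: gspan_res.
- move=> U s Hs x Ux; have [W [h [Wx Gs]]] := Hs x Ux.
  have [T [k [Tx Gt]]] := Gs x Wx; exists T, (osub_trans k h); split=> //.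
  by rewrite -mresE.
Qed.

Lemma generated_omod : exists (N : Omod X) (i : mhom N M),
  [/\ forall U, injective (i U), forall U (s : M U), G s -> exists t, i U t = s &
      forall U t, lspan_sec (i U t)].
Proof.
exists (sub_omod lspan_spec), (sub_omod_in lspan_spec); split.
- by move=> U s t; exact: submod_inj.
- move=> U s Gs.
  have Ks : lspan_sec s.
    move=> x Ux; exists U, (@osub_refl _ _); split=> //; rewrite mres_id -(scale1r s).
    exact: gspanG.
  by exists (exist _ s Ks).
- by move=> U t; exact: (svalP t).
Qed.

End Generated.

(** The submodule generated by the pure sections satisfies the universal property
    too, so that it is everything; the same for tensor products. *)
Lemma pullback_generated (Q S : scheme) (t : mor Q S) (M : Omod S)
    (N : module_pullback t M) (W : opens Q) (y : N W) :
  lspan_sec (fun W (y : N W) => exists U (m : maps t W U) (x : M U), y = mp_map N U W m x) y.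
Proof.
set G := fun _ _ => _.
have G_res U W' (h : osub W' U) (s : N U) : G U s -> G W' (mres h s).
  move=> [U0 [m [x ->]]]; have m' : maps t W' U0 by move=> z /h/m.
  by exists U0, m', x; rewrite (ah_resr _ _ _ m').
have [N0 [i [inj surj span]]] := generated_omod G_res.
have ch U W' (m : maps t W' U) (x : M U) : {y0 : N0 W' | i W' y0 = mp_map N U W' m x}.
  by apply/cid/surj; exists U, m, x.
have [semi univ] := mp_univ N.
have @u : addhom t M N0.
  refine (@AddHom _ _ t M N0 (fun U W' m x => sval (ch U W' m x)) _ _ _).
  - by move=> U W' m x x'; apply: (@inj _); rewrite mhD !(svalP (ch _ _ _ _)) ahD.
  - move=> U U' W' h m m' x; apply: (@inj _); rewrite !(svalP (ch _ _ _ _)); exact: ah_resl.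
  - by move=> U W1 W' h m m' x; apply: (@inj _); rewrite mh_res !(svalP (ch _ _ _ _)) (ah_resr _ _ _ m').
have semi_u : Defs.semilinear u.
  by move=> U W' m a x; apply: (@inj _); rewrite mhZ !(svalP (ch _ _ _ _)) semi.
have [[h hE] _] := univ N0 u semi_u.
have [_ uniq] := univ N (mp_map N) semi.
have @ih : mhom N N.
  refine (@MHom _ N N (fun W s => i W (h W s)) _ _ _).
  - by move=> *; rewrite !mhD.
  - by move=> *; rewrite !mhZ.
  - by move=> *; rewrite !mh_res.
pose idN : mhom N N := @MHom _ N N (fun W s => s) (fun _ _ _ => erefl)
  (fun _ _ _ => erefl) (fun _ _ _ _ => erefl).
have <- : ih W y = y.
  apply: (uniq ih idN) => U W' m x; rewrite /= hE; exact: (svalP (ch _ _ _ _)).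
exact: span.
Qed.

Lemma tensor_generated (X : ringedSpace) (M N P : Omod X) (b : bilin M N P)
    (U : opens X) (y : P U) : is_sheaf_tensor b ->
  lspan_sec (fun U (y : P U) => exists s t, y = b U s t) y.
Proof.
move=> tens; set G := fun _ _ => _.
have G_res U' W' (h : osub W' U') (s : P U') : G U' s -> G W' (mres h s).
  by move=> [x [x' ->]]; exists (mres h x), (mres h x'); rewrite bl_res.
have [N0 [i [inj surj span]]] := generated_omod G_res.
have ch U' (s : M U') (t : N U') : {y0 : N0 U' | i U' y0 = b U' s t}.
  by apply/cid/surj; exists s, t.
have @b' : bilin M N N0.
  refine (@Bilin _ M N N0 (fun U s t => sval (ch U s t)) _ _ _ _ _).
  - by move=> *; apply: (@inj _); rewrite mhD !(svalP (ch _ _ _)) blDl.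
  - by move=> *; apply: (@inj _); rewrite mhD !(svalP (ch _ _ _)) blDr.
  - by move=> *; apply: (@inj _); rewrite mhZ !(svalP (ch _ _ _)) blZl.
  - by move=> *; apply: (@inj _); rewrite mhZ !(svalP (ch _ _ _)) blZr.
  - by move=> *; apply: (@inj _); rewrite mh_res !(svalP (ch _ _ _)) bl_res.
have [[h hE] _] := tens N0 b'; have [_ uniq] := tens P b.
have @ih : mhom P P.
  refine (@MHom _ P P (fun W s => i W (h W s)) _ _ _).
  - by move=> *; rewrite !mhD.
  - by move=> *; rewrite !mhZ.
  - by move=> *; rewrite !mh_res.
pose idN : mhom P P := @MHom _ P P (fun W s => s) (fun _ _ _ => erefl)
  (fun _ _ _ => erefl) (fun _ _ _ _ => erefl).
have <- : ih U y = y.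
  by apply: (uniq ih idN) => U' s t; rewrite /= hE; exact: (svalP (ch _ _ _)).
exact: span.
Qed.

Section TensorPowers.
Variables (X : ringedSpace) (L : Omod X) (P : tensor_powers L).

Fixpoint gen_pow U (l : L U) k : P k U :=
  if k is k'.+1 then tp_bil P k' U l (gen_pow l k') else tp_one P U 1.

Lemma gen_pow_res U W (h : osub W U) (l : L U) k :
  mres h (gen_pow l k) = gen_pow (mres h l) k.
Proof.
elim: k => [|k IH] /=; first by rewrite -mh_res /= rmorph1.
by rewrite -bl_res IH.
Qed.

Lemma tp_mul_gen U (l : L U) j k a : tp_mul l j (a *: gen_pow l k) = a *: gen_pow l (j + k).
Proof. by elim: j => [//|j IH] /=; rewrite IH blZr. Qed.

End TensorPowers.

Section Generates.
Variable X : ringedSpace.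

(** Generation is kept apart from freeness: it passes to tensor powers and to pullbacks by their
    universal properties, and it is what the computation of images rests on. *)
Definition generates (M : Omod X) (D : opens X) (l : M D) :=
  forall U (hU : osub U D) (y : M U), locally_on (fun W (h : osub W U) =>
    exists a : sec W, mres h y = a *: mres (osub_trans h hU) l).

Lemma generates_span (M : Omod X) (G : forall U : opens X, set (M U)) (D : opens X)
    (l : M D) :
  (forall U (y : M U), lspan_sec G y) ->
  (forall U (hU : osub U D) (y : M U), G U y -> locally_on (fun W (h : osub W U) =>
    exists a : sec W, mres h y = a *: mres (osub_trans h hU) l)) ->
  generates l.
Proof.
move=> span H U hU y x Ux; have [W0 [h0 [W0x sp]]] := span U y x Ux.
suff [W [h [Wx [a E]]]] : exists W (h : osub W W0), oset W x /\
    exists a : sec W, mres h (mres h0 y) = a *: mres (osub_trans h (osub_trans h0 hU)) l.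
  exists W, (osub_trans h h0); split=> //; exists a.
  by rewrite -mresE E; congr (_ *: _) => //; exact: mres_irr.
move: (osub_trans h0 hU) => hW0; elim: sp => [|s t _ Hs _ Ht|b s Gs].
- exists W0, (@osub_refl _ _); split=> //; exists 0; rewrite scale0r; exact: mres0.
- have [W [h [Wx [a E]]]] := Hs; have [T [k [Tx [c F]]]] := Ht.
  exists (oI W T), (osub_trans oIl h); split=> //; exists (res oIl a + res oIr c).
  rewrite mresD scalerDl -(mresE h oIl s) E mresZ mresE; congr (_ *: _ + _).
  rewrite (mres_irr _ (osub_trans oIr k) t) -mresE F mresZ mresE; congr (_ *: _);
  exact: mres_irr.
- have [W [h [Wx [a E]]]] := H _ hW0 s Gs x W0x.
  exists W, h; split=> //; exists (res h b * a).
  by rewrite mresZ E scalerA.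
Qed.

Lemma generates_line (M : Omod X) (D : opens X) (l : M D) :
  (forall U (h : osub U D), bijective (fun a : sec U => a *: mres h l)) -> generates l.
Proof.
move=> H U hU y x Ux; exists U, (@osub_refl _ _); split=> //.
have [g _ Kg] := H U hU; exists (g y).
by rewrite mres_id -{1}(Kg y); congr (_ *: _) => //; exact: mres_irr.
Qed.

Lemma generates_pow (L : Omod X) (P : tensor_powers L) (D : opens X) (l : L D) k :
  generates l -> generates (gen_pow P l k).
Proof.
move=> H; elim: k => [|k IH].
  move=> U hU y x Ux; exists U, (@osub_refl _ _); split=> //.
  have [g Kg gK] := tp_one_bij P U; exists (g y).
  rewrite mres_id -{1}(gK y) gen_pow_res /= -mhZ; congr (tp_one P U _).
  by rewrite /GRing.scale /= mulr1.
apply: (generates_span (G:=fun U (y : P k.+1 U) => exists s t, y = tp_bil P k U s t)).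
  by move=> U y; exact: (tensor_generated _ (@tp_univ _ _ P k)).
move=> U hU _ [s [t ->]] x Ux.
have [W [h [Wx [a E]]]] := H U hU s x Ux.
have [T [g [Tx [c F]]]] := IH U hU t x Ux.
have hW : osub (oI W T) U := osub_trans oIl h.
exists (oI W T), hW; split=> //; exists (res oIl a * res oIr c).
rewrite -bl_res (mres_irr hW (osub_trans (@oIl _ W T) h) s) -(mresE h oIl s) E mresZ mresE.
rewrite (mres_irr hW (osub_trans (@oIr _ W T) g) t) -(mresE g oIr t) F mresZ mresE blZl blZr scalerA.
congr (_ *: _); rewrite gen_pow_res -bl_res -gen_pow_res.
by congr (tp_bil P k _ _ _); exact: mres_irr.
Qed.

End Generates.

Lemma generates_pullback (Q S : scheme) (t : mor Q S) (M : Omod S) (N : module_pullback t M)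
    (D : opens S) (l : M D) (D' : opens Q) (m : maps t D' D) :
  generates l -> generates (mp_map N D D' m l).
Proof.
move=> H; apply: (generates_span (G:=fun W (y : N W) =>
    exists U (m : maps t W U) (x : M U), y = mp_map N U W m x)).
  by move=> U y; exact: pullback_generated.
move=> U hU _ [U0 [m0 [x ->]]] z Uz.
have hz : oset (oI U0 D) (t z) by split; [exact: m0|exact/m/hU].
have [W [h [Wz [a E]]]] := H (oI U0 D) oIr (mres oIl x) (t z) hz.
have hT : osub (oI U (pre t W)) U := oIl.
have mT : maps t (oI U (pre t W)) W by move=> w [].
have mT0 : maps t (oI U (pre t W)) U0 by move=> w [/m0].
have mTD : maps t (oI U (pre t W)) D by move=> w [/hU/m].
exists (oI U (pre t W)), hT; split; first by split.
exists (comor mT a).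
rewrite (ah_resr _ _ _ mT0) -(ah_resl _ (osub_trans h oIl) mT) -mresE E.
rewrite (mp_univ N).1; congr (_ *: _).
by rewrite (ah_resl _ _ _ mTD) (ah_resr _ _ _ mTD).
Qed.

(** * Stalks of additive maps in a local coordinate *)

Section StalkHom.
Variables (Q S : scheme) (t : mor Q S) (M : Omod S) (u : addhom t M (Oreg Q)).
Variables (D : opens S) (l : M D) (q : Q) (s : S) (e : t q = s) (Ds : oset D s).

Lemma sh_rep (a : stalk s) : exists b : stalk q, forall U (hU : osub U D) (Us : oset U s)
    (c : sec U) W (Wq : oset W q) (m : maps t W U), a = germ Us c ->
  b = germ Wq (u U W m (c *: mres hU l) : sec W).
Proof.
have [U [hU [Us [c ->]]]] := germ_in Ds a.
have Pq : oset (pre t U) q by rewrite /= e.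
exists (germ Pq (u U (pre t U) (pre_maps t U) (c *: mres hU l) : sec _)).
move=> U' hU' Us' c' W Wq m /germ_eq [T [h [h' [Ts E]]]]; apply/germ_eq.
pose W' := oI W (pre t T).
have mT : maps t W' T by move=> w [].
have mU : maps t W' U by move=> w /mT/h.
have mU' : maps t W' U' by move=> w /mT/h'.
have k : osub W' (pre t U) by move=> w /mT/h.
exists W', k, oIl; split; first by split=> //=; rewrite e.
rewrite -[LHS]/(mres (o:=Oreg Q) k _) -[RHS]/(mres (o:=Oreg Q) oIl _).
rewrite (ah_resr _ _ _ mU) (ah_resr _ _ _ mU').
rewrite -(ah_resl _ h mT) -(ah_resl _ h' mT) !mresZ E !mresE.
by congr (u T W' mT (_ *: _)); exact: mres_irr.
Qed.

Lemma sh_exists : exists h : {additive stalk s -> stalk q},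
  forall U (hU : osub U D) (Us : oset U s) (c : sec U) W (Wq : oset W q) (m : maps t W U),
  h (germ Us c) = germ Wq (u U W m (c *: mres hU l) : sec W).
Proof.
pose h a := sval (cid (sh_rep a)).
have hE U (hU : osub U D) (Us : oset U s) (c : sec U) W (Wq : oset W q) (m : maps t W U) :
    h (germ Us c) = germ Wq (u U W m (c *: mres hU l) : sec W).
  exact: (svalP (cid (sh_rep (germ Us c)))).
have h_nmod : nmod_morphism h.
  have hD a b : h (a + b) = h a + h b.
    have [U [Us [c [d [-> ->]]]]] := germ_pair a b.
    pose U' := oI U D; have Us' : oset U' s by split.
    rewrite -!(germ_res (@oIl _ U D) Us Us') -rmorphD.
    have Pq : oset (pre t U') q by rewrite /= e.
    rewrite !(hE _ oIr Us' _ _ Pq (pre_maps t U')) -[RHS]rmorphD; congr (germ Pq _).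
    by rewrite scalerDl ahD.
  split=> //; apply: (@addrI _ (h 0)); by rewrite -hD !addr0.
pose h1 := GRing.isNmodMorphism.Build _ _ h h_nmod.
pose hh : {additive stalk s -> stalk q} := HB.pack h h1.
by exists hh.
Qed.

(** The stalk of [u] at [q] in the coordinate [c |-> c l] on [M]. If [l] generates [M], the image of
    [sh] is the stalk of the image sheaf ([image_sheaf_at]), so that image sheaves are studied
    through additive maps between stalks of structure sheaves. *)
Definition sh : {additive stalk s -> stalk q} := sval (cid sh_exists).
Lemma shE U (hU : osub U D) (Us : oset U s) (c : sec U) W (Wq : oset W q) (m : maps t W U) :
  sh (germ Us c) = germ Wq (u U W m (c *: mres hU l) : sec W).
Proof. exact: (svalP (cid sh_exists)). Qed.

End StalkHom.

Lemma image_sheaf_at (Q S : scheme) (t : mor Q S) (M : Omod S) (u : addhom t M (Oreg Q))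
    (D : opens S) (l : M D) (q : Q) (s : S) (e : t q = s) (Ds : oset D s)
    (W : opens Q) (Wq : oset W q) (a : sec W) : generates l ->
  (exists W' (h : osub W' W), oset W' q /\
     exists U (m : maps t W' U) (x : M U), u U W' m x = mres (o:=Oreg Q) h a) <->
  (exists b : stalk s, germ Wq a = sh u l e Ds b).
Proof.
move=> gen; split=> [[W' [h [Wq' [U [m [x E]]]]]]|[b]].
  pose U' := oI U D.
  have Us' : oset U' s by split=> //; rewrite -e; exact: (m q Wq').
  have [T [k [Ts [b F]]]] := gen U' oIr (mres oIl x) s Us'.
  exists (germ Ts b).
  have hq : oset (oI W' (pre t T)) q by split=> //=; rewrite e.
  have mT : maps t (oI W' (pre t T)) T by move=> w [].
  have mU : maps t (oI W' (pre t T)) U by move=> w [/m].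
  rewrite (shE u l e Ds (osub_trans k oIr) Ts b hq mT) -F mresE (ah_resl _ _ _ mU).
  rewrite -(germ_res (osub_trans oIl h) Wq hq); congr (germ hq _).
  rewrite -(ah_resr u (@oIl _ W' (pre t T)) m mU) E.
  by rewrite -[RHS]/(res oIl (res h a)) resE.
have [U [hU [Us [b0 ->]]]] := germ_in Ds b.
have Pq : oset (pre t U) q by rewrite /= e.
rewrite (shE u l e Ds hU Us b0 Pq (pre_maps t U)) => /germ_eq [T [h [h' [Tq E]]]].
have m : maps t T U by move=> w /h'.
exists T, h; split=> //; exists U, m, (b0 *: mres hU l).
by rewrite -(ah_resr u h' (pre_maps t U) m); exact/esym.
Qed.

(** * Frobenius base changes *)

Lemma frob_stalk p (p_pr : prime p) (X : scheme) (hX : has_char p X) n x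
    (e : frob p_pr hX n x = x) (a : stalk x) : stalk_map e a = a ^+ (p ^ n).
Proof.
have [U [hU [s ->]]] := germ_surj a.
have m : maps (frob p_pr hX n) U U by [].
by rewrite (stalk_mapE e hU s hU m) /= /frob_fun rmorphXn res_id.
Qed.

Lemma stalk_char p (X : scheme) (hX : has_char p X) (x : X) : (p%:R : stalk x) = 0.
Proof.
by rewrite -(rmorph_nat (@germ X x (otop X) I)) [p%:R](hX) rmorph0.
Qed.

Section BaseChangeStalk.
Variables (p : nat) (p_pr : prime p) (X V V' : scheme) (f : mor X V) (g : mor V' V).
Variables (hV : has_char p V) (e : nat).
Variables (Xe : fiber_product f (frob p_pr hV e)) (P0 : fiber_product f g).
Variables (g1 : mor V' V) (P1 : fiber_product f g1) (u : mor P1 Xe) (j : mor P1 P0).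
Variables (L : Omod X) (phi : addhom (fp1 Xe) L (Oreg Xe)).
Variables (L' : module_pullback (fp1 P0) L) (phi' : addhom j L' (Oreg P1)).
Hypothesis bc : is_base_change u phi phi'.
Variables (D : opens X) (l : L D) (x : X) (Dx : oset D x) (v : V').
Variables (z0 : P0) (z1 : P1) (ze : Xe).
Variables (e01 : fp1 P0 z0 = x) (e02 : fp2 P0 z0 = v) (e12 : fp2 P1 z1 = v).
Variables (ej : j z1 = z0) (eu : u z1 = ze) (ee : fp1 Xe ze = x).
Variables (D0 : oset (pre (fp1 P0) D) z0).

Definition pullback_gen : L' (pre (fp1 P0) D) := mp_map L' D (pre (fp1 P0) D) (pre_maps _ _) l.

Lemma base_change_stalk (b : stalk x) (c : stalk v) :
  sh phi' pullback_gen ej D0 (stalk_map e01 b * stalk_map e02 c) =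
  stalk_map eu (sh phi l ee Dx b) * stalk_map e12 c.
Proof.
have [U [hU [Ux [b0 ->]]]] := germ_in Dx b.
have [C [Cv [c0 ->]]] := germ_surj c.
pose T := oI (pre (fp1 P0) U) (pre (fp2 P0) C).
have Tj : oset T z0 by split=> /=; rewrite ?e01 ?e02.
have mT : maps (fp1 P0) T U by move=> w [].
have mC : maps (fp2 P0) T C by move=> w [].
pose S := pre (fp1 Xe) U; have Se : oset S ze by rewrite /= ee.
pose W := oI (oI (pre j T) (pre u S)) (pre (fp2 P1) C).
have Wk : oset W z1 by split; [split|]; rewrite /= ?ej ?eu ?e12.
have mj : maps j W T by move=> w [[]].
have mu : maps u W S by move=> w [[]].
have mW : maps (fp2 P1) W C by move=> w [].
rewrite (stalk_mapE e01 Ux b0 Tj mT) (stalk_mapE e02 Cv c0 Tj mC) -rmorphM.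
have hT : osub T (pre (fp1 P0) D) by move=> w [/hU].
rewrite (shE phi' pullback_gen ej D0 hT Tj _ Wk mj).
rewrite (shE phi l ee Dx hU Ux b0 Se (pre_maps _ _)).
rewrite (stalk_mapE eu Se _ Wk mu) (stalk_mapE e12 Cv c0 Wk mW) -rmorphM.
congr (germ Wk _); rewrite mulrC -scalerA.
have -> : comor mT b0 *: mres hT pullback_gen = mp_map L' U T mT (b0 *: mres hU l).
  rewrite (mp_univ L').1; congr (_ *: _).
  have mTD : maps (fp1 P0) T D by exact: hT.
  by rewrite (ah_resl _ _ _ mTD) (ah_resr _ _ _ mTD).
exact: bc.
Qed.

End BaseChangeStalk.

Section Relative.
Variables (p : nat) (p_pr : prime p) (X V : scheme) (f : mor X V) (hV : has_char p V).
Variable XF : frob_base_changes p_pr f hV.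
Let hX : has_char p X := has_char_dom f hV.

Lemma rel_frob1 N : fp1 (XF N) ∘m rel_frob XF N =m frob p_pr hX N.
Proof. exact: fp_lift1. Qed.
Lemma rel_frob2 N : fp2 (XF N) ∘m rel_frob XF N =m f.
Proof. exact: fp_lift2. Qed.

(** It is enough to compare projections. After [fp1] the relative Frobenius is the Frobenius of [X],
    which commutes with [fp1]; after [fp2] it is [f], and the fibre square turns [f] after [fp1]
    into the Frobenius of [V] after [fp2]. *)
Lemma rel_frob_fp1 N :
  rel_frob XF N ∘m fp1 (XF N) =m frob p_pr (has_char_dom (fp1 (XF N)) hX) N.
Proof.
apply: (@fp_uniq _ _ _ _ _ (XF N)).
  apply: mor_trans (cmorA _ _ _) _.
  apply: mor_trans (cmor_congl _ (rel_frob1 N)) _.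
  by apply: mor_sym; exact: frob_comm.
apply: mor_trans (cmorA _ _ _) _.
apply: mor_trans (cmor_congl _ (rel_frob2 N)) _.
apply: mor_trans (fp_comm (XF N)) _.
by apply: mor_sym; exact: frob_comm.
Qed.

(** In particular, [fp1 : X_{V^N} -> X] is a bijection on points, and the stalk
    of [X_{V^N}] over [x] is taken at [rel_frob XF N x]. *)
Lemma rel_frobK N (z : XF N) : rel_frob XF N (fp1 (XF N) z) = z.
Proof. exact: (rel_frob_fp1 N).1. Qed.
Lemma fp1K N (x : X) : fp1 (XF N) (rel_frob XF N x) = x.
Proof. exact: (rel_frob1 N).1. Qed.

Section Point.
Variables (x : X) (v : V) (fx : f x = v).

Section AtN.
Variables (N : nat) (z : XF N) (e1 : fp1 (XF N) z = x).

Lemma fp2_pt : fp2 (XF N) z = v.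
Proof. by rewrite -fx -e1; exact/esym/((fp_comm (XF N)).1 z). Qed.

Lemma rel_frob_pt : rel_frob XF N x = z. Proof. by rewrite -e1 rel_frobK. Qed.

Variable e2 : fp2 (XF N) z = v.

Lemma fp1_base (c : stalk v) : stalk_map e1 (stalk_map fx c) = stalk_map e2 c ^+ (p ^ N).
Proof.
have E : (f ∘m fp1 (XF N)) z = v by rewrite /= /comp_fun e1.
rewrite -(stalk_map_comp e1 fx E).
have E' : (frob p_pr hV N ∘m fp2 (XF N)) z = v by rewrite /= /comp_fun e2.
rewrite (stalk_map_eq E E' _ (fp_comm (XF N))).
have F : frob p_pr hV N v = v by [].
by rewrite (stalk_map_comp e2 F E') frob_stalk rmorphXn.
Qed.

Lemma rel_frob_stalk1 (E : rel_frob XF N x = z) (a : stalk x) :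
  stalk_map E (stalk_map e1 a) = a ^+ (p ^ N).
Proof.
have E' : (fp1 (XF N) ∘m rel_frob XF N) x = x by rewrite /= /comp_fun E.
rewrite -(stalk_map_comp E e1 E').
have F : frob p_pr hX N x = x by [].
by rewrite (stalk_map_eq E' F _ (rel_frob1 N)) frob_stalk.
Qed.

Lemma rel_frob_stalk2 (E : rel_frob XF N x = z) (c : stalk v) :
  stalk_map E (stalk_map e2 c) = stalk_map fx c.
Proof.
have E' : (fp2 (XF N) ∘m rel_frob XF N) x = v by rewrite /= /comp_fun E.
by rewrite -(stalk_map_comp E e2 E') (stalk_map_eq E' fx _ (rel_frob2 N)).
Qed.

(** The factor [V^N] is radicial: the [p ^ N]-th power of a function on it comes from [X]
    ([fp1_base]), so [fib_gen] applies. Coefficients in the sections over one affine [V0], instead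
    of the stalk at [v], are what allows a presentation to be spread out. *)
Lemma XF_gen_affine (V0 : opens V) (hv : oset V0 v) (Q : {rmorphism sec V0 -> stalk z}) :
  affine V0 -> (forall c, Q c = stalk_map e2 (germ hv c)) ->
  forall s : stalk z, tens (stalk_map e1) Q s.
Proof.
move=> aV QE.
have Px : oset (pre f V0) x by rewrite /= fx.
have [U [aU Ux UV]] := affine_nbhd Px.
have mU : maps f U V0 by exact: UV.
have mC : maps (frob p_pr hV N) V0 V0 by [].
apply: (fib_gen aU aV aV mU mC Ux p_pr QE).
  exact: (stalk_char (has_char_dom (fp1 (XF N)) hX)).
move=> c; exists N, (stalk_map fx (germ hv c)).
by rewrite QE fp1_base.
Qed.

Lemma XF_gen (s : stalk z) : tens (stalk_map e1) (stalk_map e2) s.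
Proof.
have [V0 hv aV] := sch_affine v.
have [Q QE] := rmorph_comp_ex (stalk_map e2) (germ hv).
have := XF_gen_affine aV QE s; apply: (tens_morph (h:=idfun)) => a.
  by exists a.
by exists (germ hv a); rewrite /= QE.
Qed.

End AtN.

Variables (tr : forall i k, mor (XF k) (XF i)) (tr_spec : frob_transitions tr).

Lemma tr_fp1 i k j (z : XF k) : k = (i + j)%N -> fp1 (XF i) (tr i k z) = fp1 (XF k) z.
Proof. by move=> E; have [H _] := tr_spec E; exact: H.1. Qed.

Section AtIJ.
Variables (i j k : nat) (kE : k = (i + j)%N) (zi : XF i) (zk : XF k).
Variables (ei1 : fp1 (XF i) zi = x) (ei2 : fp2 (XF i) zi = v).
Variables (ek1 : fp1 (XF k) zk = x) (ek2 : fp2 (XF k) zk = v).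

Lemma tr_pt : tr i k zk = zi.
Proof. by rewrite -(rel_frobK (tr i k zk)) (tr_fp1 _ kE) ek1 -ei1 rel_frobK. Qed.

Variable et : tr i k zk = zi.

Lemma tr_stalk1 (a : stalk x) : stalk_map et (stalk_map ei1 a) = stalk_map ek1 a.
Proof.
have E : (fp1 (XF i) ∘m tr i k) zk = x by rewrite /= /comp_fun et.
by rewrite -(stalk_map_comp et ei1 E); apply: stalk_map_eq; case: (tr_spec kE).
Qed.

Lemma tr_stalk2 (c : stalk v) : stalk_map et (stalk_map ei2 c) = stalk_map ek2 (c ^+ (p ^ j)).
Proof.
have E : (fp2 (XF i) ∘m tr i k) zk = v by rewrite /= /comp_fun et.
have E' : (frob p_pr hV j ∘m fp2 (XF k)) zk = v by rewrite /= /comp_fun ek2.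
have F : frob p_pr hV j v = v by [].
rewrite -(stalk_map_comp et ei2 E) (stalk_map_eq E E' _ (tr_spec kE).2).
by rewrite (stalk_map_comp ek2 F E') frob_stalk.
Qed.

End AtIJ.

Section AtIJK.
Variables (i j k j' k' : nat) (kE : k = (i + j)%N) (kE' : k' = (k + j')%N).
Variables (zi : XF i) (zk : XF k) (zk' : XF k').
Variables (ei : fp1 (XF i) zi = x) (ek : fp1 (XF k) zk = x) (ek' : fp1 (XF k') zk' = x).
Variables (e1 : tr i k zk = zi) (e2 : tr k k' zk' = zk) (e3 : tr i k' zk' = zi).

(** The transitions are specified only by their projections, and no functoriality is assumed; on
    stalks it follows because the two factors generate. *)
Lemma tr_stalk_comp (s : stalk zi) : stalk_map e2 (stalk_map e1 s) = stalk_map e3 s.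
Proof.
have kE3 : k' = (i + (j + j'))%N by rewrite addnA -kE.
have := XF_gen ei (fp2_pt ei) s; elim/tens_ind => [|s1 s2 H1 H2|a c].
- by rewrite !rmorph0.
- by rewrite !rmorphD H1 H2.
rewrite !rmorphM (tr_stalk1 kE ei ek) (tr_stalk1 kE' ek ek') (tr_stalk1 kE3 ei ek').
rewrite (tr_stalk2 kE (fp2_pt ei) (fp2_pt ek)) (tr_stalk2 kE' (fp2_pt ek) (fp2_pt ek')).
by rewrite (tr_stalk2 kE3 (fp2_pt ei) (fp2_pt ek')) -exprM -expnD.
Qed.
End AtIJK.

Lemma tr_stalk_id i (z : XF i) (ez : fp1 (XF i) z = x) (et : tr i i z = z) (s : stalk z) :
  stalk_map et s = s.
Proof.
have kE : i = (i + 0)%N by rewrite addn0.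
have := XF_gen ez (fp2_pt ez) s; elim/tens_ind => [|s1 s2 H1 H2|a c].
- by rewrite !rmorph0.
- by rewrite !rmorphD H1 H2.
rewrite rmorphM (tr_stalk1 kE ez ez) (tr_stalk2 kE (fp2_pt ez) (fp2_pt ez)).
by rewrite expn0 expr1.
Qed.

Section Phi.
Variables (e : nat) (L : Omod X) (D : opens X) (l : L D) (Dx : oset D x).
Variables (phi : addhom (fp1 (XF e)) L (Oreg (XF e))) (phi_lin : relative_linear phi).

Lemma phi_rel_linear (z : XF e) (ez : fp1 (XF e) z = x) (E : rel_frob XF e x = z)
    (s : stalk z) (b : stalk x) :
  sh phi l ez Dx (stalk_map E s * b) = s * sh phi l ez Dx b.
Proof.
have [T [hT [s0 ->]]] := germ_surj s.
have [U [hU [Ux [b0 ->]]]] := germ_in Dx b.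
pose U' := oI U (pre (rel_frob XF e) T).
have hU' : osub U' U := oIl.
have Ux' : oset U' x by split=> //=; rewrite E.
have mT : maps (rel_frob XF e) U' T by move=> w [].
pose T' := oI T (pre (fp1 (XF e)) U').
have hz : oset T' z by split=> //=; rewrite ez.
have m : maps (fp1 (XF e)) T' U' by move=> w [].
rewrite (stalk_mapE E hT s0 Ux' mT) -(germ_res hU' Ux Ux' b0) -rmorphM.
rewrite !(shE phi l ez Dx (osub_trans hU' hU) Ux' _ hz m) -scalerA.
rewrite (phi_lin _ mT _ (@oIl _ T _) m) rmorphM (germ_res _ hT) //.
Qed.

Lemma phi_linear1 (z : XF e) (ez : fp1 (XF e) z = x) (a b : stalk x) :
  sh phi l ez Dx (a ^+ (p ^ e) * b) = stalk_map ez a * sh phi l ez Dx b.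
Proof.
by rewrite -(phi_rel_linear ez (rel_frob_pt ez)) rel_frob_stalk1.
Qed.
Lemma phi_linear2 (z : XF e) (ez : fp1 (XF e) z = x) (ez2 : fp2 (XF e) z = v)
    (c : stalk v) (b : stalk x) :
  sh phi l ez Dx (stalk_map fx c * b) = stalk_map ez2 c * sh phi l ez Dx b.
Proof.
by rewrite -(phi_rel_linear ez (rel_frob_pt ez)) rel_frob_stalk2.
Qed.

Variables (LF : forall i, module_pullback (fp1 (XF i)) L).
Variable phib : forall j, addhom (tr j (e + j)%N) (LF j) (Oreg (XF (e + j)%N)).
Hypothesis phib_spec : frob_twists phi phib.

Section Twist.
Variables (j : nat) (zj : XF j) (zk : XF (e + j)%N) (ze : XF e).
Variables (ej : fp1 (XF j) zj = x) (Dj : oset (pre (fp1 (XF j)) D) zj).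
Variables (et : tr j (e + j)%N zk = zj) (ete : tr e (e + j)%N zk = ze).
Variables (ee : fp1 (XF e) ze = x).

Definition twist := sh (phib j) (pullback_gen (LF j) l) et Dj.

Lemma twistE (ej2 : fp2 (XF j) zj = v) (ek2 : fp2 (XF (e + j)%N) zk = v) (b : stalk x) (c : stalk v) :
  twist (stalk_map ej b * stalk_map ej2 c) =
  stalk_map ete (sh phi l ee Dx b) * stalk_map ek2 c.
Proof. exact: (base_change_stalk (@phib_spec j) l Dx ej ej2 ek2 et ete ee Dj). Qed.

End Twist.
End Phi.
End Point.
End Relative.

(** * The iterates of the trace on stalks *)

Section Iterate.
Variables (p : nat) (p_pr : prime p) (X V : scheme) (f : mor X V) (hV : has_char p V).
Variables (e : nat) (XF : frob_base_changes p_pr f hV).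
Variables (L : Omod X) (Lp : tensor_powers L).
Variables (tr : forall i k, mor (XF k) (XF i)) (tr_spec : frob_transitions tr).
Variable LF : forall i, module_pullback (fp1 (XF i)) L.
Variables (phi : addhom (fp1 (XF e)) L (Oreg (XF e))) (phi_lin : relative_linear phi).
Variable phib : forall j, addhom (tr j (e + j)%N) (LF j) (Oreg (XF (e + j)%N)).
Hypothesis phib_spec : frob_twists phi phib.
Variable phin : forall n,
  addhom (fp1 (XF (n * e)%N)) (Lp (tw_exp p e n)) (Oreg (XF (n * e)%N)).
Hypothesis phin_spec : relative_iterates phi phib phin.

Variables (D : opens X) (l : L D) (x : X) (Dx : oset D x).

Let pt N : XF N := rel_frob XF N x.
Let e1 N : fp1 (XF N) (pt N) = x := fp1K XF N x.
Let e2 N : fp2 (XF N) (pt N) = f x := fp2_pt erefl (e1 N).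
(** With [R] and [A] the stalks at [x] and [f x], the stalk of [X_N] is to be thought of as [R]
    tensored over [A] with [A ^ (1 / p ^ N)]: [stalk_I] is [a |-> a (x) 1] and [stalk_K] is
    [c |-> 1 (x) c ^ (1 / p ^ N)]. This explains the exponents [p ^ (k - i)] in [TR_K] and [p ^ N]
    in [stalk_I_base]. *)
Definition stalk_I N : {rmorphism stalk x -> stalk (pt N)} := stalk_map (e1 N).
Definition stalk_K N : {rmorphism stalk (f x) -> stalk (pt N)} := stalk_map (e2 N).

Lemma tr_pt_le i k : (i <= k)%N -> tr i k (pt k) = pt i.
Proof. by move=> /subnKC/esym E; exact: (tr_pt tr_spec E (e1 i) (e1 k)). Qed.

Definition TR i k (h : (i <= k)%N) : {rmorphism stalk (pt i) -> stalk (pt k)} :=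
  stalk_map (tr_pt_le h).

Lemma TR_I i k (h : (i <= k)%N) a : TR h (stalk_I i a) = stalk_I k a.
Proof. exact: (tr_stalk1 tr_spec (esym (subnKC h))). Qed.
Lemma TR_K i k (h : (i <= k)%N) c : TR h (stalk_K i c) = stalk_K k (c ^+ (p ^ (k - i))).
Proof. exact: (tr_stalk2 tr_spec (esym (subnKC h))). Qed.
Lemma TR_comp i j k (h : (i <= j)%N) (h' : (j <= k)%N) (h'' : (i <= k)%N) s :
  TR h' (TR h s) = TR h'' s.
Proof.
exact: (tr_stalk_comp erefl tr_spec (esym (subnKC h)) (esym (subnKC h')) (e1 i) (e1 j) (e1 k)).
Qed.
Lemma TR_id i (h : (i <= i)%N) s : TR h s = s.
Proof. by apply: (tr_stalk_id erefl tr_spec (e1 i)). Qed.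
Lemma stalk_gen N s : tens (stalk_I N) (stalk_K N) s.
Proof. exact: (XF_gen erefl (e1 N)). Qed.
Lemma stalk_I_base N c : stalk_I N (stalk_map erefl c) = stalk_K N c ^+ (p ^ N).
Proof. exact: fp1_base. Qed.

Definition phi0 : {additive stalk x -> stalk (pt e)} := sh phi l (e1 e) Dx.
Definition Giter n : {additive stalk x -> stalk (pt (n * e)%N)} :=
  sh (phin n) (gen_pow Lp l (tw_exp p e n)) (e1 (n * e)%N) Dx.

Lemma leS n : (n * e <= n.+1 * e)%N. Proof. by rewrite leq_mul2r leqnSn orbT. Qed.
Lemma le1 n : (e <= n.+1 * e)%N. Proof. by rewrite mulSn leq_addr. Qed.

Lemma Dpt N : oset (pre (fp1 (XF N)) D) (pt N). Proof. by rewrite /= e1. Qed.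
(** [Tstep n] is the stalk of [phi (x) id], so that [phi^(n+1) = Tstep n o phi^n]. *)
Definition Tstep n : {additive stalk (pt (n * e)%N) -> stalk (pt (n.+1 * e)%N)} :=
  @twist p p_pr X V f hV XF tr e L D l LF phib (n * e)%N (pt (n * e)%N) (pt (n.+1 * e)%N)
     (Dpt (n * e)%N) (tr_pt_le (leS n)).

Lemma TstepE n b c : Tstep n (stalk_I _ b * stalk_K _ c) = TR (le1 n) (phi0 b) * stalk_K _ c.
Proof. by apply: twistE; exact: phib_spec. Qed.

(** For a variable [e] the index [1 * e] does not reduce to [e]; a transition map identifies the two
    base changes. *)
Lemma Giter1 b : Giter 1 b = TR (le1 0) (phi0 b).
Proof.
have [U [hU [Ux [b0 ->]]]] := germ_in Dx b.
have We : oset (pre (fp1 (XF e)) U) (pt e) by rewrite /= e1.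
have W1 : oset (pre (fp1 (XF (1 * e)%N)) U) (pt (1 * e)%N) by rewrite /= e1.
pose W := oI (pre (fp1 (XF (1 * e)%N)) U) (pre (tr e (1 * e)%N) (pre (fp1 (XF e)) U)).
have hW : oset W (pt (1 * e)%N) by split=> //=; rewrite (tr_pt_le (le1 0)) e1.
have m : maps (fp1 (XF (1 * e)%N)) W U by move=> w [].
have t : maps (tr e (1 * e)%N) W (pre (fp1 (XF e)) U) by move=> w [].
rewrite /phi0 (shE phi l (e1 e) Dx hU Ux b0 We (pre_maps _ _)) (stalk_mapE _ We _ hW t).
rewrite (shE _ _ _ Dx hU Ux b0 hW m); congr (germ hW _).
rewrite -(phin_spec.1 _ _ _ m); congr (phin 1 U W m _).
by rewrite gen_pow_res /= -blZl.
Qed.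

Lemma GiterS n b : (0 < n)%N -> Giter n.+1 b = Tstep n (Giter n b).
Proof.
move=> n_gt0; have [U [hU [Ux [b0 ->]]]] := germ_in Dx b.
pose T := pre (fp1 (XF (n * e)%N)) U.
have hT : oset T (pt (n * e)%N) by rewrite /= e1.
pose W := oI (pre (fp1 (XF (n.+1 * e)%N)) U) (pre (tr (n * e)%N (n.+1 * e)%N) T).
have hW : oset W (pt (n.+1 * e)%N) by split; rewrite /= ?(tr_pt_le (leS n)) e1.
have m : maps (fp1 (XF (n.+1 * e)%N)) W U by move=> w [].
have t : maps (tr (n * e)%N (n.+1 * e)%N) W T by move=> w [].
rewrite (shE _ _ _ Dx hU Ux b0 hT (pre_maps _ _)) (shE _ _ _ Dx hU Ux b0 hW m).
have kT : osub T (pre (fp1 (XF (n * e)%N)) D) by move=> w /hU.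
rewrite /Tstep /twist (shE (phib (n * e)%N) (pullback_gen (LF (n * e)%N) l) _ (Dpt (n * e)%N) kT hT _ hW t).
congr (germ hW _).
(* The exponent for [n.+1] unfolds to [p ^ (n * e) + tw_exp p e n], so that the generator is
   [l ^ (p ^ (n * e))] times the generator used for [n]. *)
rewrite !gen_pow_res [gen_pow _ _ (tw_exp p e n.+1)]/(gen_pow _ _ (p ^ (n * e) + tw_exp p e n)).
rewrite -tp_mul_gen (phin_spec.2 n n_gt0 _ _ _ _ (pre_maps _ _) _ _ t).
congr (phib _ _ _ _ (_ *: _)); rewrite /pullback_gen.
have mTD : maps (fp1 (XF (n * e)%N)) T D by exact: kT.
by rewrite (ah_resl _ _ _ mTD) (ah_resr _ _ _ mTD).
Qed.

Lemma Tstep_I n a s : Tstep n (stalk_I _ (a ^+ (p ^ e)) * s) = stalk_I _ a * Tstep n s.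
Proof.
have := stalk_gen s; elim/tens_ind => [|s1 s2 H1 H2|b c].
- by rewrite mulr0 raddf0 mulr0.
- by rewrite mulrDr !raddfD H1 H2 /= mulrDr.
rewrite mulrA -rmorphM !TstepE mulrA; congr (_ * _).
by rewrite /phi0 (phi_linear1 l Dx phi_lin (e1 e)) rmorphM TR_I.
Qed.
(** The source of [phi (x) id] is twisted by the [e]-th Frobenius, so [c ^ (1 / p ^ (n e))] comes
    out as its [p ^ e]-th root [c ^ (1 / p ^ ((n + 1) e))]; therefore the same [c] occurs on both
    sides. *)
Lemma Tstep_K n c s : Tstep n (stalk_K _ c * s) = stalk_K _ c * Tstep n s.
Proof.
have := stalk_gen s; elim/tens_ind => [|s1 s2 H1 H2|b d].
- by rewrite mulr0 raddf0 mulr0.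
- by rewrite mulrDr !raddfD H1 H2 /= mulrDr.
by rewrite mulrCA -rmorphM !TstepE rmorphM mulrCA.
Qed.

Lemma Giter_I n a b : (0 < n)%N -> Giter n (a ^+ (p ^ (n * e)) * b) = stalk_I _ a * Giter n b.
Proof.
elim: n a => // -[_ a _|n IH a _].
  have -> : a ^+ (p ^ (1 * e)) = a ^+ (p ^ e) by rewrite mul1n.
  by rewrite !Giter1 /phi0 (phi_linear1 l Dx phi_lin (e1 e)) rmorphM TR_I.
have -> : a ^+ (p ^ (n.+2 * e)) = (a ^+ (p ^ e)) ^+ (p ^ (n.+1 * e)).
  by rewrite -exprM -expnD.
by rewrite !(GiterS (n:=n.+1)) // IH // Tstep_I.
Qed.
Lemma Giter_K n c b : (0 < n)%N ->
  Giter n (stalk_map erefl c * b) = stalk_K _ c * Giter n b.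
Proof.
elim: n c => // -[_ c _|n IH c _]; last by rewrite !(GiterS (n:=n.+1)) // IH // Tstep_K.
rewrite !Giter1 /phi0 (phi_linear2 erefl l Dx phi_lin (e1 e) (e2 e)) rmorphM.
rewrite -[stalk_map (e2 e) c]/(stalk_K e c) TR_K.
by have -> : c ^+ (p ^ (1 * e - e)) = c by rewrite mul1n subnn expn0 expr1.
Qed.

(** A scalar is a sum of products of a function from [X] and a constant. The first enters the
    argument of [Giter] as a [p ^ (n * e)]-th power, the second as a function pulled back from
    [V]. *)
Lemma Giter_ideal n s b : (0 < n)%N -> exists b', s * Giter n b = Giter n b'.
Proof.
move=> n_gt0; have := stalk_gen s; elim/tens_ind => [|s1 s2 [b1 H1] [b2 H2]|a c].
- by exists 0; rewrite mul0r raddf0.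
- by exists (b1 + b2); rewrite mulrDl H1 H2 raddfD.
exists (a ^+ (p ^ (n * e)) * (stalk_map erefl c * b)).
by rewrite Giter_I // Giter_K // mulrA.
Qed.

(** On generators both sides are the value of [phi] on the factor from [X] times a constant. This
    compatibility with base change is what pushes an inclusion of images from one exponent to the
    next. *)
Lemma Tstep_TR n m (h : (n * e <= m * e)%N) (h' : (n.+1 * e <= m.+1 * e)%N) s :
  Tstep m (TR h s) = TR h' (Tstep n s).
Proof.
have := stalk_gen s; elim/tens_ind => [|s1 s2 H1 H2|b c].
- by rewrite !raddf0.
- by rewrite !raddfD H1 H2.
rewrite rmorphM TR_I TR_K !TstepE [RHS]rmorphM TR_K (TR_comp _ _ (le1 m)).
by have -> : (m.+1 * e - n.+1 * e)%N = (m * e - n * e)%N by rewrite !mulSn subnDl.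
Qed.

(** [Jiter n m] is the stalk of the image of [sigma n (x) A^(1/p^me)]. *)
Definition Jiter n m (h : (n * e <= m * e)%N) (s : stalk (pt (m * e)%N)) :=
  exists bc : seq (stalk x * stalk (f x)), s = \sum_(i <- bc) TR h (Giter n i.1) * stalk_K _ i.2.

Lemma Jiter_ind n m (h : (n * e <= m * e)%N) (P : stalk (pt (m * e)%N) -> Prop) :
  P 0 -> (forall s t, P s -> P t -> P (s + t)) ->
  (forall b c, P (TR h (Giter n b) * stalk_K _ c)) -> forall s, Jiter h s -> P s.
Proof. by move=> P0 PD PG _ [bc ->]; apply: (big_ind P) => // i _; exact: PG. Qed.
Lemma Jiter0 n m (h : (n * e <= m * e)%N) : Jiter h 0.
Proof. by exists [::]; rewrite big_nil. Qed.
Lemma JiterD n m (h : (n * e <= m * e)%N) s t : Jiter h s -> Jiter h t -> Jiter h (s + t).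
Proof. by move=> [bc ->] [bc' ->]; exists (bc ++ bc'); rewrite big_cat. Qed.
Lemma JiterG n m (h : (n * e <= m * e)%N) b c : Jiter h (TR h (Giter n b) * stalk_K _ c).
Proof. by exists [:: (b, c)]; rewrite big_seq1. Qed.
Lemma JiterK n m (h : (n * e <= m * e)%N) s c : Jiter h s -> Jiter h (s * stalk_K _ c).
Proof.
elim/Jiter_ind => [|s1 s2 H1 H2|b d]; first by rewrite mul0r; exact: Jiter0.
  by rewrite mulrDl; exact: JiterD.
by rewrite -mulrA -rmorphM; exact: JiterG.
Qed.

(** Writing [phi^1 b] as a sum of terms [a (x) c] and applying [phi (x) id] gives multiples of
    [phi a] by constants, which is the first case; each further case results from the preceding one
    by applying [phi (x) id]. *)
Lemma Giter_Jiter n b : (0 < n)%N -> Jiter (leS n) (Giter n.+1 b).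
Proof.
elim: n b => // n IH b _; rewrite GiterS //.
case: n IH => [_|n IH].
  have := stalk_gen (Giter 1 b); elim/tens_ind => [|s1 s2 H1 H2|a c].
  - by rewrite raddf0; exact: Jiter0.
  - by rewrite raddfD; exact: JiterD.
  rewrite TstepE -(TR_comp (le1 0) (leS 1)) -Giter1; exact: JiterG.
elim/Jiter_ind: (IH b isT) => [|s1 s2 H1 H2|a c].
- by rewrite raddf0; exact: Jiter0.
- by rewrite raddfD; exact: JiterD.
rewrite mulrC Tstep_K (Tstep_TR _ (leS n.+2)) -GiterS // mulrC; exact: JiterG.
Qed.

Lemma Giter_Jiter_le n m (h : (n * e <= m * e)%N) b : (0 < n)%N -> (n <= m)%N ->
  Jiter h (Giter m b).
Proof.
move=> n_gt0; elim: m h b => [|m IH] h b; first by rewrite leqNgt n_gt0.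
rewrite leq_eqVlt => /orP [/eqP nm|nm].
  move: h; rewrite nm => h; rewrite -[Giter _ b](TR_id h) -(mulr1 (TR _ _)) -(rmorph1 (stalk_K _)).
  exact: JiterG.
have h0 : (n * e <= m * e)%N by rewrite leq_mul2r (nm : (n <= m)%N) orbT.
have m_gt0 : (0 < m)%N := leq_trans n_gt0 nm.
elim/Jiter_ind: (Giter_Jiter b m_gt0) => [|s1 s2|a c]; [exact: Jiter0|exact: JiterD|].
apply: JiterK; elim/Jiter_ind: (IH h0 a nm) => [|s1 s2 H1 H2|a' c'].
- by rewrite rmorph0; exact: Jiter0.
- by rewrite rmorphD; exact: JiterD.
by rewrite rmorphM TR_K (TR_comp _ _ h); exact: JiterG.
Qed.

Section Stable.
Variables (n0 : nat) (n0_gt0 : (0 < n0)%N).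
Hypothesis stable : forall b, exists b', TR (leS n0) (Giter n0 b) = Giter n0.+1 b'.

Lemma stable_step n b : (n0 <= n)%N -> exists b', TR (leS n) (Giter n b) = Giter n.+1 b'.
Proof.
elim: n b => [|n IH] b; first by rewrite leqNgt n0_gt0.
rewrite leq_eqVlt => /orP [/eqP <-|nn]; first exact: stable.
have n_gt0 : (0 < n)%N := leq_trans n0_gt0 nn.
have [b' E] := IH b nn; exists b'.
by rewrite GiterS // -(Tstep_TR (leS n)) E -GiterS.
Qed.

Lemma stable_le n m (h : (n * e <= m * e)%N) b : (n0 <= n)%N -> (n <= m)%N ->
  exists b', TR h (Giter n b) = Giter m b'.
Proof.
move=> n0n; have n_gt0 : (0 < n)%N := leq_trans n0_gt0 n0n.
elim: m h => [|m IH] h; first by rewrite leqNgt n_gt0.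
rewrite leq_eqVlt => /orP [/eqP nm|nm].
  by move: h; rewrite -nm => h; exists b; rewrite TR_id.
have h0 : (n * e <= m * e)%N by rewrite leq_mul2r (nm : (n <= m)%N) orbT.
have [b' E] := IH h0 nm; have [b'' F] := stable_step b' (leq_trans n0n nm).
by exists b''; rewrite -F -E (TR_comp _ _ h).
Qed.

Lemma stable_sigma n m (h : (n * e <= m * e)%N) s : (n0 <= n)%N -> (n <= m)%N ->
  (exists b, s = Giter m b) <-> Jiter h s.
Proof.
move=> n0n nm; have n_gt0 : (0 < n)%N := leq_trans n0_gt0 n0n.
split=> [[b ->]|]; first exact: Giter_Jiter_le.
elim/Jiter_ind => [|s1 s2 [b1 ->] [b2 ->]|b c].
- by exists 0; rewrite raddf0.
- by exists (b1 + b2); rewrite raddfD.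
have [b' ->] := stable_le h b n0n nm; rewrite mulrC.
exact: (Giter_ideal _ _ (leq_trans n_gt0 nm)).
Qed.
End Stable.

End Iterate.

(** * Comparison with the perfect generic fibre *)

Section PerfectPoint.
Variables (p : nat) (p_pr : prime p) (V : scheme) (hV : has_char p V).
Variable G : perfect_generic_point p V.
Local Notation Y := (pg_Y G).
Local Notation gY := (pg_mor G).
Let hY : has_char p Y := has_char_dom gY hV.

Definition frobY n : {rmorphism sec (otop Y) -> sec (otop Y)} :=
  @comor Y Y (frob p_pr hY n) (otop Y) (otop Y) (fun _ _ => I).
Lemma frobYE n c : frobY n c = c ^+ (p ^ n).
Proof. by rewrite /frobY /= /frob_fun res_id. Qed.

Lemma rootY_exists n : exists k : {rmorphism sec (otop Y) -> sec (otop Y)},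
  (forall c, k c ^+ (p ^ n) = c) /\ (forall c, k (c ^+ (p ^ n)) = c).
Proof.
have [th thK Kth] := pg_theta_bij G.
have inj : injective (frobY n).
  apply: raddf_inj => c; rewrite -[X in X = 0]/(frobY n c) frobYE -(Kth c) -rmorphXn => E.
  have := can_inj thK (etrans E (esym (rmorph0 (pg_theta G)))).
  by move/eqP; rewrite expf_eq0 => /andP [_ /eqP ->]; rewrite rmorph0.
have surj c : exists d, c = frobY n d.
  rewrite -(Kth c); have [k kE] : exists k, k ^+ (p ^ n) = th c.
    elim: n {inj} => [|m [k kE]]; first by exists (th c); rewrite expr1.
    have [k' k'E] := (pg_perfect G).1 k; exists k'.
    by rewrite expnS exprM k'E.
  by exists (pg_theta G k); rewrite frobYE -rmorphXn kE.
have [k [kK Kk]] := rmorph_inv inj surj.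
by exists k; split=> c; rewrite -frobYE ?kK ?Kk.
Qed.

Definition rootY n : {rmorphism sec (otop Y) -> sec (otop Y)} := sval (cid (rootY_exists n)).
Lemma rootYK n c : rootY n c ^+ (p ^ n) = c.
Proof. exact: (svalP (cid (rootY_exists n))).1. Qed.
Lemma rootYX n c : rootY n (c ^+ (p ^ n)) = c.
Proof. exact: (svalP (cid (rootY_exists n))).2. Qed.
Lemma rootY_comp m n c : rootY m (rootY n c) = rootY (m + n) c.
Proof. by rewrite -[in RHS](rootYK n c) -[in RHS](rootYK m (rootY n c)) -exprM -expnD rootYX. Qed.
Lemma rootY_X m n c : rootY (m + n) c ^+ (p ^ m) = rootY n c.
Proof. by rewrite -rootY_comp rootYK. Qed.

Definition RY n : mor Y Y := aff_mor (pg_affine G) (rootY n).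
Lemma frob_RY n : frob p_pr hY n ∘m RY n =m idm Y.
Proof.
have m1 : maps (frob p_pr hY n ∘m RY n) (otop Y) (otop Y) by [].
have m2 : maps (idm Y) (otop Y) (otop Y) by [].
apply: (aff_uniq (mF:=m1) (mG:=m2) (pg_affine G)) => c.
have k1 : maps (RY n) (otop Y) (otop Y) by [].
have k2 : maps (frob p_pr hY n) (otop Y) (otop Y) by [].
rewrite (comor_comp m1 k1 k2) aff_morE [comor k2 c]/= /frob_fun res_id rootYX.
by rewrite /= /id_comor res_id.
Qed.

Variables (X : scheme) (f : mor X V) (XF : frob_base_changes p_pr f hV).
Variable XK : fiber_product f gY.

Lemma wK_comm N : f ∘m fp1 XK =m frob p_pr hV N ∘m (gY ∘m (RY N ∘m fp2 XK)).
Proof.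
apply: mor_trans (fp_comm XK) _; apply: mor_sym.
apply: mor_trans (cmorA _ _ _) _.
apply: mor_trans (cmor_congl _ (mor_sym (frob_comm p_pr gY hY hV N))) _.
apply: mor_trans (mor_sym (cmorA _ _ _)) _; apply: cmor_congr.
apply: mor_trans (cmorA _ _ _) _.
apply: mor_trans (cmor_congl _ (frob_RY N)) _.
exact: cmor_idl.
Qed.

(** The projection of [X x Spec K] to [X_{V^N}], over the map [Spec K -> V^N]
    that extends the [p ^ N]-th root on [k(V)]. *)
Definition wK N : mor XK (XF N) := fp_lift (XF N) (wK_comm N).
Lemma wK1 N : fp1 (XF N) ∘m wK N =m fp1 XK. Proof. exact: fp_lift1. Qed.
Lemma wK2 N : fp2 (XF N) ∘m wK N =m gY ∘m (RY N ∘m fp2 XK). Proof. exact: fp_lift2. Qed.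

Section Point.
Variables (z : XK) (x : X) (ex : fp1 XK z = x).

Lemma wK_pt N : wK N z = rel_frob XF N x.
Proof. by rewrite -(rel_frobK (wK N z)) [fp1 (XF N) _]((wK1 N).1 z) ex. Qed.

Lemma fx_eta : f x = pg_eta G.
Proof. by rewrite -ex -(pg_mor_eta (fp2 XK z)); exact: (fp_comm XK).1. Qed.

Definition WS N : {rmorphism stalk (rel_frob XF N x) -> stalk z} := stalk_map (wK_pt N).

Let topz : oset (otop XK) z := I.
Let mtop : maps (fp2 XK) (otop XK) (otop Y) := fun _ _ => I.
(** The stalk as an algebra over [K], with [K] in the guise of the global sections of its
    spectrum. *)
Definition QK : {rmorphism sec (otop Y) -> stalk z} := (germ topz \o comor mtop)%FUN.

Lemma WS_I N a : WS N (stalk_I XF x N a) = stalk_map ex a.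
Proof.
have E : (fp1 (XF N) ∘m wK N) z = x by rewrite /= /comp_fun wK_pt fp1K.
by rewrite /WS -(stalk_map_comp (wK_pt N) (fp1K XF N x) E); apply: stalk_map_eq; exact: wK1.
Qed.

Lemma gY_maps (C : opens V) : oset C (f x) -> maps gY (otop Y) C.
Proof. by move=> hC y _; rewrite pg_mor_eta -fx_eta. Qed.

Lemma WS_K_germ N (C : opens V) (hC : oset C (f x)) (c : sec C) (mC : maps gY (otop Y) C) :
  WS N (stalk_K XF x N (germ hC c)) = QK (rootY N (comor mC c)).
Proof.
have E : (fp2 (XF N) ∘m wK N) z = f x by rewrite /= /comp_fun wK_pt (fp2_pt erefl (fp1K XF N x)).
have E' : (gY ∘m (RY N ∘m fp2 XK)) z = f x by rewrite /= /comp_fun pg_mor_eta fx_eta.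
rewrite /WS /stalk_K -(stalk_map_comp (wK_pt N) _ E) (stalk_map_eq E E' _ (wK2 N)).
have m1 : maps (RY N ∘m fp2 XK) (otop XK) (otop Y) by [].
have m2 : maps (gY ∘m (RY N ∘m fp2 XK)) (otop XK) C by move=> w _; exact: mC.
have m3 : maps (RY N) (otop Y) (otop Y) by [].
rewrite (stalk_mapE E' hC c topz m2) (comor_comp m2 m1 mC) (comor_comp m1 mtop m3).
by rewrite aff_morE.
Qed.

Lemma WS_K (c : stalk (f x)) : exists k, forall N, WS N (stalk_K XF x N c) = QK (rootY N k).
Proof.
have [C [hC [c0 ->]]] := germ_surj c.
by exists (comor (gY_maps hC) c0) => N; exact: WS_K_germ.
Qed.

(** Since [K] is purely inseparable over [k(V)], a power [p ^ n] of any element lies in the stalk of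
    [V] at the generic point. This point is [f x], so the power comes from [X]. *)
Lemma QK_rad k : exists r b, QK k ^+ (p ^ r) = stalk_map ex b.
Proof.
have [th thK Kth] := pg_theta_bij G.
have [_ perf] := pg_perfect G; have [n [y E]] := perf (th k).
have [_ surj _] := pg_stalk G; have [C [hC [c Ec]]] := surj y.
have fC : oset C (f x) by rewrite fx_eta.
exists n, (stalk_map erefl (germ fC c)).
have mC : maps gY (otop Y) C by move=> w _; rewrite pg_mor_eta.
have -> : QK k ^+ (p ^ n) = QK (comor mC c).
  by rewrite -rmorphXn (pg_comor hC) Ec -E [pg_theta _ _]rmorphXn Kth.
have E1 : (f ∘m fp1 XK) z = f x by rewrite /= /comp_fun ex.
rewrite -(stalk_map_comp ex erefl E1).
have m1 : maps (f ∘m fp1 XK) (otop XK) C.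
  by move=> w _; rewrite [(f ∘m fp1 XK) w]((fp_comm XK).1 w) /= /comp_fun pg_mor_eta.
have m2 : maps (gY ∘m fp2 XK) (otop XK) C by move=> w _; exact: mC.
rewrite (stalk_mapE E1 fC c topz m1) ((fp_comm XK).2 _ _ m1 m2).
by rewrite (comor_comp m2 mtop mC).
Qed.

Lemma XK_gen (s : stalk z) : tens (stalk_map ex) QK s.
Proof.
have [V0 hv aV] := sch_affine (f x).
have [U [aU Ux UV]] := affine_nbhd (W:=pre f V0) (x:=x) hv.
have mU : maps f U V0 by exact: UV.
have mC : maps gY (otop Y) V0 by move=> w _; rewrite pg_mor_eta -fx_eta.
have hy : oset (otop Y) (fp2 XK z) by [].
apply: (fib_gen (ey:=erefl) aU (pg_affine G) aV mU mC Ux (hy:=hy) p_pr).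
- by move=> b; rewrite (stalk_mapE erefl hy b topz mtop).
- exact: (stalk_char (has_char_dom (fp1 XK) (has_char_dom f hV))).
- exact: QK_rad.
Qed.

Variables (e : nat) (L : Omod X) (Lp : tensor_powers L).
Variables (tr : forall i k, mor (XF k) (XF i)) (tr_spec : frob_transitions tr).
Variable LF : forall i, module_pullback (fp1 (XF i)) L.
Variables (phi : addhom (fp1 (XF e)) L (Oreg (XF e))).
Variable phib : forall j, addhom (tr j (e + j)%N) (LF j) (Oreg (XF (e + j)%N)).
Hypothesis phib_spec : frob_twists phi phib.
Variable phin : forall n,
  addhom (fp1 (XF (n * e)%N)) (Lp (tw_exp p e n)) (Oreg (XF (n * e)%N)).
Hypothesis phin_spec : relative_iterates phi phib phin.

(** The maps from the generic fibre to the [X_N] are compatible because the [p ^ (k - i)]-th power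
    of a [p ^ k]-th root in [K] is the [p ^ i]-th root. *)
Lemma WS_TR i k (h : (i <= k)%N) s : WS k (TR tr_spec x h s) = WS i s.
Proof.
have := stalk_gen s; elim/tens_ind => [|s1 s2 H1 H2|a c].
- by rewrite !rmorph0.
- by rewrite !rmorphD H1 H2.
rewrite !rmorphM TR_I TR_K !WS_I; congr (_ * _).
have [d Hd] := WS_K c; rewrite !rmorphXn !Hd.
by rewrite -rmorphXn -[in rootY k d](subnK h) rootY_X.
Qed.

Variable LK : module_pullback (fp1 XK) L.
Variable XK1 : fiber_product f (gY ∘m frob p_pr (has_char_dom gY hV) e).
Variables (u : mor XK1 (XF e)) (j : mor XK1 XK).
Hypothesis uj_spec : base_change_projections u j.
Variables (phiK : addhom j LK (Oreg XK1)) (phiK_spec : is_base_change u phi phiK).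
Variables (psi : addhom (idm XK) LK (Oreg XK)) (psi_spec : untwist phiK psi).
Variables (LKp : tensor_powers LK).
Variable psin : forall n, addhom (idm XK) (LKp (tw_exp p e n)) (Oreg XK).
Hypothesis psin_spec : absolute_iterates psi psin.
Variables (D : opens X) (l : L D) (Dx : oset D x).

Lemma jinv_comm : f ∘m fp1 XK =m (gY ∘m frob p_pr (has_char_dom gY hV) e) ∘m (RY e ∘m fp2 XK).
Proof.
apply: mor_trans (wK_comm e) _; apply: mor_trans (cmorA _ _ _) _.
by apply: cmor_congl; apply: mor_sym; exact: frob_comm.
Qed.
(** The base change of the inverse of Frobenius on [Spec K]. Pulling back along it recovers [psi]
    from [phiK] and turns [u] into [wK e]. *)
Definition jinv : mor XK XK1 := fp_lift XK1 jinv_comm.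

Lemma j_jinv : j ∘m jinv =m idm XK.
Proof.
have [_ _ [j1 j2]] := uj_spec.
apply: (@fp_uniq _ _ _ _ _ XK).
  apply: mor_trans (cmorA _ _ _) _; apply: mor_trans (cmor_congl _ j1) _.
  by apply: mor_trans (fp_lift1 XK1 jinv_comm) _; apply: mor_sym; exact: cmor_idr.
apply: mor_trans (cmorA _ _ _) _; apply: mor_trans (cmor_congl _ j2) _.
apply: mor_trans (mor_sym (cmorA _ _ _)) _.
apply: mor_trans (cmor_congr _ (fp_lift2 XK1 jinv_comm)) _.
apply: mor_trans (cmorA _ _ _) _; apply: mor_trans (cmor_congl _ (frob_RY e)) _.
by apply: mor_trans (cmor_idl _) _; apply: mor_sym; exact: cmor_idr.
Qed.

Lemma u_jinv : u ∘m jinv =m wK e.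
Proof.
have [_ [u1 u2] _] := uj_spec.
apply: (@fp_uniq _ _ _ _ _ (XF e)).
  apply: mor_trans (cmorA _ _ _) _; apply: mor_trans (cmor_congl _ u1) _.
  by apply: mor_trans (fp_lift1 XK1 jinv_comm) _; apply: mor_sym; exact: wK1.
apply: mor_trans (cmorA _ _ _) _; apply: mor_trans (cmor_congl _ u2) _.
apply: mor_trans (mor_sym (cmorA _ _ _)) _.
apply: mor_trans (cmor_congr _ (fp_lift2 XK1 jinv_comm)) _.
by apply: mor_sym; exact: wK2.
Qed.

Let Dz : oset (pre (fp1 XK) D) z. Proof. by rewrite /= ex. Qed.
Definition Psi0 : {additive stalk z -> stalk z} :=
  sh psi (pullback_gen LK l) (erefl : idm XK z = z) Dz.
Definition Psi n : {additive stalk z -> stalk z} :=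
  sh (psin n) (gen_pow LKp (pullback_gen LK l) (tw_exp p e n)) (erefl : idm XK z = z) Dz.

(** This is the formula defining the base change, pulled back along [jinv]; the root of [k] is the
    trace of the identification of [K ^ (1 / p ^ e)] with [K]. *)
Lemma Psi0E b k : Psi0 (stalk_map ex b * QK k) =
  WS e (phi0 phi l Dx b) * QK (rootY e k).
Proof.
pose z1 := jinv z.
have jz : j z1 = z by exact: j_jinv.1.
have uz : u z1 = rel_frob XF e x by rewrite -wK_pt; exact: u_jinv.1.
have z1E : jinv z = z1 by [].
have Ej s : stalk_map z1E (stalk_map jz s) = s.
  have E : (j ∘m jinv) z = z by exact: jz.
  by rewrite -(stalk_map_comp z1E jz E) stalk_map_id //; exact: j_jinv.
have PsiK s : stalk_map jz (Psi0 s) = sh phiK (pullback_gen LK l) jz Dz s.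
  have [U [hU [Uz [s0 ->]]]] := germ_in Dz s.
  have m : maps (idm XK) U U by [].
  rewrite /Psi0 (shE psi _ erefl Dz hU Uz s0 Uz m).
  have hW : oset (pre j U) z1 by rewrite /= jz.
  rewrite (stalk_mapE jz Uz _ hW (pre_maps _ _)).
  rewrite (shE phiK _ jz Dz hU Uz s0 hW (pre_maps _ _)); congr (germ hW _).
  exact: psi_spec.
have v1 : fp2 XK1 z1 = fp2 XK1 z1 by [].
have v0 : fp2 XK z = fp2 XK1 z1 by rewrite -jz; have [_ _ [_ [H _]]] := uj_spec; exact: H.
have hv : oset (otop Y) (fp2 XK1 z1) by [].
have hz1 : oset (otop XK1) z1 by [].
have m1 : maps (fp2 XK1) (otop XK1) (otop Y) by [].
rewrite -(Ej (Psi0 _)) PsiK.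
have -> : QK k = stalk_map v0 (germ hv k) by rewrite (stalk_mapE v0 hv k topz mtop).
rewrite (base_change_stalk phiK_spec l Dx ex v0 v1 jz uz (fp1K XF e x)) rmorphM.
congr (_ * _).
  have E : (u ∘m jinv) z = rel_frob XF e x by exact: uz.
  by rewrite -(stalk_map_comp z1E uz E) (stalk_map_eq E (wK_pt e) _ u_jinv).
rewrite (stalk_mapE v1 hv k hz1 m1).
have m2 : maps jinv (otop XK) (otop XK1) by [].
rewrite (stalk_mapE z1E hz1 _ topz m2).
have m3 : maps (fp2 XK1 ∘m jinv) (otop XK) (otop Y) by [].
have m4 : maps (RY e ∘m fp2 XK) (otop XK) (otop Y) by [].
have m5 : maps (RY e) (otop Y) (otop Y) by [].
rewrite -(comor_comp m3 m2 m1) ((fp_lift2 XK1 jinv_comm).2 _ _ m3 m4) (comor_comp m4 mtop m5).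
by rewrite aff_morE.
Qed.

Lemma Psi1 s : Psi 1 s = Psi0 s.
Proof.
have [U [hU [Uz [s0 ->]]]] := germ_in Dz s.
have m : maps (idm XK) U U by [].
rewrite /Psi0 (shE psi _ erefl Dz hU Uz s0 Uz m) (shE (psin 1) _ erefl Dz hU Uz s0 Uz m).
congr (germ Uz _); rewrite -(psin_spec.1 U U m); congr (psin 1 U U m _).
by rewrite gen_pow_res /= -blZl.
Qed.

Lemma PsiS n s : (0 < n)%N -> Psi n.+1 s = Psi0 (Psi n s).
Proof.
move=> n_gt0; have [U [hU [Uz [s0 ->]]]] := germ_in Dz s.
have m : maps (idm XK) U U by [].
rewrite (shE (psin n) _ erefl Dz hU Uz s0 Uz m) (shE (psin n.+1) _ erefl Dz hU Uz s0 Uz m).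
rewrite /Psi0 (shE psi _ erefl Dz hU Uz _ Uz m); congr (germ Uz _).
rewrite !gen_pow_res [gen_pow _ _ (tw_exp p e n.+1)]/(gen_pow _ _ (p ^ (n * e) + tw_exp p e n)).
by rewrite -tp_mul_gen (psin_spec.2 n n_gt0 _ _ m).
Qed.

(** The link between the two sides: by [XK_gen] the elements [b (x) k] span the stalk of the generic
    fibre, so all values of [psi^n] are combinations over [K] of values of [phi^n]. *)
Lemma PsiE n b k : (0 < n)%N -> Psi n (stalk_map ex b * QK k) =
  WS (n * e)%N (Giter phin l Dx n b) * QK (rootY (n * e)%N k).
Proof.
elim: n b k => // -[_ b k _|n IH b k _].
  rewrite Psi1 Psi0E (Giter1 tr_spec phin_spec l Dx) WS_TR.
  by have -> : rootY (1 * e)%N k = rootY e k by rewrite mul1n.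
rewrite PsiS // IH // (@GiterS _ _ _ _ _ _ _ _ _ _ _ tr_spec _ _ _ _ phin_spec _ l _ Dx n.+1) //.
set s := Giter _ _ _ _ _; set k' := rootY _ k.
have -> : rootY (n.+2 * e)%N k = rootY e k' by rewrite rootY_comp.
(* The origin of [s] is forgotten: any element of the stalk is a sum of terms [a (x) c], on which
   [Tstep] and [Psi0] are both explicit. *)
clearbody s k'; have := stalk_gen s; elim/tens_ind => [|s1 s2 H1 H2|a c].
- by rewrite !raddf0 !mul0r raddf0.
- by rewrite !raddfD !mulrDl raddfD H1 H2.
rewrite (TstepE tr_spec phib_spec l Dx) !rmorphM WS_TR WS_I.
have [d Hd] := WS_K c; rewrite !Hd -mulrA -rmorphM Psi0E !rmorphM rootY_comp.
by rewrite mulrA.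
Qed.

Hypothesis gen : generates l.
Variable n0 : nat.
Hypothesis n0_stable : forall n, (n0 <= n)%N -> forall (W : opens XK) (s : Oreg XK W),
  image_sheaf (psin n) s <-> image_sheaf (psin n0) s.

Lemma Psi_stable s : exists s', Psi n0 s = Psi n0.+1 s'.
Proof.
have [U [hU [Uz [s0 ->]]]] := germ_in Dz s.
have m : maps (idm XK) U U by [].
rewrite (shE (psin n0) _ erefl Dz hU Uz s0 Uz m); set y := psin n0 U U m _.
have im : image_sheaf (psin n0) y.
  by move=> w Uw; exists U, (@osub_refl _ _); split=> //; exists U, m; eexists; rewrite mres_id.
have {im} := (n0_stable (leqnSn n0) y).2 im => /(_ z Uz).
have gK : generates (gen_pow LKp (pullback_gen LK l) (tw_exp p e n0.+1)).
  by apply: generates_pow; exact: generates_pullback.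
move=> /(image_sheaf_at (psin n0.+1) (erefl : idm XK z = z) Dz Uz y gK) [s' E].
by exists s'; rewrite -E.
Qed.

End Point.
End PerfectPoint.

(** * Descent along a field extension *)

Section Quotient.
Variables (R : comPzRingType) (I : set R) (hI : is_ideal I).

Let idE a b : a = b -> I (a - b).
Proof. by move=> ->; rewrite subrr; exact: ideal0. Qed.

Definition ideal_setoid : setoid_ring.
Proof.
refine (@SetoidRing R (fun a b => I (a - b)) 0 1 (fun a => - a) (fun a b => a + b)
  (fun a b => a * b) _ _ _ _ _ _ _ _ _ _ _ _ _ _).
- by move=> a; exact: idE.
- by move=> a b H; rewrite -opprB; exact: idealN.
- by move=> a b c H H'; rewrite -(subrK b a) -addrA; exact: idealD.
- by move=> a b H; rewrite -opprD; exact: idealN.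
- by move=> a b c H; rewrite opprD addrACA subrr addr0.
- by move=> a b c H; rewrite -mulrBl mulrC; exact: idealM.
- by move=> a b c; apply: idE; rewrite addrA.
- by move=> a b; apply: idE; rewrite addrC.
- by move=> a; apply: idE; rewrite add0r.
- by move=> a; apply: idE; rewrite addNr.
- by move=> a b c; apply: idE; rewrite mulrA.
- by move=> a b; apply: idE; rewrite mulrC.
- by move=> a; apply: idE; rewrite mul1r.
- by move=> a b c; apply: idE; rewrite mulrDl.
Defined.

Lemma quotient_exists : exists (E : comPzRingType) (h : {rmorphism R -> E}),
  forall a, h a = 0 <-> I a.
Proof.
pose h (a : R) : qring ideal_setoid := @qpi ideal_setoid a.
have h_nmod : nmod_morphism h by split=> [|x y]; rewrite /h -?qpi0 -?qpiD.
have h_monoid : monoid_morphism h by split=> [|x y]; rewrite /h -?qpi1 -?qpiM.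
have [hh hhE] := rmorphism_of h_nmod h_monoid.
exists (qring ideal_setoid : comPzRingType), hh => a.
rewrite hhE -qpi0 qpi_eq /=.
by rewrite subr0.
Qed.
End Quotient.

Section Descent.
Import mpoly.
Local Open Scope ring_scope.
Variables (A R : comNzRingType) (k K : fieldType) (m : nat).
Variables (kap : {rmorphism A -> R}) (g : 'I_m -> R) (J : set R) (hJ : is_ideal J).
Variables (gam : {rmorphism A -> k}) (iota : {rmorphism k -> K}).
Hypothesis gam_inj : injective gam.
Hypothesis gam_frac : forall c, exists a b, gam a != 0 /\ gam a * c = gam b.

(** The [A]-subalgebra generated by the [g i], as an inductive predicate, so that identities on it
    can be proved by induction on how an element is built. *)
Inductive gen_subring : R -> Prop :=
| gsC a : gen_subring (kap a)
| gsG i : gen_subring (g i)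
| gsD x y : gen_subring x -> gen_subring y -> gen_subring (x + y)
| gsM x y : gen_subring x -> gen_subring y -> gen_subring (x * y).

Lemma gen_subring_spec : subring_spec gen_subring.
Proof.
split; [|move=> x Hx|exact: gsD|exact: gsM].
  by rewrite -(rmorph1 kap); exact: gsC.
by rewrite -mulN1r -(rmorphN1 kap); apply: gsM => //; exact: gsC.
Qed.

Lemma common_denominator r (c : 'I_r -> k) :
  exists a (b : 'I_r -> A), a != 0 /\ forall j, gam a * c j = gam (b j).
Proof.
have H j := cid (gam_frac (c j)); pose a j := sval (H j).
have H' j := cid (svalP (H j)); pose b j := sval (H' j).
have aP j : gam (a j) != 0 by case: (svalP (H' j)).
have E j : gam (a j) * c j = gam (b j) by case: (svalP (H' j)).
exists (\prod_j a j), (fun j => \prod_(i | i != j) a i * b j); split=> [|j].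
  apply: contraTneq isT => /(congr1 gam); rewrite rmorph0 rmorph_prod => /eqP.
  by rewrite prodf_seq_eq0 => /hasP [i _ /=]; rewrite (negPf (aP i)).
by rewrite (bigD1 j) //= !rmorphM -E mulrA [gam (a j) * _]mulrC.
Qed.

Let mp (y : {mpoly A[m]}) : {mpoly K[m]} := map_mpoly (iota \o gam) y.

(** The rank of a matrix over [k] is the same over [K], so that a linear combination
    with coefficients in [K] can be replaced by one over [k]; then clear denominators. *)
Lemma mpoly_descent (y : {mpoly A[m]}) (l : seq (K * {mpoly A[m]})) :
  mp y = \sum_(i <- l) i.1 *: mp i.2 ->
  exists a (b : 'I_(size l) -> A), a != 0 /\
    a *: y = \sum_(i < size l) b i *: (nth (0, 0) l i).2.
Proof.
move=> E; pose yl i : {mpoly A[m]} := (nth (0, 0) l i).2.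
(* The monomials that occur in [y] or in [l]. Taking coefficients at them turns the relation into
   membership in a row space. *)
pose ms : seq 'X_{1..m} := msupp y ++ flatten [seq msupp i.2 | i <- l].
pose n := size ms; pose mon (i : 'I_n) : 'X_{1..m} := tnth (in_tuple ms) i.
pose z : 'rV[k]_n := \row_i gam (y@_(mon i)).
pose Y : 'M[k]_(size l, n) := \matrix_(j, i) gam ((yl j)@_(mon i)).
have : (map_mx iota z <= map_mx iota Y)%MS.
  apply/submxP; exists (\row_(j < size l) (nth (0, 0) l j).1).
  apply/rowP => i; rewrite !mxE.
  have := congr1 (mcoeff (mon i)) E; rewrite mcoeff_map_mpoly /= => ->.
  rewrite (big_nth (0, 0)) big_mkord raddf_sum /=; apply: eq_bigr => j _.
  by rewrite mcoeffZ mcoeff_map_mpoly !mxE.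
rewrite map_submx => /submxP [c cE].
have [a [b [a0 ab]]] := common_denominator (fun j => c ord0 j).
exists a, b; split=> //; apply/mpolyP => q.
rewrite mcoeffZ raddf_sum /=.
have [qms|qms] := boolP (q \in ms); last first.
  have out : forall w, w \in y :: map snd l -> w@_q = 0.
    move=> w; rewrite inE => /orP [/eqP ->|/mapP [i il ->]]; apply: memN_msupp_eq0;
      move: qms; rewrite mem_cat negb_or => /andP [q1 q2] //.
    by apply: contra q2 => H; apply/flattenP; exists (msupp i.2) => //; exact: map_f.
  rewrite out ?mem_head // mulr0 big1 // => i _; rewrite mcoeffZ out ?mulr0 //.
  by rewrite inE; apply/orP; right; apply: map_f; exact: mem_nth.
have [i ->] : exists i, q = mon i.
  by move: (qms) => /(nthP q) [i il <-]; exists (Ordinal il); rewrite /mon (tnth_nth q).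
apply: gam_inj; rewrite rmorphM rmorph_sum /=.
have := congr1 (fun w : 'rV_n => w ord0 i) cE; rewrite !mxE => ->.
rewrite big_distrr; apply: eq_bigr => j _ /=.
by rewrite mcoeffZ rmorphM -ab mxE mulrA.
Qed.

(** [E] is [K[X_1,...,X_m] / I], where [I] is spanned over [K] by the polynomials
    over [A] whose value lies in [J]: it plays the role of [(R / J) (x)_A K]. *)
Lemma descent_ring : exists (E : comPzRingType) (th : {rmorphism subring_of gen_subring_spec -> E})
    (eK : {rmorphism K -> E}),
  [/\ forall r a, sub_val r = kap a -> th r = eK (iota (gam a)),
      forall r, J (sub_val r) -> th r = 0 &
      forall r, th r = 0 -> exists a, a != 0 /\ J (kap a * sub_val r)].
Proof.
pose ev : {rmorphism {mpoly A[m]} -> R} := mmap kap g.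
pose mpr : {rmorphism {mpoly A[m]} -> {mpoly K[m]}} := map_mpoly (iota \o gam).
pose IK : set {mpoly K[m]} := [set w | exists l : seq (K * {mpoly A[m]}),
  (forall i, i \in l -> J (ev i.2)) /\ w = \sum_(i <- l) i.1 *: mpr i.2].
have hIK : is_ideal IK.
  have IK0 : IK 0 by exists [::]; rewrite big_nil.
  have IKD v w : IK v -> IK w -> IK (v + w).
    move=> [l [gl ->]] [l' [gl' ->]]; exists (l ++ l'); rewrite big_cat.
    by split=> // i; rewrite mem_cat => /orP [/gl|/gl'].
  (* A polynomial over [K] is a combination of monomials, and a monomial times a polynomial over [A]
     with value in [J] is another one. *)
  split=> // w _ [l [gl ->]]; rewrite [w]mpolyE big_distrl /=.
  apply: (big_ind IK) => // q _; exists [seq (w@_q * i.1, 'X_[q] * i.2) | i <- l].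
  split; first by move=> _ /mapP [i /gl il ->] /=; rewrite rmorphM; exact: idealM.
  rewrite big_map big_distrr /=; apply: eq_bigr => i _.
  by rewrite rmorphM -scalerAl -scalerAr scalerA; congr (_ *: (_ * _)); rewrite /mpr /= map_mpolyX.
have [E [pi piE]] := quotient_exists hIK.
have [psi psiE] : exists psi : {rmorphism {mpoly A[m]} -> E}, forall y, psi y = pi (mpr y).
  by exists (pi \o mpr)%FUN.
have psiJ y : J (ev y) -> psi y = 0.
  move=> Jy; rewrite psiE; apply/piE; exists [:: (1, y)]; rewrite big_seq1 scale1r.
  by split=> // i; rewrite inE => /eqP ->.
have surj r : gen_subring r -> exists y, ev y = r.
  elim=> [a|i|x x' _ [y <-] _ [y' <-]|x x' _ [y <-] _ [y' <-]].
  - by exists a%:MP; rewrite /ev /= mmapC.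
  - by exists 'X_i; rewrite /ev /= mmapX mmap1U.
  - by exists (y + y'); rewrite rmorphD.
  - by exists (y * y'); rewrite rmorphM.
(* The class of any polynomial with value [r]: two of them differ by a polynomial with value 0,
   which belongs to [J]. *)
pose th (r : subring_of gen_subring_spec) : E := psi (sval (cid (surj _ (svalP r)))).
have thE r y : ev y = sub_val r -> th r = psi y.
  move=> Er; apply/eqP; rewrite -subr_eq0 -rmorphB; apply/eqP/psiJ.
  by rewrite rmorphB (svalP (cid (surj _ (svalP r)))) Er subrr; exact: ideal0.
have lift r : exists y, ev y = sub_val r /\ th r = psi y.
  by have [y Ey] := surj _ (svalP r); exists y; split=> //; exact: thE.
have th_nmod : nmod_morphism th.
  split=> [|r s]; first by rewrite (thE _ 0) ?rmorph0.
  have [y [Ey ->]] := lift r; have [y' [Ey' ->]] := lift s.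
  by rewrite -rmorphD; apply: thE; rewrite !rmorphD Ey Ey'.
have th_monoid : monoid_morphism th.
  split=> [|r s]; first by rewrite (thE _ 1) ?rmorph1.
  have [y [Ey ->]] := lift r; have [y' [Ey' ->]] := lift s.
  by rewrite -rmorphM; apply: thE; rewrite !rmorphM Ey Ey'.
have [thh thhE] := rmorphism_of th_nmod th_monoid.
have [eK eKE] : exists eK : {rmorphism K -> E}, forall c, eK c = pi c%:MP.
  by exists (pi \o (@mpolyC m K))%FUN.
exists E, thh, eK; split=> [r a Er|r Jr|r].
- rewrite thhE (thE _ a%:MP) ?psiE ?eKE; last by rewrite /ev /= mmapC Er.
  by rewrite /mpr /= map_mpolyC.
- have [y [Ey]] := lift r; rewrite thhE => ->; apply: psiJ.
  by rewrite Ey.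
(* A vanishing class is a relation with coefficients in [K]; after multiplication with a nonzero [a]
   it becomes one over [A], and applying [ev] lands in [J]. *)
- have [y [Ey]] := lift r; rewrite thhE => ->; rewrite psiE => /piE [l [gl El]].
  have [a [b [a0 abE]]] := mpoly_descent El.
  exists a; split=> //; rewrite -Ey -[kap a](mmapC g kap) -[mmap _ _ _]/(ev _) -rmorphM.
  rewrite mul_mpolyC abE rmorph_sum; apply: (big_ind J).
  + exact: ideal0.
  + by move=> *; exact: idealD.
  + move=> i _; rewrite -mul_mpolyC rmorphM; apply: idealM => //.
    by apply: gl; exact: mem_nth.
Qed.

End Descent.

(** * Finiteness and presentations *)

Section FrobeniusSpan.
Variables (A B : comPzRingType) (h : {rmorphism A -> B}) (q : nat) (q_gt0 : (0 < q)%N).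

(** Membership in the span of [M] over the subring generated by the [q]-th powers and the image of
    [A]. *)
Definition frob_span (M : seq B) (b : B) := exists l : seq (B * A * B),
  (forall i, i \in l -> i.2 \in M) /\ b = \sum_(i <- l) i.1.1 ^+ q * h i.1.2 * i.2.

(** The monomials in the generators with all exponents less than [q] suffice: divide the exponents
    by [q] with remainder. *)
Lemma finite_type_frob_span : finite_type_algebra h -> exists M, forall b, frob_span M b.
Proof.
move=> [d [g ft]]; pose mon (k : 'I_d -> nat) : B := \prod_i g i ^+ k i.
pose M := [seq mon (fun i => k i) | k : {ffun 'I_d -> 'I_q}].
have monM k : (forall i, (k i < q)%N) -> mon k \in M.
  move=> kq; have -> : mon k = mon (fun i => [ffun i => Ordinal (kq i)] i).
    by apply: eq_bigr => i _; rewrite ffunE.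
  by apply/mapP; exists [ffun i => Ordinal (kq i)]; rewrite ?mem_enum.
have span0 c a m : frob_span M (c ^+ q * h a * mon m).
  exists [:: (c * mon (fun i => (m i %/ q)%N), a, mon (fun i => (m i %% q)%N))].
  split; first by move=> i; rewrite inE => /eqP -> /=; apply: monM => j; rewrite ltn_pmod.
  have E : mon m = mon (fun i => (m i %/ q)%N) ^+ q * mon (fun i => (m i %% q)%N).
    rewrite /mon -prodrXl -big_split /=; apply: eq_bigr => i _.
    by rewrite -exprM -exprD -divn_eq.
  by rewrite big_seq1 /= exprMn {1}E mulrA; congr (_ * _); exact: mulrAC.
have spanD x y : frob_span M x -> frob_span M y -> frob_span M (x + y).
  move=> [l [gl ->]] [l' [gl' ->]]; exists (l ++ l'); rewrite big_cat.
  by split=> // i; rewrite mem_cat => /orP [/gl|/gl'].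
have span_0 : frob_span M 0 by exists [::]; rewrite big_nil.
have monD k k' : mon k * mon k' = mon (fun i => k i + k' i)%N.
  by rewrite /mon -big_split; apply: eq_bigr => i _; rewrite exprD.
have inM y : y \in M -> exists k, y = mon k.
  by move=> /mapP [k _ ->]; eexists.
exists M; apply: ft => [a|i|//|].
- rewrite -[h a]mul1r -[1 * _]mulr1 -{1}(expr1n _ q); have <- : mon (fun=> 0%N) = 1.
    by rewrite /mon big1 // => i _; rewrite expr0.
  exact: span0.
- have -> : g i = 1 ^+ q * h 1 * mon (fun j => (j == i) : nat).
    rewrite expr1n rmorph1 !mul1r /mon (bigD1 i) //= eqxx expr1 big1 ?mulr1 // => j.
    by move/negPf ->; rewrite expr0.
  exact: span0.
move=> _ _ [l [gl ->]] [l' [gl' ->]]; rewrite big_distrl /= big_seq.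
apply: (big_ind (frob_span M)) => // i /gl/inM [k ->].
rewrite big_distrr /= big_seq; apply: (big_ind (frob_span M)) => // j /gl'/inM [k' ->].
have -> : i.1.1 ^+ q * h i.1.2 * mon k * (j.1.1 ^+ q * h j.1.2 * mon k') =
   (i.1.1 * j.1.1) ^+ q * h (i.1.2 * j.1.2) * mon (fun i => k i + k' i)%N.
  by rewrite -monD exprMn rmorphM; ring.
exact: span0.
Qed.

End FrobeniusSpan.

Lemma pring_lift (A : comPzRingType) (I : Type) (F : I -> comPzRingType)
    (h : forall i, {rmorphism A -> F i}) :
  exists k : {rmorphism A -> pring F}, forall a i, (k a : pring F) i = h i a.
Proof.
pose k a : pring F := fun i => h i a.
have k_nmod : nmod_morphism k.
  by split=> [|x y]; apply: functional_extensionality_dep => i; rewrite /k ?rmorph0 ?rmorphD.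
have k_monoid : monoid_morphism k.
  by split=> [|x y]; apply: functional_extensionality_dep => i; rewrite /k ?rmorph1 ?rmorphM.
by have [kk kkE] := rmorphism_of k_nmod k_monoid; exists kk => a i; rewrite kkE.
Qed.

(** * The function field *)

Section GenericPoint.
Variables (p : nat) (V : scheme) (V_int : integral_scheme V) (G : perfect_generic_point p V).
Variables (V0 : opens V) (aV : affine V0) (hV0 : oset V0 (pg_eta G)).

Lemma pg_germ_neq0 (W : opens V) (hW : oset W (pg_eta G)) (s : sec W) :
  pg_germ hW s <> 0 <-> unit_at s (pg_eta G).
Proof.
have [comp surj ker] := pg_stalk G; split=> [s0|[T [h [Te [t E]]]] s0].
  have [T [hT [t Et]]] := surj (pg_germ hW s)^-1.
  pose T' := oI W T; have hT' : oset T' (pg_eta G) by [].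
  have [|T'' [h [Te E]]] := ker T' hT' (res oIl s * res oIr t - 1).
    rewrite rmorphB rmorphM rmorph1 (comp _ _ _ hW) (comp _ _ _ hT) Et divff ?subrr //.
    exact/eqP.
  exists T'', (osub_trans h oIl); split=> //; exists (res (osub_trans h oIr) t).
  by move: E; rewrite rmorphB rmorphM rmorph1 !resE => /eqP; rewrite subr_eq0 => /eqP.
have := congr1 (pg_germ Te) E; rewrite rmorphM rmorph1 (comp _ _ _ hW) s0 mul0r.
by move/esym/eqP; rewrite oner_eq0.
Qed.

(** A section that vanishes near the generic point is killed by a power of some [s] that is a unit
    there. In a domain one of the two factors is zero, and it is not the power of [s]. *)
Lemma pg_germ_inj : injective (pg_germ hV0).
Proof.
have [comp surj ker] := pg_stalk G.
apply: raddf_inj => a /ker [W [h [We E]]].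
have [s [[_ su] sW]] := affine_basis aV hV0 We; have [_ _ _ _ A5] := aV.
have [|n En] := A5 s a; first by rewrite (res_irr _ (osub_trans sW h)) -resE E rmorph0.
have [_ dom] := V_int.2 V0 (ex_intro _ _ hV0).
have [|//] := dom _ _ En; move=> sn0; exfalso.
have /pg_germ_neq0 s0 := su; apply: (s0 hV0); apply/eqP.
by have := congr1 (pg_germ hV0) sn0; rewrite rmorphXn rmorph0 => /eqP; rewrite expf_eq0 => /andP [].
Qed.

Lemma pg_germ_frac (c : pg_k G) : exists a b, pg_germ hV0 a != 0 /\ pg_germ hV0 a * c = pg_germ hV0 b.
Proof.
have [comp surj ker] := pg_stalk G; have [W [hW [w <-]]] := surj c.
have [s [se sW]] := affine_basis aV hV0 hW; have [_ _ _ A4 _] := aV.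
have [n [b E]] := A4 s (res sW w); exists (s ^+ n), b; split.
  rewrite rmorphXn expf_neq0 //; apply/eqP; apply/pg_germ_neq0; exact: se.2.
rewrite -(comp _ _ sW hW se w) -(comp _ _ (@basic_open_sub _ _ s) hV0 se b) -E rmorphM.
by rewrite !rmorphXn (comp _ _ _ hV0).
Qed.

End GenericPoint.

Section Spread.
Variables (p : nat) (p_pr : prime p) (X V : scheme) (f : mor X V) (hV : has_char p V).
Variable XF : frob_base_changes p_pr f hV.
Variables (V0 : opens V) (aV : affine V0) (U0 : opens X) (aU : affine U0).
Variable mU : maps f U0 V0.

Definition germI N x (hx : oset U0 x) (b : sec U0) := stalk_I XF x N (germ hx b).
Definition germK N x (hx : oset U0 x) (a : sec V0) := stalk_K XF x N (germ (mU hx) a).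

Lemma pt_in N (D : opens X) x : oset D x -> oset (pre (fp1 (XF N)) D) (rel_frob XF N x).
Proof. by rewrite /= fp1K. Qed.

(** One finite expression for [s z], valid at all points of [D] and [U0] where [s] is a unit, with
    coefficients from the fixed sets [U0] and [V0]. It places the whole family of germs of [z] in
    the subring generated by these coefficients and the inverse of [s]. *)
Definition presented N (D : opens X) (z : sec (pre (fp1 (XF N)) D)) (s : sec U0) :=
  exists l : seq (sec U0 * sec V0), forall x (hx : oset U0 x) (Dx : oset D x),
    unit_at s x -> germI N hx s * germ (pt_in N Dx) z = \sum_(i <- l) germI N hx i.1 * germK N hx i.2.

Lemma presentedM N D (z : sec (pre (fp1 (XF N)) D)) s t :
  presented z s -> presented z (s * t).
Proof.
move=> [l E]; exists [seq (t * i.1, i.2) | i <- l] => x hx Dx su.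
have /(unit_at_mul _ _ hx) [su' _] := su.
rewrite big_map /germI !rmorphM mulrAC (E x hx Dx su') mulrC big_distrr /=.
by apply: eq_bigr => i _; rewrite !rmorphM mulrA.
Qed.

(** At [x0] the stalk is generated by functions on [V0] and germs from [X], which are fractions of
    sections over [U0]; the resulting equality of germs persists on a neighbourhood. *)
Lemma present1 N D (z : sec (pre (fp1 (XF N)) D)) x0 : oset U0 x0 -> oset D x0 ->
  exists s, [/\ unit_at s x0, osub (basic_open s) D & presented z s].
Proof.
move=> h0 D0; set z0 := rel_frob XF N x0.
have [Q QE] := rmorph_comp_ex (stalk_K XF x0 N) (germ (mU h0)).
have := XF_gen_affine erefl (fp1K XF N x0) aV QE (germ (pt_in N D0) z).
move=> tz; have {tz} [s [l [su E]]] : exists s (l : seq (sec U0 * sec V0)), unit_at s x0 /\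
    germI N h0 s * germ (pt_in N D0) z = \sum_(i <- l) germI N h0 i.1 * germK N h0 i.2.
  elim/tens_ind: tz => [|y y' [s [l [su E]]] [s' [l' [su' E']]]|b a].
  - by exists 1, [::]; rewrite big_nil mulr0; split=> //; exact: unit_at1 h0.
  - exists (s * s'), ([seq (s' * i.1, i.2) | i <- l] ++ [seq (s * i.1, i.2) | i <- l']).
    split; first exact/unit_at_mul.
    rewrite big_cat !big_map /germI !rmorphM mulrDr; congr (_ + _).
      rewrite mulrAC -/(germI N h0 s) E mulrC big_distrr /=; apply: eq_bigr => i _.
      by rewrite !rmorphM mulrA.
    rewrite -mulrA -/(germI N h0 s') E' big_distrr /=; apply: eq_bigr => i _.
    by rewrite !rmorphM mulrA.
  - have [s [t [su E]]] := affine_stalk aU h0 b.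
    exists s, [:: (t, a)]; split=> //; rewrite big_seq1 /= /germI -E rmorphM -mulrA; congr (_ * _).
    by rewrite QE.
pose O := pre (fp1 (XF N)) (oI U0 D).
have hO : oset O z0 by split; rewrite /= fp1K.
have kD : osub O (pre (fp1 (XF N)) D) by move=> w [].
have kU : maps (fp1 (XF N)) O U0 by move=> w [].
have kV : maps (fp2 (XF N)) O V0.
  move=> w [hw _]; have -> : fp2 (XF N) w = f (fp1 (XF N) w) by exact/esym/((fp_comm (XF N)).1 w).
  exact: mU.
have gI x (hx : oset U0 x) (Ox : oset O (rel_frob XF N x)) b :
    germI N hx b = germ Ox (comor kU b).
  by rewrite /germI /stalk_I (stalk_mapE _ hx b Ox kU).
have gK x (hx : oset U0 x) (Ox : oset O (rel_frob XF N x)) a :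
    germK N hx a = germ Ox (comor kV a).
  by rewrite /germK /stalk_K (stalk_mapE _ (mU hx) a Ox kV).
pose lhs := comor kU s * res kD z.
pose rhs := \sum_(i <- l) comor kU i.1 * comor kV i.2.
have lhsE x (hx : oset U0 x) (Dx : oset D x) (Ox : oset O (rel_frob XF N x)) :
    germI N hx s * germ (pt_in N Dx) z = germ Ox lhs.
  by rewrite rmorphM (gI x hx Ox) (germ_res kD (pt_in N Dx)).
have rhsE x (hx : oset U0 x) (Ox : oset O (rel_frob XF N x)) :
    \sum_(i <- l) germI N hx i.1 * germK N hx i.2 = germ Ox rhs.
  by rewrite rmorph_sum; apply: eq_bigr => i _; rewrite rmorphM (gI x hx Ox) (gK x hx Ox).
have := E; rewrite (lhsE x0 h0 D0 hO) (rhsE x0 h0 hO) => /germ_eq [W [k [k' [W0 EW]]]].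
have W1 : oset (oI (pre (rel_frob XF N) W) D) x0 by [].
have [s' [[_ s'u] s'W]] := affine_basis aU h0 W1.
(* The factor [s] clears the denominators, and [s'] confines the points to the neighbourhood on
   which the equality persists. *)
exists (s * s'); split.
- exact/unit_at_mul.
- move=> x [hx /(unit_at_mul _ _ hx) [_ sx]].
  by have [] := s'W x (conj hx sx).
exists [seq (s' * i.1, i.2) | i <- l] => x hx Dx /(unit_at_mul _ _ hx) [_ sx].
have [Wx _] := s'W x (conj hx sx).
have Ox : oset O (rel_frob XF N x) by exact: (k _ Wx).
have EE : germI N hx s * germ (pt_in N Dx) z = \sum_(i <- l) germI N hx i.1 * germK N hx i.2.
  rewrite (lhsE x hx Dx Ox) (rhsE x hx Ox) -(germ_res k Ox Wx) EW.
  exact: germ_res.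
rewrite big_map /germI !rmorphM mulrAC -/(germI N hx s) EE mulrC big_distrr /=.
by apply: eq_bigr => i _; rewrite !rmorphM mulrA.
Qed.

Lemma present_all N D (Z : seq (sec (pre (fp1 (XF N)) D))) x0 : oset U0 x0 -> oset D x0 ->
  exists s, [/\ unit_at s x0, osub (basic_open s) D & forall z, z \in Z -> presented z s].
Proof.
move=> h0 D0; elim: Z => [|z Z [s [su sD IH]]].
  have [s [[_ su] sD]] := affine_basis aU h0 D0.
  by exists s.
have [s' [su' sD' IH']] := present1 z h0 D0.
exists (s * s'); split.
- exact/unit_at_mul.
- move=> x [hx /(unit_at_mul _ _ hx) [sx _]].
  exact: sD (conj hx sx).
- move=> y; rewrite inE => /orP [/eqP ->|/IH]; last exact: presentedM.
  by rewrite mulrC; exact: presentedM.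
Qed.

End Spread.

(** * The image sheaves on stalks *)

Section Sheaves.
Variables (p : nat) (p_pr : prime p) (X V : scheme) (f : mor X V) (hV : has_char p V).
Variables (e : nat) (XF : frob_base_changes p_pr f hV).
Variables (L : Omod X) (Lp : tensor_powers L).
Variables (tr : forall i k, mor (XF k) (XF i)) (tr_spec : frob_transitions tr).
Variable phin : forall n,
  addhom (fp1 (XF (n * e)%N)) (Lp (tw_exp p e n)) (Oreg (XF (n * e)%N)).

Lemma sigma_res n (T T' : opens (XF (n * e)%N)) (h : osub T' T) (s : sec T) :
  sigma phin s -> sigma phin (res h s).
Proof.
move=> sg x T'x; have [W [k [Wx [U [m [y E]]]]]] := sg x (h x T'x).
have mW : maps (fp1 (XF (n * e)%N)) (oI T' W) U by move=> w [_ /m].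
exists (oI T' W), oIl; split=> //; exists U, mW, y.
rewrite -(ah_resr (phin n) (@oIr _ T' W) m mW) E.
rewrite -[LHS]/(res oIr (res k s)) -[RHS]/(res oIl (res h s)) !resE; exact: res_irr.
Qed.

Variables (D : opens X) (l : L D) (x : X) (Dx : oset D x) (gen : generates l).
Local Notation Gn n := (Giter phin l Dx n).
Local Notation pt N := (rel_frob XF N x).

Lemma sigma_germ n (W : opens (XF (n * e)%N)) (Wx : oset W (pt (n * e)%N)) (s : sec W) :
  sigma phin s -> exists b, germ Wx s = Gn n b.
Proof.
move=> /(_ _ Wx) /(image_sheaf_at (phin n) (fp1K XF (n * e)%N x) Dx Wx s) H.
by apply: H; exact: generates_pow.
Qed.

Definition base_change_at n m (W : opens (XF (m * e)%N)) (s : sec W) (z : XF (m * e)%N) :=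
  exists W' (h : osub W' W), oset W' z /\
  exists (T : opens (XF (n * e)%N)) (C : opens V)
      (t : maps (tr (n * e)%N (m * e)%N) W' T) (b : maps (fp2 (XF (m * e)%N)) W' C)
      (k : nat) (y : 'I_k -> sec T) (c : 'I_k -> sec C),
      (forall i, sigma phin (y i)) /\
      res h s = \sum_i comor t (y i) * comor b (c i).

Lemma base_change_germ n m (h : (n * e <= m * e)%N) (W : opens (XF (m * e)%N))
    (Wx : oset W (pt (m * e)%N)) (s : sec W) :
  base_change_at n s (pt (m * e)%N) <-> Jiter tr_spec phin l Dx h (germ Wx s).
Proof.
split=> [[W' [k [Wx' [T [C [t [b [r [y [c [sg E]]]]]]]]]]]|].
  rewrite -(germ_res k Wx Wx') E rmorph_sum.
  apply: big_ind => [|s1 s2|i _]; [exact: Jiter0|exact: JiterD|].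
  have hT : oset T (pt (n * e)%N) by rewrite -(tr_pt_le tr_spec x h); exact: (t _ Wx').
  have hC : oset C (f x) by rewrite -(fp2_pt erefl (fp1K XF (m * e)%N x)); exact: (b _ Wx').
  have [a Ea] := sigma_germ hT (sg i).
  rewrite rmorphM -(stalk_mapE (tr_pt_le tr_spec x h) hT _ Wx' t).
  rewrite -(stalk_mapE (fp2_pt erefl (fp1K XF (m * e)%N x)) hC _ Wx' b) Ea.
  exact: JiterG.
(* The germ is detached from [s] and the open sets may shrink, so that the claim can be proved by
   induction on the sum in [Jiter]. *)
suff H s0 : Jiter tr_spec phin l Dx h s0 -> exists (W' : opens (XF (m * e)%N)) (W'x : oset W' (pt (m * e)%N))
    (T : opens (XF (n * e)%N)) (C : opens V)
    (t : maps (tr (n * e)%N (m * e)%N) W' T) (b : maps (fp2 (XF (m * e)%N)) W' C)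
    (k : nat) (y : 'I_k -> sec T) (c : 'I_k -> sec C),
    (forall i, sigma phin (y i)) /\ s0 = germ W'x (\sum_i comor t (y i) * comor b (c i)).
  move=> /H [W' [W'x [T [C [t [b [k [y [c [sg /germ_eq [W1 [k1 [k2 [W1x E]]]]]]]]]]]]]].
  exists W1, k1; split=> //.
  have t1 : maps (tr (n * e)%N (m * e)%N) W1 T by move=> w /k2 /t.
  have b1 : maps (fp2 (XF (m * e)%N)) W1 C by move=> w /k2 /b.
  exists T, C, t1, b1, k, y, c; split=> //; rewrite E rmorph_sum; apply: eq_bigr => i _.
  by rewrite rmorphM (comor_resr k2 t t1) (comor_resr k2 b b1).
elim/Jiter_ind => [|s1 s2 [W1 [W1x [T1 [C1 [t1 [b1 [k1 [y1 [c1 [sg1 ->]]]]]]]]]]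
    [W2 [W2x [T2 [C2 [t2 [b2 [k2 [y2 [c2 [sg2 ->]]]]]]]]]]|b c].
- have t : maps (tr (n * e)%N (m * e)%N) (otop (XF (m * e)%N)) (otop (XF (n * e)%N)) by [].
  have b : maps (fp2 (XF (m * e)%N)) (otop (XF (m * e)%N)) (otop V) by [].
  exists (otop _), I, (otop _), (otop _), t, b, 0%N, (fun=> 0), (fun=> 0).
  by rewrite big_ord0 rmorph0; split=> // -[].
- have t : maps (tr (n * e)%N (m * e)%N) (oI W1 W2) (oI T1 T2) by move=> w [/t1 ? /t2].
  have b : maps (fp2 (XF (m * e)%N)) (oI W1 W2) (oI C1 C2) by move=> w [/b1 ? /b2].
  have W12 : oset (oI W1 W2) (pt (m * e)%N) by split.
  exists (oI W1 W2), W12, (oI T1 T2), (oI C1 C2), t, b, (k1 + k2)%N.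
  exists (fun i => match fintype.split i with inl i => res oIl (y1 i) | inr i => res oIr (y2 i) end).
  exists (fun i => match fintype.split i with inl i => res oIl (c1 i) | inr i => res oIr (c2 i) end).
  split=> [i|]; first by case: (fintype.split i) => k; exact: sigma_res.
  rewrite big_split_ord rmorphD -(germ_res (@oIl _ W1 W2) W1x W12) -(germ_res (@oIr _ W1 W2) W2x W12).
  rewrite !(rmorph_sum (res _)); congr (_ + _); congr (germ _ _); apply: eq_bigr => i _.
    have tt : maps (tr (n * e)%N (m * e)%N) (oI W1 W2) T1 by move=> w [/t1].
    have bb : maps (fp2 (XF (m * e)%N)) (oI W1 W2) C1 by move=> w [/b1].
    rewrite [fintype.split _](unsplitK (inl i)) rmorphM (comor_resr _ t1 tt) (comor_resr _ b1 bb).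
    by rewrite (comor_resl _ t tt) (comor_resl _ b bb).
  have tt : maps (tr (n * e)%N (m * e)%N) (oI W1 W2) T2 by move=> w [_ /t2].
  have bb : maps (fp2 (XF (m * e)%N)) (oI W1 W2) C2 by move=> w [_ /b2].
  rewrite [fintype.split _](unsplitK (inr i)) rmorphM (comor_resr _ t2 tt) (comor_resr _ b2 bb).
  by rewrite (comor_resl _ t tt) (comor_resl _ b bb).
have [U [hU [Ux [b0 ->]]]] := germ_in Dx b; have [C [hC [c0 ->]]] := germ_surj c.
pose T := pre (fp1 (XF (n * e)%N)) U; have hT : oset T (pt (n * e)%N) by rewrite /= fp1K.
pose W' := oI (pre (tr (n * e)%N (m * e)%N) T) (pre (fp2 (XF (m * e)%N)) C).
have W'x : oset W' (pt (m * e)%N).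
  by split; [rewrite /= (tr_pt_le tr_spec x h) fp1K | rewrite /= (fp2_pt erefl (fp1K XF _ x))].
have t : maps (tr (n * e)%N (m * e)%N) W' T by move=> w [].
have b' : maps (fp2 (XF (m * e)%N)) W' C by move=> w [].
pose y : sec T := phin n U T (pre_maps _ _) (b0 *: mres hU (gen_pow Lp l (tw_exp p e n))).
exists W', W'x, T, C, t, b', 1%N, (fun=> y), (fun=> c0); split=> [i w Tw|].
  exists T, (@osub_refl _ _); split=> //; exists U, (pre_maps _ _); eexists.
  by rewrite mres_id.
rewrite big_ord1 rmorphM /Giter (shE _ _ _ Dx hU Ux b0 hT (pre_maps _ _)).
by rewrite /TR /stalk_K (stalk_mapE _ hT _ W'x t) (stalk_mapE _ hC _ W'x b').
Qed.

End Sheaves.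

(** * Spreading out *)

Section Spreading.
Variables (p : nat) (p_pr : prime p) (X V : scheme) (f : mor X V) (hV : has_char p V).
Variables (V_int : integral_scheme V).
Variables (e : nat) (L : Omod X) (Lp : tensor_powers L).
Variable XF : frob_base_changes p_pr f hV.
Variables (tr : forall i k, mor (XF k) (XF i)) (tr_spec : frob_transitions tr).
Variable LF : forall i, module_pullback (fp1 (XF i)) L.
Variables (phi : addhom (fp1 (XF e)) L (Oreg (XF e))) (phi_lin : relative_linear phi).
Variable phib : forall j, addhom (tr j (e + j)%N) (LF j) (Oreg (XF (e + j)%N)).
Hypothesis phib_spec : frob_twists phi phib.
Variable phin : forall n,
  addhom (fp1 (XF (n * e)%N)) (Lp (tw_exp p e n)) (Oreg (XF (n * e)%N)).
Hypothesis phin_spec : relative_iterates phi phib phin.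
Variable G : perfect_generic_point p V.
Variable XK : fiber_product f (pg_mor G).
Variable LK : module_pullback (fp1 XK) L.
Variable XK1 : fiber_product f (pg_mor G ∘m frob p_pr (has_char_dom (pg_mor G) hV) e).
Variables (u : mor XK1 (XF e)) (j : mor XK1 XK).
Hypothesis uj_spec : base_change_projections u j.
Variables (phiK : addhom j LK (Oreg XK1)) (phiK_spec : is_base_change u phi phiK).
Variables (psi : addhom (idm XK) LK (Oreg XK)) (psi_spec : untwist phiK psi).
Variables (LKp : tensor_powers LK).
Variable psin : forall n, addhom (idm XK) (LKp (tw_exp p e n)) (Oreg XK).
Hypothesis psin_spec : absolute_iterates psi psin.
Variables (n0 : nat) (n0_gt0 : (0 < n0)%N).
Hypothesis n0_stable : forall n, (n0 <= n)%N -> forall (W : opens XK) (s : Oreg XK W),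
  image_sheaf (psin n) s <-> image_sheaf (psin n0) s.

(** The local generator may be chosen separately for each [x], because the images on stalks do not
    depend on it. *)
Definition stable_at (x : X) := exists (D : opens X) (l : L D) (Dx : oset D x),
  generates l /\ forall b, exists b',
    TR tr_spec x (leS e n0) (Giter phin l Dx n0 b) = Giter phin l Dx n0.+1 b'.

Section Affine.
Variables (V0 : opens V) (aV : affine V0) (hV0 : oset V0 (pg_eta G)).
Variables (U0 : opens X) (aU : affine U0).
Variables (mU : maps f U0 V0) (ft : finite_type_algebra (comor mU)).

Section Generic.
Variables (D : opens X) (l : L D).

Local Notation Gn n Dx := (Giter phin l Dx n).

(** A germ [t / s] equals [(1 / s) ^ q * (s ^ (q - 1) * t)], so its denominator is a [q]-th power.
    Such powers and constants come out of [Giter], which leaves the values on [M]. *)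
Lemma Giter_span n (M : seq (sec U0)) x (hx : oset U0 x) (Dx : oset D x)
    (J : set (stalk (rel_frob XF (n * e)%N x))) :
  (0 < n)%N -> (forall b, frob_span (comor mU) (p ^ (n * e)) M b) -> is_ideal J ->
  (forall m, m \in M -> J (Gn n Dx (germ hx m))) -> forall b, J (Gn n Dx b).
Proof.
move=> n_gt0 spanM hJ JM b; set q := (p ^ (n * e))%N in spanM *.
have q_gt0 : (0 < q)%N by rewrite expn_gt0 prime_gt0.
have [s [t [su E]]] := affine_stalk aU hx b.
have [v sv] := unit_at_germ hx su.
have -> : b = v ^+ q * germ hx (s ^+ q.-1 * t).
  transitivity ((germ hx s * v) ^+ q * b); first by rewrite sv expr1n mul1r.
  rewrite rmorphM -E rmorphXn exprMn -{1}(prednK q_gt0) exprSr.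
  by move: (_ ^+ q.-1) (v ^+ q) => c d; ring.
have [lm [Hl ->]] := spanM (s ^+ q.-1 * t).
rewrite rmorph_sum big_distrr raddf_sum /= big_seq.
apply: (big_ind J) => [|y y'|i il]; [exact: ideal0|exact: idealD|].
have -> : v ^+ q * germ hx (i.1.1 ^+ q * comor mU i.1.2 * i.2) =
    (v * germ hx i.1.1) ^+ q * (stalk_map (erefl (f x)) (germ (mU hx) i.1.2) * germ hx i.2).
  rewrite (stalk_mapE erefl (mU hx) i.1.2 hx mU) !rmorphM rmorphXn exprMn; ring.
rewrite (Giter_I tr_spec phi_lin phib_spec phin_spec l Dx) //.
rewrite (Giter_K tr_spec phi_lin phib_spec phin_spec l Dx) //.
by apply: idealM => //; apply: idealM => //; apply: JM; exact: Hl.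
Qed.

(** The germs at all points come from one section, which makes [present_all] applicable to the
    values of the iterates. *)
Lemma Giter_sections n x (hx : oset U0 x) (Dx : oset D x) (hxD : oset (oI U0 D) x) b :
  Gn n Dx (germ hx b) = germ (pt_in XF (n * e)%N hxD)
    (phin n (oI U0 D) (pre (fp1 (XF (n * e)%N)) (oI U0 D)) (pre_maps _ _)
      (res oIl b *: mres oIr (gen_pow Lp l (tw_exp p e n))) : sec _).
Proof.
rewrite -(germ_res (@oIl _ U0 D) hx hxD b) /Giter.
by rewrite (shE (phin n) _ _ Dx oIr hxD _ (pt_in XF (n * e)%N hxD) (pre_maps _ _)).
Qed.

Hypothesis gen : generates l.

Let N := (n0.+1 * e)%N.

(** Let [J] be the ideal of the image of [phi^(n0+1)] in a product of stalks. The ring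
    [E] of [descent_ring] gives a map [Spec E -> XK], and stability over [XK] shows
    that the image of [phi^n0] vanishes in the stalks of [Spec E], hence in [E]. *)
Lemma generic_relation x0 (h0 : oset U0 x0) (D0 : oset D x0) (M M' : seq (sec U0)) :
  (forall b, frob_span (comor mU) (p ^ N) M' b) ->
  exists s : sec U0, [/\ unit_at s x0, osub (basic_open s) D &
    forall m, m \in M -> exists2 a : sec V0, unit_at a (pg_eta G) &
      forall x (hx : oset U0 x) (Dx : oset D x), unit_at s x -> exists b',
        germK XF mU N hx a * TR tr_spec x (leS e n0) (Gn n0 Dx (germ hx m)) =
        Gn n0.+1 Dx b'].
Proof.
move=> spanM'; pose U1 := oI U0 D.
have mtr : maps (tr (n0 * e)%N N) (pre (fp1 (XF N)) U1) (pre (fp1 (XF (n0 * e)%N)) U1).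
  move=> w; rewrite /= (tr_fp1 tr_spec w (esym (subnKC (leS e n0)))) //.
(* The sections [zM m] and [zM' m] carry the values on [m] of [phi^n0] and [phi^(n0+1)], both on
   [X_N]. *)
pose zM m : sec (pre (fp1 (XF N)) U1) := comor mtr
  (phin n0 U1 (pre (fp1 (XF (n0 * e)%N)) U1) (pre_maps _ _)
      (res oIl m *: mres oIr (gen_pow Lp l (tw_exp p e n0))) : sec _).
pose zM' m : sec (pre (fp1 (XF N)) U1) := phin n0.+1 U1 (pre (fp1 (XF N)) U1) (pre_maps _ _)
      (res oIl m *: mres oIr (gen_pow Lp l (tw_exp p e n0.+1))).
have [s [su sD pres]] := present_all aV aU mU (map zM M ++ map zM' M') h0 (conj h0 D0 : oset U1 x0).
have {sD} sD : osub (basic_open s) D by move=> x /sD [].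
exists s; split=> //.
(* All points of the basic open set of [s] are treated at once, so that the denominator found at the
   end does not depend on the point. *)
pose Ix := {x | oset (basic_open s) x}.
pose hU (i : Ix) : oset U0 (sval i) := (svalP i).1.
pose sU (i : Ix) : unit_at s (sval i) := (svalP i).2.
pose hD (i : Ix) : oset D (sval i) := sD _ (svalP i).
pose h1 (i : Ix) : oset U1 (sval i) := conj (hU i) (hD i).
pose F (i : Ix) : comPzRingType := stalk (rel_frob XF N (sval i)).
pose i0 : Ix := exist _ x0 (conj h0 su).
(* Polynomial rings are formed over nonzero rings; the product of the stalks is nonzero because [x0]
   is one of the points. *)
have R0 : (1 : pring F) != 0.
  apply/eqP => E; apply: (@stalk_neq0 (XF N) (rel_frob XF N x0)).
  exact: (congr1 (fun r : pring F => r i0) E).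
have A0 : (1 : sec V0) != 0.
  have [H _] := V_int.2 V0 (ex_intro _ _ hV0); exact/eqP.
pose R : comNzRingType := HB.pack (pring F) (GRing.PzSemiRing_isNonZero.Build (pring F) R0).
pose A : comNzRingType := HB.pack (GRing.ComPzRing.sort (sec V0))
  (GRing.PzSemiRing_isNonZero.Build (sec V0) A0).
have [kap kapE] := pring_lift (fun i => (stalk_K XF (sval i) N \o germ (mU (hU i)))%FUN :
  {rmorphism sec V0 -> F i}).
have [IR IRE] := pring_lift (fun i => (stalk_I XF (sval i) N \o germ (hU i))%FUN :
  {rmorphism sec U0 -> F i}).
have inv_ex (i : Ix) : {v : F i | IR s i * v = 1}.
  by apply: cid; rewrite IRE; apply: (invertible_morph (stalk_I XF (sval i) N)); exact/(germ_unit (hU i)).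
pose inv : pring F := fun i => sval (inv_ex i).
have invE : IR s * inv = 1.
  by apply: functional_extensionality_dep => i; exact: (svalP (inv_ex i)).
pose kapA : {rmorphism A -> R} := kap.
have [d [g0 ftg]] := ft.
(* Index 0 gives the inverse of [s], the other indices the generators of [sec U0] over [sec V0]. *)
pose g (i : 'I_d.+1) : R := oapp (fun k => IR (g0 k)) inv (unlift ord0 i).
pose J : set R := [set r | forall i, exists b', (r : pring F) i = Gn n0.+1 (hD i) b'].
have hJ : is_ideal J.
  split.
  - by move=> i; exists 0; rewrite raddf0.
  - move=> r r' Hr Hr' i; have [b E] := Hr i; have [b' E'] := Hr' i.
    by exists (b + b'); rewrite raddfD -E -E'.
  - move=> r r' Hr i; have [b E] := Hr i.
    have [b' E'] := Giter_ideal tr_spec phi_lin phib_spec phin_spec l (hD i) ((r : pring F) i) b (ltn0Sn n0).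
    by exists b'; rewrite -E' -E.
have [E [th [eK [thK thJ th0]]]] := @descent_ring A R (pg_k G) (pg_K G) d.+1
  kapA g J hJ (pg_germ hV0 : {rmorphism A -> pg_k G}) (pg_incl G)
  (@pg_germ_inj _ _ V_int G V0 aV hV0) (pg_germ_frac aV hV0).
pose gs := gen_subring_spec kapA g.
have gs0 : gen_subring kapA g 0 by rewrite -(rmorph0 kapA); exact: gsC.
have IRbase a : IR (comor mU a) = kap (a ^+ (p ^ N)).
  apply: functional_extensionality_dep => i; rewrite IRE kapE /=.
  by rewrite -(stalk_mapE erefl (mU (hU i)) a (hU i) mU) stalk_I_base !rmorphXn.
have IRgen b : gen_subring kapA g (IR b).
  apply: (ftg (fun b => gen_subring kapA g (IR b))) => [a|i|b1 b2 H1 H2|b1 b2 H1 H2].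
  - by rewrite IRbase; exact: gsC.
  - have -> : IR (g0 i) = g (lift ord0 i) by rewrite /g liftK.
    exact: gsG.
  - by rewrite rmorphD; exact: gsD.
  - by rewrite rmorphM; exact: gsM.
have inv_gen : gen_subring kapA g inv.
  have -> : inv = g ord0 by rewrite /g unlift_none.
  exact: gsG.
have [tB tBE] := sub_lift gs IRgen.
have [eB eBE] := rmorph_comp_ex th tB.
have [hX hXE] := rmorph_comp_ex (Spec_in E) eB.
have [ti [Kti tiK]] : exists k : {rmorphism sec (otop (pg_Y G)) -> pg_K G},
    cancel k (pg_theta G) /\ cancel (pg_theta G) k.
  have [th' H1 H2] := pg_theta_bij G; apply: rmorph_inv; first exact: can_inj H1.
  by move=> w; exists (th' w).
(* A function on [V] that reaches [R] through [X] is the [p ^ N]-th power of the constant it defines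
   on [V^N] ([IRbase]). The map from [Spec E] to [Spec K] is therefore twisted by Frobenius, as the
   square over [V] requires. *)
have [hY1 hY1E] := rmorph_comp_ex ti (frobY p_pr hV G N).
have [hY2 hY2E] := rmorph_comp_ex eK hY1.
have [hY hYE] := rmorph_comp_ex (Spec_in E) hY2.
pose tX := aff_mor aU hX; pose tY := aff_mor (pg_affine G) hY.
have kX : maps tX (otop (Spec E)) U0 by exact: aff_maps.
have kY : maps tY (otop (Spec E)) (otop (pg_Y G)) by [].
have mC : maps (pg_mor G) (otop (pg_Y G)) V0 by move=> w _; rewrite pg_mor_eta.
have comm : f ∘m tX =m pg_mor G ∘m tY.
  have k1 : maps (f ∘m tX) (otop (Spec E)) V0 by move=> w _; exact: mU (kX w I).
  have k2 : maps (pg_mor G ∘m tY) (otop (Spec E)) V0 by move=> w _; exact: mC.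
  apply: (aff_uniq (mF:=k1) (mG:=k2) aV) => a.
  rewrite (comor_comp k1 kX mU) (comor_comp k2 kY mC) !aff_morE hXE hYE hY2E hY1E eBE.
  congr (Spec_in E _); rewrite (thK _ (a ^+ (p ^ N))); last by rewrite tBE.
  by rewrite frobYE (pg_comor hV0) -!rmorphXn tiK.
pose tau := fp_lift XK comm.
(* As the inverse of [s] is among the generators, [Spec E] lies over the basic open set of [s], and
   each of its points selects a factor of the product. *)
have eBs : invertible (eB s).
  exists (th (exist _ inv inv_gen)); rewrite eBE -rmorphM -(rmorph1 th); congr (th _).
  by apply: sub_inj; rewrite -[LHS]/(sub_val (tB s) * inv) tBE.
have Ut t : oset U0 (tX t) by exact: kX.
have st t : unit_at s (tX t).
  have tt : oset (otop (Spec E)) t by [].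
  by apply/aff_unit/(germ_unit tt); rewrite hXE; do 2! apply: invertible_morph.
pose it t : Ix := exist _ (tX t) (conj (Ut t) (st t)).
have ext t : fp1 XK (tau t) = tX t by exact: (fp_lift1 XK comm).1.
pose topt (t : Spec E) : oset (otop (Spec E)) t := I.
(* Evaluation at [t] of one factor of the product, along [Spec E -> XK -> X_N]. *)
pose evt t (w : stalk (rel_frob XF N (tX t))) : stalk t :=
  stalk_map (erefl (tau t)) (WS XF (ext t) N w).
have evt_B t b : evt t (IR b (it t)) = germ (topt t) (Spec_in E (th (tB b))).
  rewrite /evt IRE /= [WS _ _ _ _]WS_I.
  have E1 : (fp1 XK ∘m tau) t = tX t by exact: ext.
  rewrite -(stalk_map_comp (erefl (tau t)) (ext t) E1).
  rewrite (stalk_map_eq E1 (erefl (tX t)) _ (fp_lift1 XK comm)).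
  by rewrite (stalk_mapE erefl (hU (it t)) b (topt t) kX) aff_morE hXE eBE.
have evt_A t a : evt t (kap a (it t)) = germ (topt t) (Spec_in E (eK (pg_incl G (pg_germ hV0 a)))).
  rewrite /evt kapE /= [WS _ _ _ _](WS_K_germ XF (ext t) N (mU (hU (it t))) a mC).
  have mt : maps tau (otop (Spec E)) (otop XK) by [].
  have m2 : maps (fp2 XK) (otop XK) (otop (pg_Y G)) by [].
  have m3 : maps (fp2 XK ∘m tau) (otop (Spec E)) (otop (pg_Y G)) by [].
  rewrite /QK /= (stalk_mapE erefl _ _ (topt t) mt) (comor_irr _ m2) -(comor_comp m3 mt m2).
  rewrite ((fp_lift2 XK comm).2 _ _ m3 kY) aff_morE hYE hY2E hY1E frobYE rootYK.
  by rewrite (pg_comor hV0) tiK.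
(* On the generated subring the evaluation of the factor selected by [t] is [th]. It is enough to
   compare generators; for the inverse of [s] one cancels [s]. *)
have evtE t (r : subring_of gs) : evt t ((sub_val r : pring F) (it t)) = germ (topt t) (Spec_in E (th r)).
  have : gen_subring kapA g (sub_val r) by exact: (svalP r).
  move Er : (sub_val r) => r0 Hr; elim: Hr r Er => [a|i|x x' Hx IHx Hx' IHx'|x x' Hx IHx Hx' IHx'] r Er.
  - by rewrite evt_A (thK r a Er).
  - move: Er; rewrite /g; case: unliftP => [k _|_] /= Er.
      rewrite evt_B; congr (germ _ (Spec_in E (th _))); apply: sub_inj.
      by rewrite -[RHS]/(sub_val r) Er -tBE.
    apply: (@unit_cancel _ (germ (topt t) (Spec_in E (th (tB s))))).
      by rewrite -eBE; do 2! apply: invertible_morph.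
    rewrite -{1}evt_B /evt -!rmorphM.
    have -> : IR s (it t) * inv (it t) = 1 by exact: (congr1 (fun r : pring F => r (it t)) invE).
    rewrite !rmorph1 -[LHS](rmorph1 (germ (topt t))) -(rmorph1 (Spec_in E)) -(rmorph1 th).
    congr (germ _ (Spec_in E (th _))); apply: sub_inj.
    by rewrite -[RHS]/(sub_val (tB s) * sub_val r) tBE Er.
  - have -> : r = (exist _ x Hx : subring_of gs) + (exist _ x' Hx' : subring_of gs) by exact: sub_inj.
    rewrite !rmorphD -(IHx (exist _ x Hx) erefl) -(IHx' (exist _ x' Hx') erefl).
    by rewrite /evt -!rmorphD.
  - have -> : r = (exist _ x Hx : subring_of gs) * (exist _ x' Hx' : subring_of gs) by exact: sub_inj.
    rewrite !rmorphM -(IHx (exist _ x Hx) erefl) -(IHx' (exist _ x' Hx') erefl).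
    by rewrite /evt -!rmorphM.
have pres_gen z : presented mU z s -> exists r : subring_of gs,
    (sub_val r : pring F) = (fun i => germ (pt_in XF N (h1 i)) z).
  move=> [lz Elz]; pose rz : pring F := fun i => germ (pt_in XF N (h1 i)) z.
  have E1 : IR s * rz = \sum_(i <- lz) IR i.1 * kap i.2.
    apply: functional_extensionality_dep => i.
    rewrite (big_morph (fun r : pring F => r i) (id1:=0) (op1:=+%R) (fun _ _ => erefl) erefl).
    have := Elz _ (hU i) (h1 i) (sU i); rewrite /germI /germK => E1.
    transitivity (IR s i * rz i); first by [].
    rewrite IRE /= E1; apply: eq_bigr => k _.
    transitivity (IR k.1 i * kap k.2 i); last by [].
    by rewrite IRE kapE.
  have Hrz : gen_subring kapA g rz.
    have -> : rz = inv * \sum_(i <- lz) IR i.1 * kap i.2.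
      by rewrite -E1 mulrA [inv * _]mulrC invE mul1r.
    apply: gsM => //; apply: (big_ind (gen_subring kapA g)) => // [x y|k _]; first exact: gsD.
    by apply: gsM => //; exact: gsC.
  by exists (exist _ rz Hrz).
have evt0 t : evt t 0 = 0 by rewrite /evt !rmorph0.
(* By [Giter_span] it suffices to consider the members of [M']; the families of their values lie in
   [J], which [th] kills. *)
have kill t (Dt : oset D (tX t)) b : evt t (Gn n0.+1 Dt b) = 0.
  apply: (Giter_span (n:=n0.+1) (M:=M') (hx:=Ut t) (J:=[set w | evt t w = 0])) => // [|m mM].
    split=> [//|w w' Hw Hw'|w w' Hw]; rewrite /= /evt.
      by rewrite !rmorphD [X in X + _]Hw [X in _ + X]Hw' addr0.
    by rewrite !rmorphM [X in _ * X]Hw mulr0.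
  have /pres_gen [r Er] : presented mU (zM' m) s.
    by apply: pres; rewrite mem_cat map_f ?orbT.
  have Jr : J (sub_val r).
    by move=> i; exists (germ (hU i) m); rewrite Er (Giter_sections n0.+1 (hU i) (hD i) (h1 i)).
  have := evtE t r; rewrite (thJ r Jr) !rmorph0 => <-.
  rewrite Er (Giter_sections n0.+1 (Ut t) Dt (h1 (it t))) //.
move=> m mM; have /pres_gen [r Er] : presented mU (zM m) s.
  by apply: pres; rewrite mem_cat map_f.
have rE i : (sub_val r : pring F) i =
    TR tr_spec (sval i) (leS e n0) (Gn n0 (hD i) (germ (hU i) m)).
  rewrite Er (Giter_sections n0 (hU i) (hD i) (h1 i)) /TR.
  by rewrite (stalk_mapE _ (pt_in XF (n0 * e)%N (h1 i)) _ (pt_in XF N (h1 i)) mtr).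
(* Over the generic fibre the family [r] is a value of [psi^n0], hence a value of [psi^(n0+1)]. The
   latter is a combination over [K] of values of [phi^(n0+1)], which [kill] annihilates. *)
have thr0 : th r = 0.
  apply: Spec_inj; rewrite rmorph0; apply: germ_ext => t tt.
  have -> : tt = topt t by exact: Prop_irrelevance.
  rewrite rmorph0 -evtE rE /evt WS_TR //.
  have := PsiE (ext t) tr_spec phib_spec phin_spec uj_spec phiK_spec psi_spec psin_spec
    l (hD (it t)) (germ (hU (it t)) m) 1 n0_gt0.
  rewrite !rmorph1 !mulr1 => <-.
  have [s' ->] := Psi_stable (ext t) (hD (it t)) gen n0_stable
    (stalk_map (ext t) (germ (hU (it t)) m)).
  have := XK_gen p_pr hV (ext t) s'; elim/tens_ind => [|s1 s2 H1 H2|b k].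
  - by rewrite !raddf0.
  - by rewrite [X in stalk_map _ X]raddfD rmorphD H1 H2 addr0.
  rewrite (PsiE (ext t) tr_spec phib_spec phin_spec uj_spec phiK_spec psi_spec psin_spec) //.
  rewrite rmorphM -[X in X * _]/(evt t _) kill mul0r //.
have [a [a0 Ja]] := th0 r thr0; exists a.
  apply/(pg_germ_neq0 hV0) => /eqP E0; move: a0; apply/negP; rewrite negbK.
  by apply/eqP; apply: (pg_germ_inj V_int aV (hV0:=hV0)); rewrite (eqP E0) rmorph0.
move=> x hx Dx sx; pose i : Ix := exist _ x (conj hx sx).
have [b' Eb] := Ja i; exists b'.
have [-> ->] : Dx = hD i /\ hx = hU i by split; exact: Prop_irrelevance.
transitivity (kap a i * (sub_val r : pring F) i); last exact: Eb.
by rewrite kapE rE.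
Qed.
End Generic.

Lemma stable_near (L_line : line_bundle L) x0 : oset U0 x0 -> exists2 s : sec U0, unit_at s x0 &
  exists2 a : sec V0, unit_at a (pg_eta G) &
    forall x, oset U0 x -> unit_at s x -> unit_at a (f x) -> stable_at x.
Proof.
move=> h0; have [D [l [D0 line]]] := L_line x0; have gen := generates_line line.
have p_gt0 k : (0 < p ^ k)%N by rewrite expn_gt0 prime_gt0.
have [M spanM] := finite_type_frob_span (p_gt0 (n0 * e)%N) ft.
have [M' spanM'] := finite_type_frob_span (p_gt0 (n0.+1 * e)%N) ft.
have [s [su sD rel]] := generic_relation gen h0 D0 M spanM'.
exists s => //.
pose ok (a : sec V0) m := forall x (hx : oset U0 x) (Dx : oset D x), unit_at s x -> unit_at a (f x) ->
  exists b', TR tr_spec x (leS e n0) (Giter phin l Dx n0 (germ hx m)) = Giter phin l Dx n0.+1 b'.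
have okM (a a' : sec V0) m : ok a m -> ok (a * a') m.
  by move=> H x hx Dx sx /(unit_at_mul _ _ (mU hx)) [ax _]; exact: H.
have ok1 m : m \in M -> exists2 a : sec V0, unit_at a (pg_eta G) & ok a m.
  move=> /rel [a au H]; exists a => // x hx Dx sx ax; have [b' E] := H x hx Dx sx.
  (* Where [a] is a unit it can be divided out, since the image of the iterate is an ideal. *)
  have [v Ev] : invertible (germK XF mU (n0.+1 * e)%N hx a).
    by apply: invertible_morph; exact/(germ_unit (mU hx)).
  have [b'' E'] := Giter_ideal tr_spec phi_lin phib_spec phin_spec l Dx v b' (ltn0Sn n0).
  by exists b''; rewrite -E' -E mulrA [v * _]mulrC Ev mul1r.
(* The product of the denominators belonging to the members of [M] serves for all of them. *)
have [a au aok] : exists2 a : sec V0, unit_at a (pg_eta G) & forall m, m \in M -> ok a m.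
  have : {subset M <= M} by [].
  elim: {1 3}M => [_|m M1 IH sub]; first by exists 1 => //; exact: unit_at1 hV0.
  have [m' Hm'|a au aok] := IH; first by apply: sub; rewrite inE Hm' orbT.
  have [a' au' aok'] := ok1 m (sub _ (mem_head _ _)).
  exists (a * a'); first exact/unit_at_mul.
  by move=> m'; rewrite inE => /orP [/eqP ->|/aok]; [rewrite mulrC|]; exact: okM.
exists a => // x hx sx ax; have Dx : oset D x := sD x (conj hx sx).
exists D, l, Dx; split=> // b0.
pose J := [set w | exists b', TR tr_spec x (leS e n0) w = Giter phin l Dx n0.+1 b'].
have hJ : is_ideal J.
  split.
  - by exists 0; rewrite !raddf0.
  - by move=> w w' [b E] [b' E']; exists (b + b'); rewrite rmorphD E E' raddfD.
  - move=> w w' [b E]; rewrite /J /= rmorphM E.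
    exact: (Giter_ideal tr_spec phi_lin phib_spec phin_spec).
have JM m : m \in M -> J (Giter phin l Dx n0 (germ hx m)) by move=> /aok H; exact: H.
exact: (Giter_span n0_gt0 spanM hJ JM).
Qed.

(** By quasi-compactness finitely many of the [s] from [stable_near] cover [U0], and the product of
    the corresponding functions on [V0] works for the whole of it. *)
Lemma stable_affine (L_line : line_bundle L) : exists2 a : sec V0, unit_at a (pg_eta G) &
  forall x, oset U0 x -> unit_at a (f x) -> stable_at x.
Proof.
have [S [gS cov]] := affine_qc aU (stable_near L_line).
have [a au aok] : exists2 a : sec V0, unit_at a (pg_eta G) &
    forall s, s \in S -> forall x, oset U0 x -> unit_at s x -> unit_at a (f x) -> stable_at x.
  elim: S gS {cov} => [|s S IH] gS.
    by exists 1 => //; exact: unit_at1 hV0.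
  have [s' Hs'|a au aok] := IH; first by apply: gS; rewrite inE Hs' orbT.
  have [a' au' aok'] := gS s (mem_head _ _).
  exists (a * a'); first exact/unit_at_mul.
  move=> s' Hs' x hx sx /(unit_at_mul _ _ (mU hx)) [ax a'x].
  by move: Hs' sx; rewrite inE => /orP [/eqP ->|/aok H] sx; [apply: aok'|apply: H].
by exists a => // x hx ax; have [s sS sx] := cov x hx; exact: aok sS x hx sx ax.
Qed.

End Affine.

(** The preimage of an affine neighbourhood of the generic point is covered by finitely many affine
    [U i] of finite type; the open set is where the product of their functions on [V0] is a unit. *)
Lemma stable_open (L_line : line_bundle L) (f_ft : finite_type_mor f) :
  exists2 U : opens V, oset U (pg_eta G) & forall x, oset U (f x) -> stable_at x.
Proof.
have [V0 [hV0 aV [r [U [cov UP]]]]] := f_ft (pg_eta G).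
have mU i : maps f (U i) V0 by move=> x Ux; apply/cov; exists i.
have H i := cid2 (stable_affine aV hV0 (UP i).1 ((UP i).2 (mU i)) L_line).
pose a i : sec V0 := s2val (H i).
have au i : unit_at (a i) (pg_eta G) by exact: (s2valP (H i)).
have aok i x : oset (U i) x -> unit_at (a i) (f x) -> stable_at x := s2valP' (H i) x.
have prodE (v : V) : oset V0 v -> unit_at (\prod_i a i) v <-> forall i, unit_at (a i) v.
  move=> hv; split=> [|Ha]; last first.
    apply: (big_ind (fun b => unit_at b v)) => // [|b b' Hb Hb'].
      exact: unit_at1 hv.
    exact/unit_at_mul.
  by move=> Hp i; move: Hp; rewrite (bigD1 i) //= => /(unit_at_mul _ _ hv) [].
exists (basic_open (\prod_i a i)); first by split=> //; exact/prodE.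
move=> x [hx /(prodE _ hx) ax]; have [i Ux] := (cov x).1 hx; exact: aok Ux (ax i).
Qed.

End Spreading.

Theorem proposition3p3
  (p : nat) (p_pr : prime p)
  (X V : scheme) (f : mor X V)
  (X_noeth : noetherian_scheme X) (V_noeth : noetherian_scheme V)
  (V_int : integral_scheme V) (V_exc : excellent_scheme V)
  (V_char : has_char p V)
  (V_dual : exists I : omod_complex V, dualizing_complex I)
  (f_sep : separated_mor f) (f_ft : finite_type_mor f) (f_flat : flat_mor f)
  (f_equidim : equidimensional f) (f_geomred : geometrically_reduced f)
  (e : nat) (e_gt0 : (0 < e)%N)
  (L : Omod X) (L_line : line_bundle L) (Lp : tensor_powers L)
  (* the schemes X_{V^i}, their transition maps, and L (x) R_{A^{1/p^i}} *)
  (XF : frob_base_changes p_pr f V_char)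
  (tr : forall i k, mor (XF k) (XF i)) (tr_spec : frob_transitions tr)
  (LF : forall i, module_pullback (fp1 (XF i)) L)
  (* phi and its iterates phi^n *)
  (phi : addhom (fp1 (XF e)) L (Oreg (XF e))) (phi_lin : relative_linear phi)
  (phib : forall j, addhom (tr j (e + j)%N) (LF j) (Oreg (XF (e + j)%N)))
  (phib_spec : frob_twists phi phib)
  (phin : forall n,
     addhom (fp1 (XF (n * e)%N)) (Lp (tw_exp p e n)) (Oreg (XF (n * e)%N)))
  (phin_spec : relative_iterates phi phib phin)
  (* Spec k(V^oo) -> V, and X_K = X x_V Spec k(V^oo) *)
  (G : perfect_generic_point p V)
  (XK : fiber_product f (pg_mor G)) (LK : module_pullback (fp1 XK) L)
  (* the base change of phi along Spec k(V^oo) -> V *)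
  (XK1 : fiber_product f
           (pg_mor G ∘m frob p_pr (has_char_dom (pg_mor G) V_char) e))
  (u : mor XK1 (XF e)) (j : mor XK1 XK)
  (uj_spec : base_change_projections u j)
  (phiK : addhom j LK (Oreg XK1)) (phiK_spec : is_base_change u phi phiK)
  (* psi_oo and its iterates psi_oo^n *)
  (psi : addhom (idm XK) LK (Oreg XK)) (psi_spec : untwist phiK psi)
  (LKp : tensor_powers LK)
  (psin : forall n, addhom (idm XK) (LKp (tw_exp p e n)) (Oreg XK))
  (psin_spec : absolute_iterates psi psin)
  (n0 : nat) (n0_gt0 : (0 < n0)%N)
  (n0_stable : forall n, (n0 <= n)%N -> forall (W : opens XK) (s : Oreg XK W),
     image_sheaf (psin n) s <-> image_sheaf (psin n0) s) :
  exists U : opens V, (exists v, oset U v) /\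
    forall m n, (n0 <= n)%N -> (n <= m)%N ->
    forall (W : opens (XF (m * e)%N)),
      osub W (pre (fp1 (XF (m * e)%N)) (pre f U)) ->
      forall s : sec W, sigma phin s <-> sigma_base_change tr phin n s.
Proof.
have [U Ueta stab] := stable_open V_int tr_spec phi_lin phib_spec phin_spec uj_spec phiK_spec
  psi_spec psin_spec n0_gt0 n0_stable L_line f_ft.
exists U; split=> [|m n n0n nm W WU s]; first by exists (pg_eta G).
have h : (n * e <= m * e)%N by rewrite leq_mul2r nm orbT.
(* Both conditions are local on [X_(me)], and [z] is the image under [rel_frob] of its projection to
   [X], so they can be compared on the stalks used above. *)
split=> H z Wz; have := H z Wz; move: (Wz); rewrite -[z](rel_frobK z) => Wz'.
  have [D [l [Dx [gen st]]]] := stab _ (WU z Wz).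
  move=> /(image_sheaf_at (phin m) (fp1K XF (m * e)%N (fp1 (XF (m * e)%N) z)) Dx Wz' s (@generates_pow _ L Lp D l (tw_exp p e m) gen)) E.
  apply/(base_change_germ tr_spec phin Dx gen h Wz' s).
  exact: (stable_sigma phi_lin phib_spec phin_spec n0_gt0 st h _ n0n nm).1.
have [D [l [Dx [gen st]]]] := stab _ (WU z Wz).
move=> /(base_change_germ tr_spec phin Dx gen h Wz' s).
move=> /(stable_sigma phi_lin phib_spec phin_spec n0_gt0 st h _ n0n nm) E.
exact/(image_sheaf_at (phin m) (fp1K XF (m * e)%N (fp1 (XF (m * e)%N) z)) Dx Wz' s (@generates_pow _ L Lp D l (tw_exp p e m) gen)).
Qed.
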